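(* Let $\mathcal{F}$ be either $\mathcal{A}$ or $\mathcal{S}$. For every nonempty index $\boldsymbol{k}$ and every integer $m\ge0$, $$\sum_{\substack{\mathrm{wt}(\boldsymbol{e})=m\\ \mathrm{dep}(\boldsymbol{e})=\mathrm{dep}(\boldsymbol{k})}} c_2(\boldsymbol{k},\boldsymbol{e})\,\zeta_{\mathcal{F}}^\star(\boldsymbol{k}\oplus\boldsymbol{e})=-\sum_{\substack{\mathrm{wt}(\boldsymbol{e})=m\\ \mathrm{dep}(\boldsymbol{e})=\mathrm{dep}(\boldsymbol{k}^\vee)}}\zeta_{\mathcal{F}}^\star(\boldsymbol{k}^\vee\oplus\boldsymbol{e}),$$ where in both sums $\boldsymbol{e}$ runs over sequences of nonnegative integers, and $$c_2((k_1,\ldots,k_r),(e_1,\ldots,e_r))=\prod_{i=1}^{r}\binom{k_i+e_i+\delta_{i,1}+\delta_{i,r}-2}{e_i},$$ with the convention that $\binom{n-1}{n}=1$ if $n=0$ and $\binom{n-1}{n}=0$ otherwise ($n\ge0$).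
   Context: An index is a (possibly empty) finite sequence of positive integers. For a finite sequence $\boldsymbol{k}=(k_1,\ldots,k_r)$ of nonnegative integers, $\mathrm{wt}(\boldsymbol{k})=k_1+\cdots+k_r$ and $\mathrm{dep}(\boldsymbol{k})=r$. For two sequences of the same depth, $\boldsymbol{k}\oplus\boldsymbol{l}$ is their componentwise sum. $\delta_{i,j}$ is the Kronecker delta. $\{1\}^m$ denotes $1,\ldots,1$ ($m$ times). Hoffman's dual: a nonempty index of depth at least $2$ is written uniquely as $\boldsymbol{k}=(a_0,\{1\}^{b_1-1},a_1+1,\{1\}^{b_2-1},a_2+1,\ldots,\{1\}^{b_{s-1}-1},a_{s-1}+1,\{1\}^{b_s-1},a_s)$ with $s\ge1$ and integers $a_p,b_q\ge1$, and $\boldsymbol{k}^\vee=(\{1\}^{a_0-1},b_1+1,\{1\}^{a_1-1},b_2+1,\ldots,b_s+1,\{1\}^{a_s-1})$. For depth one, $(k)^\vee=(\{1\}^k)$. Finite multiple zeta-star values: let $\mathcal{A}=\prod_p\mathbb{F}_p/\bigoplus_p\mathbb{F}_p$, with $p$ running over all primes. For positive integers $k_1,\ldots,k_r$, $$\zeta_{\mathcal{A}}^\star(k_1,\ldots,k_r)=\Bigl(\sum_{1\le m_1\le\cdots\le m_r<p}\frac{1}{m_1^{k_1}\cdots m_r^{k_r}}\bmod p\Bigr)_p\in\mathcal{A}.$$ Symmetric multiple zeta-star values: for an index $(k_1,\ldots,k_r)$ with $k_r\ge2$ let $\zeta(k_1,\ldots,k_r)=\sum_{1\le n_1<\cdots<n_r}n_1^{-k_1}\cdots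 n_r^{-k_r}$ and $\zeta^\star(k_1,\ldots,k_r)=\sum_{1\le n_1\le\cdots\le n_r}n_1^{-k_1}\cdots n_r^{-k_r}$, with $\zeta(\emptyset)=\zeta^\star(\emptyset)=1$. Let $\mathcal{Z}\subset\mathbb{R}$ be the $\mathbb{Q}$-linear span of all multiple zeta values $\zeta(\boldsymbol{k})$ (including $\zeta(\emptyset)=1$); it is a $\mathbb{Q}$-algebra. For positive integers $k_1,\ldots,k_r$, $$\zeta_{\mathcal{S}}^\star(k_1,\ldots,k_r)=\sum_{i=0}^{r}(-1)^{k_{i+1}+\cdots+k_r}\zeta^\star(k_1,\ldots,k_i)\,\zeta^\star(k_r,\ldots,k_{i+1})\bmod\zeta(2)\in\mathcal{Z}/\zeta(2)\mathcal{Z},$$ where $\zeta^\star$ at an index whose last component is $1$ means the regularized value. One may use the harmonic regularization: for any index there is a unique polynomial $Q$ such that $\sum_{1\le n_1\le\cdots\le n_r\le N}n_1^{-k_1}\cdots n_r^{-k_r}=Q(\log N+\gamma)+O(N^{-1}(\log N)^J)$ as $N\to\infty$ for some $J$ (with $\gamma$ Euler's constant), and the regularized value is $Q(0)$. The class modulo $\zeta(2)\mathcal{Z}$ is the same if the shuffle regularization is used instead. *)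

(* Defs.v *)
From HB Require Import structures.
From mathcomp Require Import all_boot all_order all_algebra.
From mathcomp Require Import generic_quotient ring_quotient.
From mathcomp Require Import all_classical all_reals.
From mathcomp Require Import topology normedtype landau sequences exp.

Set Implicit Arguments.
Unset Strict Implicit.
Unset Printing Implicit Defensive.

Import Order.TTheory GRing.Theory Num.Theory.
Import numFieldNormedType.Exports.

Local Open Scope ring_scope.
Local Open Scope quotient_scope.
Local Open Scope classical_set_scope.

Definition is_index (k : seq nat) : bool := all (fun a => 0 < a)%N k.

Definition wt (k : seq nat) : nat := sumn k.

Definition dep (k : seq nat) : nat := size k.

Definition oplus (k l : seq nat) : seq nat :=
  [seq (x.1 + x.2)%N | x <- zip k l].

Definition vals n r (e : r.-tuple 'I_n) : seq nat := [seq val i | i <- e].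

(* Truncated subtraction gives the convention for 'C(n - 1, n): the upper entry
   is -1 only when k_i = 1, e_i = 0 and i is interior, and then 'C(0, 0) = 1. *)
Definition c2 (k e : seq nat) : nat :=
  (\prod_(i < dep k)
     'C(nth 0 k i + nth 0 e i + (i == 0 :> nat) + (i == (dep k).-1 :> nat) - 2,
        nth 0 e i))%N.

(* The block data (a_0, [:: (b_1, a_1); ...; (b_s, a_s)]) encodes
     a_0, {1}^(b_1 - 1), a_1 + 1, ..., {1}^(b_s - 1), a_s. *)
Fixpoint index_of_blocks_tail (bs : seq (nat * nat)) : seq nat :=
  match bs with
  | [::] => [::]
  | [:: (b, a)] => nseq b.-1 1%N ++ [:: a]
  | (b, a) :: bs' => nseq b.-1 1%N ++ a.+1 :: index_of_blocks_tail bs'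
  end.

Definition index_of_blocks (a0 : nat) (bs : seq (nat * nat)) : seq nat :=
  a0 :: index_of_blocks_tail bs.

Definition dual_of_blocks (a0 : nat) (bs : seq (nat * nat)) : seq nat :=
  nseq a0.-1 1%N ++ flatten [seq x.1.+1 :: nseq x.2.-1 1%N | x <- bs].

Definition pos_blocks (a0 : nat) (bs : seq (nat * nat)) : bool :=
  [&& 0 < a0, bs != [::] & all (fun x => (0 < x.1) && (0 < x.2)) bs]%N.

(* [blocks_of b t] recovers the blocks from the index without its first entry;
   b - 1 is the number of ones read so far in the current run. *)
Fixpoint blocks_of (b : nat) (t : seq nat) : seq (nat * nat) :=
  match t with
  | [::] => [::]
  | [:: x] => [:: (b, x)]
  | x :: t' => if (x <= 1)%N then blocks_of b.+1 t'
               else (b, x.-1) :: blocks_of 1 t'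
  end.

Definition hoffman_dual (k : seq nat) : seq nat :=
  match k with
  | [::] => [::]
  | [:: a] => nseq a 1%N
  | a0 :: t => dual_of_blocks a0 (blocks_of 1 t)
  end.

Lemma blocks_of_nseq c n y t :
  blocks_of c (nseq n 1%N ++ y :: t) = blocks_of (c + n) (y :: t).
Proof.
elim: n c => [|n IH] c; first by rewrite addn0.
rewrite addnS -addSn -IH.
by case: n {IH} => [|n] //.
Qed.

Lemma blocks_of_tail bs :
  all (fun x => (0 < x.1) && (0 < x.2))%N bs ->
  blocks_of 1 (index_of_blocks_tail bs) = bs.
Proof.
elim: bs => // -[b a] bs IH /= /andP[/andP[b0 a0] h].
have E : (1 + b.-1)%N = b by rewrite add1n prednK.
case: bs IH h => [|x bs] IH h; first by rewrite blocks_of_nseq /= E.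
rewrite blocks_of_nseq E -[in RHS](IH h).
have : index_of_blocks_tail (x :: bs) != [::].
  by case: (x) => b' a' /=; case: (bs) => [|? ?]; case: (b'.-1).
case: (index_of_blocks_tail _) => // u v _.
by rewrite /= ltnS leqn0 (gtn_eqF a0).
Qed.

Lemma hoffman_dual_blocks a0 bs : pos_blocks a0 bs ->
  hoffman_dual (index_of_blocks a0 bs) = dual_of_blocks a0 bs.
Proof.
move=> /and3P[_ bs0 h]; rewrite -[in RHS](blocks_of_tail h).
have : index_of_blocks_tail bs != [::].
  by case: bs bs0 h => // -[b a] /= [|? ?] _ _; case: (b.-1).
by rewrite /index_of_blocks /=; case: (index_of_blocks_tail bs).
Qed.

Lemma index_of_blocks_exists k : is_index k -> (1 < dep k)%N ->
  exists a0 bs, pos_blocks a0 bs /\ k = index_of_blocks a0 bs.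
Proof.
case: k => // a0 t /= /andP[a00 ht] t0; exists a0, (blocks_of 1 t).
suff H b : (0 < b)%N -> let bs := blocks_of b t in
    [/\ bs != [::], all (fun x => (0 < x.1) && (0 < x.2))%N bs &
        nseq b.-1 1%N ++ t = index_of_blocks_tail bs].
  by have [h1 h2 h3] := H 1%N isT; rewrite /pos_blocks a00 h1 h2 /index_of_blocks -h3.
elim: t t0 ht b {a00} => // x [|y t] IH _ /andP[x0 ht] b b0.
  by rewrite /= b0 x0.
have {}IH := IH isT ht.
rewrite -[blocks_of b _]/(if (x <= 1)%N then blocks_of b.+1 (y :: t)
  else (b, x.-1) :: blocks_of 1 (y :: t)).
case: leqP => x1.
  have [h1 h2 h3] := IH b.+1 isT; split=> //; rewrite -h3.
  have -> : x = 1%N by apply/eqP; rewrite eqn_leq x1.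
  by rewrite -[in RHS](prednK b0) /=; elim: (b.-1) => //= n ->.
have [h1 h2 h3] := IH 1%N isT.
have x1' : (0 < x.-1)%N by case: (x) x1 => // -[].
split=> //; first by rewrite /= b0 x1'.
move: h1 h3; rewrite [nseq 1.-1 _ ++ _]/=; case: (blocks_of 1 _) => // z bs _ ->.
by rewrite -[in LHS](prednK (ltnW x1)).
Qed.

(* In both truncated sums [is_index] excludes 0 from the summation range. *)
Definition mhs_star (K : fieldType) (N : nat) (k : seq nat) : K :=
  \sum_(n : (dep k).-tuple 'I_N.+1 | is_index (vals n) && sorted leq (vals n))
    \prod_(i < dep k) (nth 0%N (vals n) i)%:R ^- nth 0%N k i.

Definition mhs (K : fieldType) (N : nat) (k : seq nat) : K :=
  \sum_(n : (dep k).-tuple 'I_N.+1 | is_index (vals n) && sorted ltn (vals n))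
    \prod_(i < dep k) (nth 0%N (vals n) i)%:R ^- nth 0%N k i.

Definition prime_nat : Type := {p : nat | prime p}.

Definition prodF : Type := forall p : prime_nat, 'F_(val p).

HB.instance Definition _ := gen_eqMixin prodF.
HB.instance Definition _ := gen_choiceMixin prodF.

Section ProdF.

Definition prodF_zero : prodF := fun=> 0.
Definition prodF_one : prodF := fun=> 1.
Definition prodF_opp (f : prodF) : prodF := fun p => - f p.
Definition prodF_add (f g : prodF) : prodF := fun p => f p + g p.
Definition prodF_mul (f g : prodF) : prodF := fun p => f p * g p.

Let addA : associative prodF_add.
Proof. by move=> f g h; apply: functional_extensionality_dep => p; rewrite /prodF_add addrA. Qed.
Let addC : commutative prodF_add.
Proof. by move=> f g; apply: functional_extensionality_dep => p; rewrite /prodF_add addrC. Qed.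
Let add0 : left_id prodF_zero prodF_add.
Proof. by move=> f; apply: functional_extensionality_dep => p; rewrite /prodF_add add0r. Qed.
Let addN : left_inverse prodF_zero prodF_opp prodF_add.
Proof. by move=> f; apply: functional_extensionality_dep => p; rewrite /prodF_add addNr. Qed.

HB.instance Definition _ := GRing.isZmodule.Build prodF addA addC add0 addN.

Let mulA : associative prodF_mul.
Proof. by move=> f g h; apply: functional_extensionality_dep => p; rewrite /prodF_mul mulrA. Qed.
Let mulC : commutative prodF_mul.
Proof. by move=> f g; apply: functional_extensionality_dep => p; rewrite /prodF_mul mulrC. Qed.
Let mul1 : left_id prodF_one prodF_mul.
Proof. by move=> f; apply: functional_extensionality_dep => p; rewrite /prodF_mul mul1r. Qed.
Let mulD : left_distributive prodF_mul prodF_add.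
Proof. by move=> f g h; apply: functional_extensionality_dep => p; rewrite /prodF_mul mulrDl. Qed.
Let one_neq0 : prodF_one != 0.
Proof.
apply/eqP => /(congr1 (fun f : prodF => f (exist _ 2%N (erefl (prime 2))))).
by move/eqP; rewrite oner_eq0.
Qed.

HB.instance Definition _ :=
  GRing.Zmodule_isComNzRing.Build prodF mulA mulC mul1 mulD one_neq0.

End ProdF.

Definition sumF : {pred prodF} :=
  fun f => `[< finite_set [set p | f p != 0] >].

Lemma infinite_primes : ~ finite_set [set: prime_nat].
Proof.
move=> /finite_seqP[s Es].
have [p lt_p p_pr] := prime_above (\max_(q <- s) val q).
have : exist _ p p_pr \in s by have : [set: prime_nat] (exist _ p p_pr) by []; rewrite Es.
by move=> /(@leq_bigmax_seq _ _ xpredT val)/(_ isT); rewrite leqNgt lt_p.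
Qed.

Lemma sumF_idealr_closed : idealr_closed sumF.
Proof.
split.
- apply/asboolP; rewrite (_ : [set _ | _] = set0)//.
  by apply/seteqP; split=> p //=; rewrite eqxx.
- apply/asboolPn => fin1; apply: infinite_primes.
  by apply: sub_finite_set fin1 => p _; exact: (oner_neq0 'F_(val p)).
- move=> a u v /asboolP fu /asboolP fv; apply/asboolP.
  apply: (@sub_finite_set _ _ ([set p | u p != 0] `|` [set p | v p != 0]));
    last by rewrite finite_setU.
  move=> p /=; case: (eqVneq (u p) 0) => [u0 nz|]; last by left.
  right; apply: contra_neq nz => v0.
  by rewrite -[LHS]/(a p * u p + v p) u0 v0 mulr0 addr0.
Qed.

HB.instance Definition _ := isIdealr.Build prodF sumF sumF_idealr_closed.

Definition calA : Type := {ideal_quot sumF}.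

HB.instance Definition _ := GRing.ComNzRing.on calA.

Definition zeta_A_star (k : seq nat) : calA :=
  \pi_{ideal_quot sumF} ((fun p => mhs_star 'F_(val p) (val p).-1 k) : prodF).

Section SymmetricMZSV.

Variable R : realType.

Definition admissible (k : seq nat) : bool :=
  is_index k && (1 < last 2 k)%N.

Definition zeta (k : seq nat) : R := limn (fun N => mhs R N k).

Definition mzv_span : set R :=
  [set x | exists2 s : seq (rat * seq nat), all (fun c => admissible c.2) s &
     x = \sum_(c <- s) ratr c.1 * zeta c.2].

Definition euler_gamma : R := limn (fun n => series harmonic n - ln n%:R).

Definition is_reg_poly (k : seq nat) (Q : {poly R}) : Prop :=
  exists J : nat,
    (fun N : nat => mhs_star R N k - Q.[ln N%:R + euler_gamma] : R^o) =O_\oo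
    (fun N : nat => N%:R^-1 * ln N%:R ^+ J : R^o).

(* For an index k there is exactly one polynomial Q with [is_reg_poly k Q]
   (harmonic regularization); 0 is only the default value of [xget]. *)
Definition zeta_star_reg (k : seq nat) : R :=
  (xget 0 [set Q | is_reg_poly k Q]).[0].

Definition zeta_star (k : seq nat) : R :=
  if admissible k then limn (fun N => mhs_star R N k) else zeta_star_reg k.

Definition zeta_S_star_rep (k : seq nat) : R :=
  \sum_(i < (dep k).+1)
    (-1) ^+ wt (drop i k) * zeta_star (take i k) * zeta_star (rev (drop i k)).

Definition zeta2_ideal : {pred R} :=
  fun x => `[< exists2 z, mzv_span z & x = zeta [:: 2%N] * z >].

Lemma zeta2_ideal_zmod_closed : zmod_closed zeta2_ideal.
Proof.
split.
  by apply/asboolP; exists 0; rewrite ?mulr0//; exists [::]; rewrite ?big_nil.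
move=> x y /asboolP[u [s hs ->] ->] /asboolP[v [t ht ->] ->]; apply/asboolP.
exists (\sum_(c <- s ++ [seq (- c.1, c.2) | c <- t]) ratr c.1 * zeta c.2).
  exists (s ++ [seq (- c.1, c.2) | c <- t]) => //.
  by rewrite all_cat hs all_map.
rewrite -mulrBr big_cat/= big_map -sumrN; congr (_ * (_ + _)).
by apply: eq_bigr => c _; rewrite rmorphN mulNr.
Qed.

HB.instance Definition _ :=
  GRing.isZmodClosed.Build R zeta2_ideal zeta2_ideal_zmod_closed.

(* Z / zeta(2) Z is the image of the span Z of the multiple zeta values in
   R / zeta(2) Z; working in the latter, equality of the classes of two elements
   of Z has the same meaning, and the classes need no proof of membership in Z. *)
Definition calS : zmodType := Quotient.quot zeta2_ideal.

Definition zeta_S_star (k : seq nat) : calS :=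
  \pi_(Quotient.quot zeta2_ideal) (zeta_S_star_rep k).

End SymmetricMZSV.

Variant flavour := FlavourA | FlavourS.

Definition calF (R : realType) (F : flavour) : zmodType :=
  match F with FlavourA => calA : zmodType | FlavourS => calS R end.

Definition zeta_F_star (R : realType) (F : flavour) : seq nat -> calF R F :=
  match F with
  | FlavourA => zeta_A_star
  | FlavourS => @zeta_S_star R
  end.

(* Main.v *)
Require Import Defs.
From mathcomp Require Import all_boot all_order all_algebra.
From mathcomp Require Import generic_quotient ring_quotient finfield.
From mathcomp Require Import all_classical all_reals.
From mathcomp Require Import complex.
From mathcomp Require Import topology normedtype landau sequences derive.
From mathcomp Require Import exp trigo.
From mathcomp Require Import zify ring lra.

(** The two flavours are shadows of one exact identity over a field containing an
element [q] with [[p]_q = 0] and [[m]_q != 0] for [0 < m < p], where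
[[m]_q = 1 + q + ... + q^(m-1)].  Put [a_m = q^m / [m]_q] and [b_m = 1 / [m]_q];
both deform [1/m].

Exact duality.  For a formal [x] let [C(n, m) = beta(n, m) prod_(j <= n) (1 - x a_j)]
with [beta] a signed q-binomial coefficient ([qbeta]).  Against this connector,
multiplication by [a_m / (1 - x a_m)] on the left becomes summation against the
same letter on the right ([conn_al]), and summation against [b] on the left becomes
multiplication by [b_n] on the right ([conn_b]); the innermost step is
[sum_m C(n, m) / (1 - x a_m) = -1] ([conn_rho]).  Moving the letters of an index
through the connector one at a time therefore exchanges repetitions inside an entry
with new entries, which is how Hoffman's dual arises ([transport]).  Since
[beta(p-1, m) = q^-m] ([qbeta_top]), at [n = p-1] the connector disappears and there
remains ([connected_duality])
  [prod_j (1 - x a_j) * (star sum of k, with powers of 1 / (1 - x a))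
     = - (star sum of the dual of k with one 1 / (1 - x a) for each entry)].
The coefficient of [x^m] gives the theorem for these deformed sums
([exact_duality]): the coefficients of [(1 - x a)^-s] are the binomial numbers
collected in [c2], except that [prod_j (1 - x a_j)] contributes correction terms.

Flavour A.  In [F_p] take [q = 1].  Then [prod_j (1 - x a_j) = 1 - x^(p-1)]
([corr_poly_Fp]), so there is no correction as soon as [p > m + 1].

Flavour S.  In the complex numbers take [q = exp(2 pi i / (2N+1))], [p = 2N+1], and
let [N] tend to infinity.  Cut each chain of summation variables at [N] and reflect
the upper half; since [b_(p-n) = - a_n] and [a_(p-n) = - b_n], this produces the
signs and the two factors of the symmetric value ([full_asym]).  For [n <= N] both
[a_n] and [b_n] are within [O(1/N)] of [1/n] ([good_qa], [good_qb]).  For every such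
family of weights a truncated star sum equals, up to [O(log(N)^J / N)], one and the
same polynomial in its depth-one, weight-one sum, with coefficients in the span [Z]
of the multiple zeta values ([regularization]); for the weights [1/n] this polynomial
is the harmonic regularization polynomial ([zeta_star_spec]).  The depth-one sums of
[a] and of [b] differ asymptotically by [- pi i] ([Tb_Ta]), so the exact duality
becomes a polynomial identity in a single divergent quantity.  Such an identity holds
coefficientwise ([horner_small_eq0]), and its constant term, read modulo [pi i Z[pi i]],
is the difference of the two sides of the theorem: a shift by [- pi i] is invisible
there, and the limits [(- 2 pi i)^j / (j+1)!] of the correction coefficients
([corr_poly_asym]) vanish for [j > 0].  A real number in [pi i Z[pi i]] lies in
[pi^2 Z = zeta(2) Z].  The value [pi^2 = 6 zeta(2)] needed here is itself the case
[k = (1)], [m = 1] of the exact duality ([zeta2_pi]). *)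

Set Implicit Arguments.
Unset Strict Implicit.
Unset Printing Implicit Defensive.

Import Order.TTheory GRing.Theory Num.Theory.
Import numFieldNormedType.Exports.
Local Open Scope ring_scope.

(** * Nested sums *)

(** The letters are listed from the largest variable down, so that the recursion lowers
    the upper end of the range; [d] is the least gap between two consecutive variables,
    0 for star sums and 1 for strict ones. *)
Fixpoint nsum (K : comNzRingType) (d : bool) (a N : nat) (f : seq (nat -> K)) : K :=
  if f is g :: f' then \sum_(a.+1 <= n < N.+1) g n * nsum d a (n - d)%N f' else 1.

Section NestedSums.
Variable K : comNzRingType.
Implicit Types (f : seq (nat -> K)) (g h : nat -> K).

Lemma nsum_nil d a N : @nsum K d a N [::] = 1. Proof. by []. Qed.

Lemma nsum_cons d a N g f :
  nsum d a N (g :: f) = \sum_(a.+1 <= n < N.+1) g n * nsum d a (n - d)%N f.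
Proof. by []. Qed.

Lemma nsumS d a N g f : (a <= N)%N ->
  nsum d a N.+1 (g :: f) = nsum d a N (g :: f) + g N.+1 * nsum d a (N.+1 - d)%N f.
Proof. by move=> aN; rewrite !nsum_cons big_nat_recr. Qed.

Lemma nsum_cons_nn d a g f : nsum d a a (g :: f) = 0.
Proof. by rewrite nsum_cons big_geq. Qed.

(** Peeling off the smallest variable instead of the largest: the remaining variables
    are then bounded below by it, and the gap [d] decides whether it may recur. *)
Lemma nsum_rcons d a N f g :
  nsum d a N (rcons f g) = \sum_(a.+1 <= n < N.+1) g n * nsum d (n.-1 + d)%N N f.
Proof.
elim: f N => [|h f IH] N //=.
under eq_bigr => n _ do rewrite IH big_distrr/=.
under [RHS]eq_bigr => n _ do rewrite big_distrr/=.
rewrite big_nat; under eq_bigr => n /andP[an nN].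
  rewrite (big_nat_widen _ _ N.+1); last by case: (d) nN; lia.
  over.
rewrite -big_nat [RHS]big_nat; under [RHS]eq_bigr => j /andP[aj jN].
  rewrite (big_nat_widenl _ a.+1); last by case: (d); lia.
  over.
rewrite -big_nat.
rewrite (exchange_big_dep_nat xpredT)//= !big_nat; apply: eq_bigr => j /andP[aj jN].
rewrite big_nat_cond [RHS]big_nat_cond; apply: eq_big => [n|n _]; last by rewrite mulrCA.
by case: (d); case: (j) aj => [|j'] aj //=; lia.
Qed.

(** A weakly decreasing chain crosses [N] at exactly one place. At the middle of a full
    chain this cut is the source of the sum defining the symmetric values. *)
Lemma nsum_split N M f : (N <= M)%N ->
  nsum false 0 M f =
  \sum_(i < (size f).+1) nsum false N M (take i f) * nsum false 0 N (drop i f).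
Proof.
elim: f M => [|g f IH] M NM; first by rewrite big_ord1 /= mulr1.
rewrite [size _]/= big_ord_recl take0 drop0 nsum_nil mul1r nsum_cons.
rewrite (big_cat_nat (n := N.+1))//=.
congr (_ + _); under [RHS]eq_bigr => i _ do rewrite big_distrl/=.
rewrite exchange_big/= !big_nat; apply: eq_bigr => n /andP[Nn nM].
rewrite [(n - _)%N]subn0 IH ?(ltnW Nn)// big_distrr/=; apply: eq_bigr => i _.
by rewrite add0n mulrA.
Qed.

Lemma big_nat_reflect (F : nat -> K) c a b : (a <= b)%N -> (b < c)%N ->
  \sum_(a.+1 <= n < b.+1) F n =
  \sum_((c - b.+1).+1 <= n < (c - a.+1).+1) F (c - n)%N.
Proof.
elim: b => [|b IH] ab bc; first by case: a ab => // _; rewrite !big_geq//.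
case: (leqP a b) => [ab'|ba]; last first.
  have -> : a = b.+1 by lia.
  by rewrite !big_geq.
rewrite big_nat_recr ?ltnS//= IH ?(ltnW bc)// [RHS]big_ltn; last by lia.
by rewrite addrC; congr (F _ + \sum_(_ <= n < _) _); lia.
Qed.

(** The map [n |-> c - n] reverses the order of the variables, hence that of the
    letters. *)
Lemma nsum_reflect c a b f : (a <= b)%N -> (b < c)%N ->
  nsum false a b f =
  nsum false (c - b.+1) (c - a.+1) (rev [seq (fun n => g (c - n)%N) | g <- f]).
Proof.
elim: f b => [|g f IH] b ab bc //.
rewrite map_cons rev_cons nsum_rcons nsum_cons (big_nat_reflect _ ab bc) !big_nat.
apply: eq_bigr => n /andP[an nc]; rewrite [(c - n - _)%N]subn0 IH; [|lia|lia].
by congr (_ * nsum _ _ _ _); lia.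
Qed.

Lemma nsum_rmorph (L : comNzRingType) (phi : {rmorphism K -> L}) d a N f :
  phi (nsum d a N f) = nsum d a N [seq phi \o g | g <- f].
Proof.
elim: f N => [|g f IH] N /=; first by rewrite rmorph1.
by rewrite rmorph_sum; apply: eq_bigr => n _; rewrite rmorphM IH.
Qed.

End NestedSums.

(** * Sums over tuples *)

Lemma sum_tuple_cons (V : nmodType) (T : finType) n (P : pred (n.+1.-tuple T))
    (F : n.+1.-tuple T -> V) :
  \sum_(t | P t) F t =
  \sum_(x : T) \sum_(t : n.-tuple T | P [tuple of x :: t]) F [tuple of x :: t].
Proof.
rewrite pair_big_dep/=.
rewrite (reindex (fun p : T * n.-tuple T => [tuple of p.1 :: p.2]))//=.
exists (fun t : n.+1.-tuple T => (thead t, [tuple of behead t])).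
  by move=> [x t] _ /=; congr (_, _); apply: val_inj.
by move=> t _; rewrite [RHS]tuple_eta; apply: val_inj.
Qed.

Lemma sum_tuple0 (V : nmodType) (T : finType) (P : pred (0.-tuple T))
    (F : 0.-tuple T -> V) :
  \sum_(t | P t) F t = if P [tuple] then F [tuple] else 0.
Proof.
rewrite big_mkcond (eq_bigr (fun=> if P [tuple] then F [tuple] else 0)).
  by rewrite sumr_const card_tuple expn0 mulr1n.
by move=> t _; rewrite (tuple0 t).
Qed.

Definition lpow (K : comNzRingType) (w : nat -> K) (k : seq nat) : seq (nat -> K) :=
  [seq (fun n => w n ^+ x) | x <- k].

(** An index lists the exponent of the smallest variable first, whence [rev k]. The
    induction peels off that variable, so the lower bound [a] has to be general. *)
Lemma tuple_chain (K : fieldType) (d : bool) M (k : seq nat) a :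
  let r : rel nat := fun x y => if d then (x < y)%N else (x <= y)%N in
  \sum_(n : (size k).-tuple 'I_M.+1 |
       [&& is_index (vals n), sorted r (vals n) & all (leq (a.+1)) (vals n)])
    \prod_(i < size k) (nth 0%N (vals n) i)%:R ^- nth 0%N k i =
  nsum d a M (lpow (fun n => n%:R^-1 : K) (rev k)).
Proof.
move=> r; elim: k a => [|x k IH] a.
  by rewrite sum_tuple0 /= big_ord0.
rewrite sum_tuple_cons rev_cons /lpow map_rcons nsum_rcons -/(lpow _ _).
rewrite -(big_mkord xpredT (fun j => \sum_(t : (size k).-tuple 'I_M.+1 |
   [&& is_index (j :: vals t), sorted r (j :: vals t) & all (leq a.+1) (j :: vals t)])
   \prod_(i < size (x :: k)) (nth 0%N (j :: vals t) i)%:R ^- nth 0%N (x :: k) i)).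
rewrite (big_cat_nat (n := minn a.+1 M.+1))//=; last by rewrite geq_minr.
rewrite big_nat big1 ?add0r; last first.
  move=> j /andP[_ ja]; rewrite big_pred0// => t.
  have /negbTE-> : ~~ (a < j)%N by rewrite -leqNgt; lia.
  by rewrite andFb !andbF.
case: (leqP a M) => aM; last first.
  by rewrite (minn_idPr _); [rewrite !big_geq //; lia|lia].
rewrite (minn_idPl _)// !big_nat; apply: eq_bigr => j /andP[aj jM].
rewrite -IH big_distrr/=; apply: eq_big => [t|t _]; last first.
  by rewrite big_ord_recl/= exprVn.
have -> : path r j (vals t) = all (r j) (vals t) && sorted r (vals t).
  by rewrite /r; case: (d); rewrite path_sortedE//; [exact: ltn_trans|exact: leq_trans].
rewrite aj /= (leq_trans _ aj)//=.
have -> : all (r j) (vals t) = all (leq (j.-1 + d).+1) (vals t).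
  by apply: eq_all => y; rewrite /r; case: (d); case: (j) aj => //= j' _; rewrite ?addn0 ?addn1.
case: (boolP (all (leq (j.-1 + d).+1) _)) => [h|_]; last by rewrite !andbF.
rewrite (_ : all _ _ = true) ?andbT//.
by apply: sub_all h => y; apply: leq_ltn_trans; lia.
Qed.

Lemma mhs_starE (K : fieldType) N k :
  mhs_star K N k = nsum false 0 N (lpow (fun n => n%:R^-1) (rev k)).
Proof.
rewrite -tuple_chain; apply: eq_bigl => n.
rewrite -[all (leq 1) _]/(is_index _).
by case: (is_index _); rewrite //= andbT.
Qed.

Lemma mhsE (K : fieldType) N k :
  mhs K N k = nsum true 0 N (lpow (fun n => n%:R^-1) (rev k)).
Proof.
rewrite -tuple_chain; apply: eq_bigl => n.
rewrite -[all (leq 1) _]/(is_index _).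
by case: (is_index _); rewrite //= andbT.
Qed.

(** * A recursive form of Hoffman's dual *)

Definition incr_head (l : seq nat) : seq nat :=
  if l is d :: ds then d.+1 :: ds else [::].

(** Prepending [k] affects the dual of the rest only through its first entry. This is
    the form in which letters moved through the connector build up the dual. *)
Fixpoint hdual (l : seq nat) : seq nat :=
  match l with
  | [::] => [::]
  | [:: k] => nseq k 1%N
  | k :: l' => nseq k.-1 1%N ++ incr_head (hdual l')
  end.

Lemma is_index_cons k l : is_index (k :: l) = (0 < k)%N && is_index l.
Proof. by []. Qed.

Lemma hdual_cons k x l : hdual (k :: x :: l) = nseq k.-1 1%N ++ incr_head (hdual (x :: l)).
Proof. by []. Qed.

Lemma hdual_neq0 l : is_index l -> l != [::] -> hdual l != [::].
Proof.
elim: l => // k [|x l] IH /andP[k0 hl] _; first by case: k k0 {hl}.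
rewrite hdual_cons; have := IH hl isT.
by case: (hdual _) => // d ds _; case: (k.-1).
Qed.

Lemma hdual_pos l : is_index l -> is_index (hdual l).
Proof.
elim: l => // k [|x l] IH /andP[k0 hl]; first by rewrite /is_index all_nseq orbT.
rewrite hdual_cons /is_index all_cat all_nseq orbT.
by have := IH hl; case: (hdual (x :: l)) => // d ds /andP[_].
Qed.

(** * Transport of connected sums *)

Section Transport.
Variables (A : comNzRingType) (P : nat) (al b rho : nat -> A) (C : nat -> nat -> A).

Hypothesis conn_al : forall n m, (0 < m <= n)%N -> (n <= P)%N ->
  al m * C n m = \sum_(m <= n' < n.+1) al n' * C n' m.
Hypothesis conn_b : forall n m, (0 < m <= n)%N -> (n <= P)%N ->
  b n * C n m = b m * \sum_(m <= m' < n.+1) C n m'.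
Hypothesis conn_rho : forall n, (0 < n <= P)%N ->
  \sum_(1 <= m < n.+1) C n m * rho m = - 1.

(** A function of the left variable [m], integrated against the connector, becomes a
    function of the right variable [n]. *)
Definition ctrans (Phi : nat -> A) (n : nat) : A :=
  \sum_(1 <= m < n.+1) C n m * Phi m.

Lemma exch_triangle n (F : nat -> nat -> A) :
  \sum_(1 <= m < n.+1) \sum_(1 <= j < m.+1) F m j =
  \sum_(1 <= j < n.+1) \sum_(j <= m < n.+1) F m j.
Proof.
rewrite big_nat; under eq_bigr => m /andP[m0 mn].
  rewrite (big_nat_widen _ _ n.+1); last by lia.
  over.
rewrite -big_nat [RHS]big_nat; under [RHS]eq_bigr => j /andP[j0 jn].
  rewrite (big_nat_widenl _ 1); last by lia.
  over.
rewrite -big_nat.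
rewrite (exchange_big_dep_nat xpredT)//= !big_nat; apply: eq_bigr => j /andP[aj jN]; rewrite big_nat_cond [RHS]big_nat_cond; apply: eq_bigl => m; lia.
Qed.

(** A letter [al] leaves the left side as a factor and arrives on the right as a new
    summation, that is, as a new entry of the index. *)
Lemma ctrans_al Phi n : (n <= P)%N ->
  ctrans (fun m => al m * Phi m) n = \sum_(1 <= j < n.+1) al j * ctrans Phi j.
Proof.
move=> nP; under [RHS]eq_bigr => j _ do rewrite big_distrr/=.
rewrite exch_triangle /ctrans !big_nat; apply: eq_bigr => m /andP[m0 mn].
rewrite mulrA [C n m * _]mulrC conn_al ?m0// big_distrl/=.
by apply: eq_bigr => j _; rewrite mulrA.
Qed.

(** A summation on the left arrives on the right as a factor [b], that is, as an
    increment of the current entry of the index. *)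
Lemma ctrans_sum Phi n : (n <= P)%N ->
  ctrans (fun m => \sum_(1 <= j < m.+1) b j * Phi j) n = b n * ctrans Phi n.
Proof.
move=> nP; rewrite /ctrans; under eq_bigr => j _ do rewrite big_distrr/=.
rewrite exch_triangle big_distrr/= !big_nat; apply: eq_bigr => m /andP[m0 mn].
by rewrite mulrA conn_b ?m0// -big_distrl/= mulrCA mulrA.
Qed.

Definition dual_letters (l : seq nat) : seq (nat -> A) :=
  [seq (fun n => b n ^+ d.-1 * al n) | d <- l].

(** The outermost summation of [dual_letters] before its factor [al] is put in: at this
    stage a further [b] can still raise the first entry. *)
Definition dual_head (l : seq nat) (n : nat) : A :=
  if l is d :: ds then b n ^+ d.-1 * nsum false 0 n (dual_letters ds) else 0.

Lemma sum_dual_head l n : l != [::] ->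
  \sum_(1 <= j < n.+1) al j * dual_head l j = nsum false 0 n (dual_letters l).
Proof.
case: l => // d ds _; rewrite /= !big_nat; apply: eq_bigr => j _.
by rewrite [(j - _)%N]subn0 mulrA [al j * _]mulrC.
Qed.

Lemma ctrans_al_iter k (Phi : nat -> A) l : is_index l -> l != [::] ->
  (forall n, (0 < n <= P)%N -> ctrans Phi n = - dual_head l n) ->
  forall n, (0 < n <= P)%N ->
    ctrans (fun m => al m ^+ k * Phi m) n = - dual_head (nseq k 1%N ++ l) n.
Proof.
move=> hl l0 H; elim: k => [|k IH] n /andP[n0 nP].
  rewrite -H ?n0//; apply: eq_bigr => m _; by rewrite mul1r.
under [X in ctrans X _]boolp.eq_fun => m do rewrite exprS -mulrA.
rewrite ctrans_al// [nseq _ _ ++ _]/= /dual_head expr0 mul1r -/(dual_head _ _).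
rewrite -sum_dual_head; last by case: (k).
rewrite -sumrN !big_nat; apply: eq_bigr => j /andP[j0 jn].
by rewrite IH ?mulrN// j0 (leq_trans _ nP).
Qed.

(** What stands on the left below the variable [m], the entry of [m] itself included up
    to one of its factors; [rho] closes the innermost variable. *)
Fixpoint lower_sum (l : seq nat) (m : nat) : A :=
  match l with
  | [::] => 0
  | [:: k] => al m ^+ k.-1 * rho m
  | k :: l' => al m ^+ k.-1 * \sum_(1 <= j < m.+1) b j * lower_sum l' j
  end.

Lemma lower_sum_cons k x l m : lower_sum (k :: x :: l) m =
  al m ^+ k.-1 * \sum_(1 <= j < m.+1) b j * lower_sum (x :: l) j.
Proof. by []. Qed.

(** The letters are moved from the innermost one outwards: an entry [k] contributes
    [k - 1] factors [al], hence [k - 1] new entries 1, and the summation that follows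
    it increments the entry reached. This is the recursion of [hdual]. *)
Lemma ctrans_lower_sum l n : is_index l -> l != [::] -> (0 < n <= P)%N ->
  ctrans (lower_sum l) n = - dual_head (hdual l) n.
Proof.
elim: l n => // k [|x l] IH n; rewrite is_index_cons => /andP[k0 hl] _ n0P.
  have -> : hdual [:: k] = nseq k.-1 1%N ++ [:: 1%N].
    by rewrite /= -[in LHS](prednK k0) -addn1 nseqD.
  apply: ctrans_al_iter => // {n0P}n n0P; rewrite /dual_head expr0 mul1r /=.
  exact: conn_rho.
rewrite hdual_cons; apply: ctrans_al_iter => // {n0P}.
- by have := hdual_pos hl; case: (hdual _) => // ? ? /andP[_].
- by have := hdual_neq0 hl isT; case: (hdual _).
move=> n' /andP[n0 nP].
rewrite ctrans_sum// IH ?n0// mulrN; congr (- _).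
have := hdual_neq0 hl isT; have := hdual_pos hl.
case: (hdual _) => // d ds /andP[d0 _] _.
by rewrite /dual_head /incr_head mulrA -exprS prednK.
Qed.

Lemma transport l : is_index l -> l != [::] ->
  \sum_(1 <= m < P.+1) C P m * (al m * lower_sum l m) =
  - nsum false 0 P (dual_letters (hdual l)).
Proof.
move=> hl l0; rewrite -[LHS]/(ctrans (fun m => al m * lower_sum l m) P) ctrans_al//.
rewrite -sum_dual_head ?hdual_neq0// -sumrN !big_nat; apply: eq_bigr => j /andP[j0 jP].
by rewrite ctrans_lower_sum ?j0// mulrN.
Qed.

End Transport.

(** * The connector at a root of unity *)

Section Connector.
Variables (K : fieldType) (q : K) (P : nat).

(** The q-integer, as a sum so that [q = 1] is allowed. *)
Definition qn (m : nat) : K := \sum_(i < m) q ^+ i.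

Lemma qn0 : qn 0 = 0. Proof. by rewrite /qn big_ord0. Qed.

Lemma qnS m : qn m.+1 = 1 + q * qn m.
Proof.
rewrite /qn big_ord_recl expr0 big_distrr/=; congr (_ + _).
by apply: eq_bigr => i _; rewrite -exprS.
Qed.

Lemma qn1 : qn 1 = 1. Proof. by rewrite qnS qn0 mulr0 addr0. Qed.

Lemma exprqn m : q ^+ m = 1 - (1 - q) * qn m.
Proof. by elim: m => [|m IH]; [rewrite qn0; ring|rewrite exprS IH qnS; ring]. Qed.

Lemma qnD m n : qn (m + n) = qn m + q ^+ m * qn n.
Proof.
elim: m => [|m IH]; first by rewrite add0n qn0; ring.
by rewrite addSn !qnS IH exprS; ring.
Qed.

Definition qa (m : nat) : K := q ^+ m / qn m.
Definition qb (m : nat) : K := (qn m)^-1.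
(** The signed q-binomial coefficient
    [(-1)^m q^(m(m-1)/2) binom(n, m)_q], in a form that makes its recursion in [m]
    immediate. *)
Definition qbeta (n m : nat) : K := \prod_(i < m) ((qn i - qn n) / qn i.+1).

Hypothesis qn_root : qn P.+1 = 0.
Hypothesis qn_neq0 : forall m, (0 < m <= P)%N -> qn m != 0.

Lemma q_neq0 : q != 0.
Proof.
apply/negP => /eqP q0; have /eqP := qn_root.
by rewrite qnS q0 mul0r addr0 oner_eq0.
Qed.

Lemma qbeta0 n : qbeta n 0 = 1. Proof. by rewrite /qbeta big_ord0. Qed.

Lemma qbetaS n m : (m < P)%N ->
  qn m.+1 * qbeta n m.+1 = (qn m - qn n) * qbeta n m.
Proof.
move=> mP; rewrite /qbeta big_ord_recr/= mulrCA mulrC; congr (_ * _).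
by rewrite mulrC divfK// qn_neq0.
Qed.

Lemma qbeta_gt n m : (n < m)%N -> qbeta n m = 0.
Proof.
move=> nm; rewrite /qbeta (bigD1 (Ordinal nm))//= subrr mul0r mul0r; done.
Qed.

(** The recursion of [qbeta] in [m] says that
    [[n] qbeta n j = [j] qbeta n j - [j+1] qbeta n (j+1)], so the sum telescopes. *)
Lemma sum_qbeta n m : (m <= n.+1)%N -> (n <= P)%N ->
  qn n * \sum_(m <= j < n.+1) qbeta n j = qn m * qbeta n m.
Proof.
move=> mn nP; have [d e] : exists d, (m + d = n.+1)%N by exists (n.+1 - m)%N; lia.
elim: d m mn e => [|d IH] m mn e.
  have -> : m = n.+1 by lia.
  by rewrite big_geq// mulr0 qbeta_gt ?mulr0.
rewrite big_ltn; last by lia.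
rewrite mulrDr IH; [|lia|lia]; case: (ltnP m P) => mP.
  by rewrite qbetaS//; ring.
have -> : m = n by lia.
by rewrite [qbeta n n.+1]qbeta_gt// mulr0 addr0.
Qed.

Let qA m := qn m / q ^+ m.

Lemma qAB n m : qA n - qA m = (qn n - qn m) / q ^+ (m + n).
Proof.
have u0 := expf_neq0 m q_neq0; have v0 := expf_neq0 n q_neq0.
have <- : qn n * q ^+ m - qn m * q ^+ n = qn n - qn m by rewrite !exprqn; ring.
by rewrite /qA exprD; field; rewrite u0 v0.
Qed.

(** The step in [n], expressed through the inverses [qA] of the letters [qa]; it follows
    from the step in [m] by induction on [m]. *)
Lemma qbeta_pred n m : (0 < n <= P)%N -> (m <= P)%N ->
  qA n * qbeta n.-1 m = (qA n - qA m) * qbeta n m.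
Proof.
case: n => // n /andP[_ nP]; rewrite [n.+1.-1]/=.
elim: m => [|m IH] mP; first by rewrite !qbeta0 /qA qn0; ring.
have q0 := q_neq0; have qm0 : qn m.+1 != 0 by rewrite qn_neq0.
apply: (mulfI qm0); rewrite mulrCA qbetaS// mulrCA IH ?(ltnW mP)//.
rewrite [RHS]mulrCA qbetaS// !mulrA; congr (_ * _).
have w0 := expf_neq0 (m + n.+1) q0; rewrite !qAB addSn exprS !qnS; field.
by rewrite q0 w0.
Qed.

(** Because [[P+1] = 0], the factor [[i] - [P]] is [[i+1] / q] and the product
    collapses. At the top of the chain the connector thus only turns [qa m] into
    [qb m]. *)
Lemma qbeta_top m : (m <= P)%N -> qbeta P m = q ^- m.
Proof.
have q0 := q_neq0.
elim: m => [|m IH] mP; first by rewrite qbeta0 expr0 invr1.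
have qm0 : qn m.+1 != 0 by rewrite qn_neq0.
apply: (mulfI qm0); rewrite qbetaS// IH ?(ltnW mP)//.
rewrite exprS invfM mulrA; congr (_ / _); apply: (mulIf q0); rewrite divfK//.
by have := qn_root; rewrite !qnS => e; rewrite -[RHS]subr0 -e; ring.
Qed.

Section Deformed.
Variables (A : comNzRingType) (iota : {rmorphism K -> A}) (x : A) (rho : nat -> A).
Hypothesis rhoE : forall m, (0 < m <= P)%N -> (1 - x * iota (qa m)) * rho m = 1.

(** The deformation of the connector. Its factor at [n] cancels the denominator
    [1 - x a_n] of the letter at [n]. *)
Definition corr_prod (n : nat) : A := \prod_(1 <= j < n.+1) (1 - x * iota (qa j)).
Let C n m := corr_prod n * iota (qbeta n m).
Let al m := iota (qa m) * rho m.
Let b m := iota (qb m).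

Lemma corr_prodS n : corr_prod n.+1 = corr_prod n * (1 - x * iota (qa n.+1)).
Proof. by rewrite /corr_prod big_nat_recr. Qed.

Lemma qaA m : (0 < m <= P)%N -> qa m * qA m = 1.
Proof.
by move=> mP; rewrite /qa /qA; field; rewrite qn_neq0// expf_neq0// q_neq0.
Qed.

Lemma qbeta_diff n m : (n < P)%N -> (m <= P)%N ->
  qbeta n.+1 m - qbeta n m = qa n.+1 * qA m * qbeta n.+1 m.
Proof.
move=> nP mP; have h : (0 < n.+1 <= P)%N by [].
have := qbeta_pred h mP; rewrite [n.+1.-1]/= => e.
have -> : qbeta n m = qa n.+1 * (qA n.+1 * qbeta n m) by rewrite mulrA qaA// mul1r.
by rewrite e mulrA mulrBr qaA//; ring.
Qed.

(** With [A_m = 1 / a_m], the deformed connectors at [n + 1] and at [n] differ by a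
    multiple of [A_m - x = A_m (1 - x a_m)], and [rho m] removes the last factor. *)
Lemma conn_diff n m : (n < P)%N -> (0 < m <= P)%N ->
  rho m * (C n.+1 m - C n m) = corr_prod n * iota (qa n.+1 * qA m * qbeta n.+1 m).
Proof.
move=> nP mP; rewrite /C corr_prodS.
have e1 : qbeta n m = qbeta n.+1 m - qa n.+1 * qA m * qbeta n.+1 m.
  by rewrite -qbeta_diff//; [ring|case/andP: mP].
have e2 : iota (qa m) * iota (qA m) = 1 by rewrite -rmorphM qaA// rmorph1.
have e3 := rhoE mP.
have im3 u v w : iota (u * v * w) = iota u * iota v * iota w by rewrite !rmorphM.
rewrite e1 rmorphB !im3.
set ga := corr_prod n; set an := iota (qa n.+1); set Am := iota (qA m).
set be := iota (qbeta n.+1 m).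
transitivity (ga * an * be * (rho m * (Am - x * 1))); first by ring.
rewrite -e2; transitivity (ga * an * be * Am * ((1 - x * iota (qa m)) * rho m)).
  rewrite -/Am; ring.
by rewrite e3; ring.
Qed.

(** By [conn_diff] the difference in [n] of the left side is [al (n+1) * C (n+1) m], and
    both sides agree at [n = m]. *)
Lemma conn_al n m : (0 < m <= n)%N -> (n <= P)%N ->
  al m * C n m = \sum_(m <= n' < n.+1) al n' * C n' m.
Proof.
move=> /andP[m0]; elim: n => [|n IH] mn nP; first by lia.
rewrite big_nat_recr//=; case: (leqP m n) => [mn'|mn']; last first.
  have -> : m = n.+1 by lia.
  by rewrite big_geq// add0r.
rewrite -IH ?(ltnW nP)//.
have mP : (0 < m <= P)%N by lia.
have e1 := conn_diff nP mP.
suff : al m * (C n.+1 m - C n m) = al n.+1 * C n.+1 m by move=> <-; ring.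
have im3 u v w : iota (u * v * w) = iota u * iota v * iota w by rewrite !rmorphM.
rewrite /al -mulrA e1 [C _ _]/C corr_prodS im3.
have e2 : iota (qa m) * iota (qA m) = 1 by rewrite -rmorphM qaA// rmorph1.
have e3 : (1 - x * iota (qa n.+1)) * rho n.+1 = 1 by apply: rhoE.
transitivity (corr_prod n * iota (qa n.+1) * iota (qbeta n.+1 m) *
   (iota (qa m) * iota (qA m))); first by ring.
transitivity (corr_prod n * iota (qa n.+1) * iota (qbeta n.+1 m) *
   ((1 - x * iota (qa n.+1)) * rho n.+1)); first by rewrite e2 e3.
by ring.
Qed.

Lemma conn_b n m : (0 < m <= n)%N -> (n <= P)%N ->
  b n * C n m = b m * \sum_(m <= m' < n.+1) C n m'.
Proof.
move=> /andP[m0 mn] nP; rewrite /C -big_distrr/= mulrCA [RHS]mulrCA; congr (_ * _).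
rewrite -rmorph_sum -!rmorphM; congr (iota _).
have := sum_qbeta (leqW mn) nP; rewrite /qb.
have qn0' : qn n != 0 by rewrite qn_neq0; lia.
have qm0 : qn m != 0 by rewrite qn_neq0; lia.
move=> e; apply: (mulfI qn0'); rewrite mulVKf// mulrCA e.
by rewrite mulKf.
Qed.

(** By [qbeta_pred] each term is proportional to [qbeta (n+1) m - qbeta n m], and the
    full alternating sums of q-binomials vanish by [sum_qbeta]. *)
Lemma sum_qA_qbeta n : (0 < n < P)%N ->
  \sum_(1 <= m < n.+2) qA m * qbeta n.+1 m = 0.
Proof.
move=> /andP[n0 nP].
have h k : (0 < k <= P)%N -> \sum_(0 <= m < k.+1) qbeta k m = 0.
  move=> kP; apply: (mulfI (qn_neq0 kP)).
  rewrite sum_qbeta//; last by case/andP: kP.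
  by rewrite qn0 mul0r mulr0.
suff e : \sum_(0 <= m < n.+2) qA m * qbeta n.+1 m = 0.
  by move: e; rewrite big_ltn// [qA 0]/qA qn0 !mul0r add0r.
have kP : (0 < n.+1 <= P)%N by [].
rewrite big_nat; under eq_bigr => m /andP[_ mn].
  have -> : qA m * qbeta n.+1 m = qA n.+1 * (qbeta n.+1 m - qbeta n m).
    have mP : (m <= P)%N by lia.
    by have := qbeta_pred kP mP; rewrite [n.+1.-1]/= mulrBr => ->; ring.
  over.
rewrite -big_nat -big_distrr/= sumrB h// big_nat_recr//= h; last by lia.
by rewrite qbeta_gt//; ring.
Qed.

(** The sum does not depend on [n]: by [conn_diff] its increments are the sums of
    [sum_qA_qbeta]. *)
Lemma conn_rho n : (0 < n <= P)%N ->
  \sum_(1 <= m < n.+1) C n m * rho m = - 1.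
Proof.
elim: n => // -[|n] IH nP.
  rewrite big_nat1 /C corr_prodS /corr_prod big_geq// mul1r mulrAC rhoE// mul1r.
  rewrite /qbeta big_ord1 qn0 qn1 sub0r divr1 rmorphN rmorph1 //.
rewrite -[RHS]IH; last by lia.
apply/eqP; rewrite -subr_eq0; apply/eqP.
have -> : \sum_(1 <= m < n.+2) C n.+1 m * rho m =
          \sum_(1 <= m < n.+3) C n.+1 m * rho m.
  by rewrite [RHS]big_nat_recr//= [C n.+1 n.+2]/C qbeta_gt// rmorph0 mulr0 mul0r addr0.
rewrite -sumrB big_nat; under eq_bigr => m mn.
  rewrite -mulrBl mulrC conn_diff; [|lia|lia].
  rewrite -mulrA [iota _]rmorphM mulrA.
  over.
rewrite -big_nat -big_distrr/= -rmorph_sum sum_qA_qbeta; last by lia.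
by rewrite rmorph0 mulr0.
Qed.

(** The exponents of [rho] count the letters [al] put at each variable: [k - 1] from the
    entry [k], one more at the largest variable ([top = 1]) from the first move, and one
    more at the smallest from the innermost [rho]. They are the origin of the two
    Kronecker deltas in [c2]. *)
Fixpoint star_letters (top : nat) (l : seq nat) : seq (nat -> A) :=
  match l with
  | [::] => [::]
  | [:: k] => [:: fun m => b m * iota (qa m) ^+ k.-1 * rho m ^+ (k.-1 + top + 1)]
  | k :: l' => (fun m => b m * iota (qa m) ^+ k.-1 * rho m ^+ (k.-1 + top)) :: star_letters 0 l'
  end.

Lemma star_letters_cons top k y l : star_letters top (k :: y :: l) =
  (fun m => b m * iota (qa m) ^+ k.-1 * rho m ^+ (k.-1 + top)) :: star_letters 0 (y :: l).
Proof. by []. Qed.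

Lemma lower_sumE l m : l != [::] ->
  \sum_(1 <= j < m.+1) b j * lower_sum al b rho l j = nsum false 0 m (star_letters 0 l).
Proof.
elim: l m => // k [|y l] IH m _.
  rewrite /= !big_nat; apply: eq_bigr => j _; rewrite mulr1 /al exprMn addn0 addn1 exprSr.
  by ring.
rewrite star_letters_cons nsum_cons !big_nat; apply: eq_bigr => j _.
rewrite [(j - _)%N]subn0 lower_sum_cons IH// /al exprMn addn0; ring.
Qed.

(** At [n = P] the connector degenerates by [qbeta_top], so its left side is an ordinary
    nested sum. *)
Theorem connected_duality l : is_index l -> l != [::] ->
  corr_prod P * nsum false 0 P (star_letters 1 l) =
  - nsum false 0 P (dual_letters al b (hdual l)).
Proof.
move=> hl l0.
rewrite -(transport conn_al conn_b conn_rho hl l0).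
(* the connector at [n = P] only exchanges [qa] for [qb] *)
have top m : (0 < m <= P)%N -> C P m * al m = corr_prod P * (b m * rho m).
  move=> mP; rewrite /C /al -mulrA; congr (_ * _); rewrite mulrA -rmorphM; congr (iota _ * _).
  rewrite qbeta_top; last by case/andP: mP.
  by rewrite /qa mulrA mulVf ?mul1r// expf_neq0// q_neq0.
under [RHS]eq_big_nat => m mP do rewrite mulrA top//.
rewrite {top}; case: l hl l0 => // k [|y l] hl _ .
  rewrite /= big_distrr/= !big_nat; apply: eq_bigr => m _.
  rewrite mulr1 /al exprMn -addnA exprD expr2; ring.
rewrite star_letters_cons nsum_cons mulr_sumr !big_nat; apply: eq_bigr => m _.
rewrite [(m - _)%N]subn0 lower_sum_cons lower_sumE// /al exprMn exprD expr1; ring.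
Qed.

End Deformed.

End Connector.

(** * Coefficient extraction *)

(** The sum over exponent vectors of length [r] and weight [m], by recursion on the
    length; this is the shape of the coefficients of a product of power series. *)
Fixpoint esum (V : nmodType) (r m : nat) (F : seq nat -> V) : V :=
  if r is r'.+1 then \sum_(i < m.+1) esum r' (m - i) (fun e => F (val i :: e))
  else if m == 0%N then F [::] else 0.

Lemma esumS (V : nmodType) r m (F : seq nat -> V) :
  esum r.+1 m F = \sum_(i < m.+1) esum r (m - i) (fun e => F (val i :: e)).
Proof. by []. Qed.

Lemma esumE (V : nmodType) M r m (F : seq nat -> V) : (m <= M)%N ->
  \sum_(e : r.-tuple 'I_M.+1 | wt (vals e) == m) F (vals e) = esum r m F.
Proof.
elim: r m F => [|r IH] m F mM.
  by rewrite sum_tuple0 /= eq_sym.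
rewrite sum_tuple_cons esumS.
rewrite -(big_mkord xpredT (fun i => \sum_(t : r.-tuple 'I_M.+1 |
   wt (i :: vals t) == m) F (i :: vals t))).
rewrite -[RHS](big_mkord xpredT (fun i => esum r (m - i) (fun e => F (i :: e)))).
rewrite (big_cat_nat (n := m.+1))//= [X in _ + X]big_nat [X in _ + X]big1 ?addr0.
  rewrite !big_nat; apply: eq_bigr => i /= im.
  rewrite -IH; last by lia.
  by apply: eq_bigl => t; rewrite /wt /=; lia.
move=> i /andP[mi _]; rewrite big_pred0// => t; rewrite /wt /=; lia.
Qed.

Lemma eq_esum (V : nmodType) r m (F G : seq nat -> V) :
  (forall e, size e = r -> all (fun x => x <= m)%N e -> F e = G e) ->
  esum r m F = esum r m G.
Proof.
elim: r m F G => [|r IH] m F G H /=; first by rewrite H.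
apply: eq_bigr => i _; apply: IH => e se ae; apply: H; rewrite /= ?se//.
rewrite -ltnS ltn_ord /=; apply: sub_all ae => x; lia.
Qed.

Lemma esum_sum (V : nmodType) r m (I : Type) (s : seq I) (F : I -> seq nat -> V) :
  esum r m (fun e => \sum_(i <- s) F i e) = \sum_(i <- s) esum r m (F i).
Proof.
elim: r m F => [|r IH] m F /=; first by case: (m == _) => //; rewrite big1.
by rewrite exchange_big/=; apply: eq_bigr => i _; rewrite IH.
Qed.

Lemma esumZ (K : pzRingType) r m (c : K) (F : seq nat -> K) :
  esum r m (fun e => c * F e) = c * esum r m F.
Proof.
elim: r m F => [|r IH] m F /=; first by case: (m == _) => //; rewrite mulr0.
by rewrite mulr_sumr; apply: eq_bigr => i _; rewrite IH.
Qed.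

Definition coef_letters (K : nzRingType) (f : seq (nat -> {poly K})) (e : seq nat) :
    seq (nat -> K) :=
  [seq (fun n => (x.1 n : {poly K})`_x.2) | x : (nat -> {poly K}) * nat <- zip f e].

Lemma coef_nsum (K : fieldType) d a N (f : seq (nat -> {poly K})) j :
  (nsum d a N f)`_j = esum (size f) j (fun e => nsum d a N (coef_letters f e)).
Proof.
elim: f N j => [|g f IH] N j; first by rewrite /= coef1; case: eqP.
rewrite [size _]/= esumS nsum_cons coef_sum.
under eq_bigr => n _ do rewrite coefM.
rewrite exchange_big/=; apply: eq_bigr => i _; rewrite esum_sum.
by apply: eq_bigr => n _; rewrite esumZ IH.
Qed.

(** Working in [K[X] / X^(M+1)] makes [1 - X a] invertible without power series, and
    loses no coefficient of degree at most [M]. *)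
Lemma in_qpoly_eq0_coef (K : fieldType) M (D : {poly K}) :
  in_qpoly 'X^(M.+1) D = 0 -> forall j, (j <= M)%N -> D`_j = 0.
Proof.
move=> /(congr1 val) /= h j jM.
have mX : mk_monic ('X^(M.+1) : {poly K}) = 'X^(M.+1) by rewrite mk_monic_Xn.
move: h; rewrite mX => h.
rewrite (Pdiv.RingMonic.rdivp_eq (monicXn K M.+1) D) h addr0 coefMXn ltnS jM //.
Qed.

Section CoefDuality.
Variables (K : fieldType) (q : K) (P : nat).
Hypothesis qn_root : qn q P.+1 = 0.
Hypothesis qn_neq0 : forall m, (0 < m <= P)%N -> qn q m != 0.

Definition corr_poly : {poly K} := \prod_(1 <= j < P.+1) (1 - 'X * (qa q j)%:P).

Definition geo_trunc (M : nat) (c : K) : {poly K} := \poly_(i < M.+1) c ^+ i.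

(** The binomial series of [(1 - X c)^-s]. For [s = 0] the truncated subtraction gives
    the right value at [e = 0] as well. *)
Lemma coef_geo_trunc M c s e : (e <= M)%N ->
  (geo_trunc M c ^+ s)`_e = 'C(s + e - 1, e)%:R * c ^+ e.
Proof.
elim: s e => [|s IH] e eM.
  rewrite expr0 coef1; case: e {eM} => [|e]; first by rewrite bin0 mul1r.
  by rewrite bin_small ?mul0r//; lia.
rewrite exprS coefM.
have hs : (\sum_(i < e.+1) 'C(s + (e - i) - 1, e - i) = 'C(s.+1 + e - 1, e))%N.
  rewrite addSn subn1 /= (reindex_inj rev_ord_inj)/=.
  rewrite (eq_bigr (fun i : 'I_e.+1 => 'C(s + i - 1, i))); last first.
    by move=> i _; have := ltn_ord i; rewrite ltnS => ie; congr 'C(_, _); lia.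
  elim: (e) => [|n IHn]; first by rewrite big_ord1 !bin0.
  by rewrite big_ord_recr IHn /= addnS subn1 /= binS addnC.
rewrite -hs natr_sum mulr_suml; apply: eq_bigr => i _.
rewrite IH ?(leq_trans (leq_subr _ _))// coef_poly (leq_trans (ltn_ord i))// mulrCA.
by rewrite -exprD subnKC// -ltnS.
Qed.

Lemma geo_truncE M c : (1 - 'X * c%:P) * geo_trunc M c = 1 - c ^+ M.+1 *: 'X^(M.+1).
Proof.
rewrite /geo_trunc poly_def.
have -> : \sum_(i < M.+1) c ^+ i *: 'X^i = \sum_(i < M.+1) ('X * c%:P) ^+ i.
  by apply: eq_bigr => i _; rewrite exprMn -polyC_exp mulrC mul_polyC.
rewrite -opprB mulNr -subrX1 opprB exprMn -polyC_exp mulrC mul_polyC //.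
Qed.

Let L (l e : seq nat) : seq (nat -> K) :=
  [seq (fun n => qb q n * qa q n ^+ x.-1) | x <- oplus l e].

(** The numbers [c2] in the order in which the letters of a nested sum are consumed. *)
Fixpoint c2_rec (top : nat) (l e : seq nat) : nat :=
  match l, e with
  | [:: k], x :: e' => 'C(k.-1 + top + 1 + x - 1, x)
  | k :: l', x :: e' => ('C(k.-1 + top + x - 1, x) * c2_rec 0 l' e')%N
  | _, _ => 1%N
  end.

Lemma c2_rec_cons top k y l x e : c2_rec top (k :: y :: l) (x :: e) =
  ('C(k.-1 + top + x - 1, x) * c2_rec 0 (y :: l) e)%N.
Proof. by []. Qed.

Lemma c2_recE top l e : is_index l -> size e = size l -> l != [::] ->
  c2_rec top l e = (\prod_(i < size l)
     'C(nth 0 l i + nth 0 e i + (i == 0 :> nat) * top + (i == (size l).-1 :> nat) - 2,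
        nth 0 e i))%N.
Proof.
elim: l top e => // k [|y l] IH top [|x e]// => [/andP[k0 _]|].
  by move=> _ _; rewrite big_ord1 /= mul1n; congr 'C(_, _); lia.
rewrite is_index_cons => /andP[k0 hl] [se] _.
rewrite c2_rec_cons IH// [RHS]big_ord_recl; congr (_ * _)%N.
  by rewrite /=; congr 'C(_, _); lia.
by apply: eq_bigr => i _; rewrite lift0 /= mul0n muln0 eqSS.
Qed.

Lemma c2_recE1 l e : is_index l -> size e = size l -> l != [::] ->
  c2_rec 1 l e = c2 l e.
Proof.
move=> hl se l0; rewrite c2_recE//; apply: eq_bigr => i _.
by rewrite muln1.
Qed.

Lemma nsum_star_letters M a N top l e : is_index l -> size e = size l ->
  all (fun x => x <= M)%N e ->
  nsum false a N (coef_letters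
    (star_letters q polyC (fun m => geo_trunc M (qa q m)) top l) e) =
  (c2_rec top l e)%:R * nsum false a N (L l e).
Proof.
have ck t n k x : (x <= M)%N -> (0 < k)%N ->
  ((qb q n)%:P * (qa q n)%:P ^+ k.-1 * geo_trunc M (qa q n) ^+ t)`_x =
  'C(t + x - 1, x)%:R * (qb q n * qa q n ^+ (k + x).-1).
  move=> xM k0; rewrite -polyC_exp -polyCM coefCM coef_geo_trunc//.
  have -> : (k + x).-1 = (k.-1 + x)%N by lia.
  by rewrite exprD; ring.
elim: l N top e => [|k [|y l] IH] N top e.
- by case: e => //; rewrite /= mulr1.
- case: e => [|x [|? ?]] // /andP[k0 _] _ /andP[xM _].
  rewrite /= mulr_sumr; apply: eq_bigr => n _.
  by rewrite ck// !mulr1.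
case: e => // x e; rewrite is_index_cons => /andP[k0 hl] [se] /andP[xM ae].
rewrite star_letters_cons c2_rec_cons [L _ _]/= -/(oplus _ _).
rewrite [coef_letters _ _]/= -/(coef_letters _ _) !nsum_cons mulr_sumr.
apply: eq_bigr => n _; rewrite IH// ck// natrM /L; ring.
Qed.

Lemma nsum_dual_letters M a N l e : is_index l -> size e = size l ->
  all (fun x => x <= M)%N e ->
  nsum false a N (coef_letters
    (dual_letters (fun m => (qa q m)%:P * geo_trunc M (qa q m))
       (fun m => (qb q m)%:P) l) e) =
  nsum false a N [seq (fun n => qb q n ^+ x.1.-1 * qa q n ^+ x.2.+1) | x <- zip l e].
Proof.
elim: l N e => [|k l IH] N [|x e] //; rewrite is_index_cons => /andP[k0 hl] [se] /andP[xM ae].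
rewrite /= ; apply: eq_bigr => n _; rewrite -[RHS]/(_ * nsum _ _ _ _) -IH// -polyC_exp mulrA.
rewrite -polyCM coefCM -[geo_trunc _ _]expr1 coef_geo_trunc// add1n subn1 /= binn mul1r.
by rewrite exprS; ring.
Qed.

(** The coefficient of [X^j] in [connected_duality], taken in [K[X] / X^(j+1)] with the
    truncated geometric series as inverses of [1 - X a]. *)
Theorem coef_duality l j : is_index l -> l != [::] ->
  \sum_(i < j.+1) corr_poly`_i * esum (size l) (j - i) (fun e =>
     (c2 l e)%:R * nsum false 0 P (L l e)) =
  - esum (size (hdual l)) j (fun e => nsum false 0 P
     [seq (fun n => qb q n ^+ x.1.-1 * qa q n ^+ x.2.+1) | x <- zip (hdual l) e]).
Proof.
move=> hl l0.
pose phi : {rmorphism {poly K} -> {poly %/ ('X^(j.+1) : {poly K})}} := in_qpoly ('X^(j.+1)).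
pose rho m := geo_trunc j (qa q m).
have phiX : phi 'X^(j.+1) = 0.
  apply: val_inj; rewrite /= mk_monic_Xn.
  by rewrite Pdiv.RingMonic.rmodpp ?monicXn.
have rhoE m : (0 < m <= P)%N ->
    (1 - phi 'X * (phi \o polyC) (qa q m)) * (phi \o rho) m = 1.
  move=> _; rewrite /= -(rmorph1 phi) -rmorphM -rmorphB -rmorphM geo_truncE.
  by rewrite rmorphB -mul_polyC rmorphM phiX mulr0 subr0.
have ph3 u v w s t : phi (u * v ^+ s * w ^+ t) = phi u * phi v ^+ s * phi w ^+ t.
  by rewrite !rmorphM !rmorphXn.
have := connected_duality qn_root qn_neq0 rhoE hl l0.
have -> : corr_prod q (phi \o polyC) (phi 'X) P = phi corr_poly.
  rewrite rmorph_prod; apply: eq_bigr => i _.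
  by rewrite rmorphB rmorph1 [phi (_ * _)]rmorphM.
have -> : star_letters q (phi \o polyC) (phi \o rho) 1 l =
   [seq phi \o g | g <- star_letters q polyC rho 1 l].
  elim: l 1%N {hl l0} => // k [|y l] IH t.
    by congr [:: _]; apply: funext => m; rewrite [RHS]ph3.
  rewrite !star_letters_cons IH; congr (_ :: _); apply: funext => m.
  by rewrite [RHS]ph3.
set al := (X in dual_letters X).
have -> : dual_letters al (fun m => (phi \o polyC) (qb q m)) (hdual l) =
   [seq phi \o g | g <- dual_letters (fun m => (qa q m)%:P * rho m) (fun m => (qb q m)%:P) (hdual l)].
  rewrite -map_comp; apply: eq_map => d; apply: funext => m.
  by rewrite /al /= [in RHS]rmorphM [in RHS]rmorphXn [in RHS]rmorphM.
rewrite -!nsum_rmorph -rmorphM => /eqP; rewrite -addr_eq0 -rmorphD => /eqP D0.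
have := in_qpoly_eq0_coef D0 (leqnn j); rewrite coefD coefM => /eqP.
rewrite addr_eq0 => /eqP; under eq_bigr => i _ do rewrite coef_nsum.
rewrite coef_nsum => E.
have szl t : size (star_letters q polyC rho t l) = size l.
  by elim: (l) t => // k [|y l'] IH t //; rewrite star_letters_cons /= IH.
have szd : size (dual_letters (fun m => (qa q m)%:P * rho m) (fun m => (qb q m)%:P) (hdual l)) =
  size (hdual l) by rewrite size_map.
rewrite szd (eq_esum (G := fun e => nsum false 0 P
     [seq (fun n => qb q n ^+ x.1.-1 * qa q n ^+ x.2.+1) | x <- zip (hdual l) e])) in E; last first.
  by move=> e se ae; rewrite nsum_dual_letters// hdual_pos.
rewrite -E; apply: eq_bigr => i _; congr (_ * _); rewrite szl; apply: eq_esum => e se ae.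
rewrite nsum_star_letters ?c2_recE1//; apply: sub_all ae => x; lia.
Qed.

End CoefDuality.

(** * Agreement with the block description of the dual *)

Definition block_word (bs : seq (nat * nat)) : seq nat :=
  flatten [seq x.1.+1 :: nseq x.2.-1 1%N | x <- bs].

(** Counting one more leading entry 1 changes only the first block. *)
Lemma block_word_incr b t :
  block_word (blocks_of b.+1 t) = incr_head (block_word (blocks_of b t)).
Proof.
elim: t b => // x [|y t] IH b //.
rewrite -[blocks_of b.+1 _]/(if (x <= 1)%N then blocks_of b.+2 (y :: t)
  else (b.+1, x.-1) :: blocks_of 1 (y :: t)).
rewrite -[blocks_of b _]/(if (x <= 1)%N then blocks_of b.+1 (y :: t)
  else (b, x.-1) :: blocks_of 1 (y :: t)).
by case: ifP => _; [exact: IH|].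
Qed.

Lemma hoffman_dual_rec k x l : is_index (x :: l) ->
  hoffman_dual (k :: x :: l) = nseq k.-1 1%N ++ incr_head (hoffman_dual (x :: l)).
Proof.
case: l => [|y l] /andP[x0 _]; first by case: x x0 => // x _; rewrite /= /dual_of_blocks /= cats0.
rewrite -[LHS]/(nseq k.-1 1%N ++ block_word (blocks_of 1 (x :: y :: l))); congr (_ ++ _).
rewrite -[hoffman_dual _]/(nseq x.-1 1%N ++ block_word (blocks_of 1 (y :: l))).
rewrite -[blocks_of 1 _]/(if (x <= 1)%N then blocks_of 2 (y :: l)
  else (1%N, x.-1) :: blocks_of 1 (y :: l)).
by case: x x0 => [|[|x]] // _; exact: block_word_incr.
Qed.

Lemma hoffman_dualE k : is_index k -> hoffman_dual k = hdual k.
Proof.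
elim: k => // a [|x l] IH // /andP[_ hl].
by rewrite hoffman_dual_rec// IH.
Qed.

Definition incr_last (l : seq nat) : seq nat := rev (incr_head (rev l)).

Lemma incr_last_rcons s x : incr_last (rcons s x) = rcons s x.+1.
Proof. by rewrite /incr_last rev_rcons /= rev_cons revK. Qed.

(** The recursion of the dual from the right end, which mirrors the one that defines
    [hdual]; hence the dual commutes with reversal. *)
Lemma hdual_rcons l k : is_index (rcons l k) -> l != [::] ->
  hdual (rcons l k) = incr_last (hdual l) ++ nseq k.-1 1%N.
Proof.
elim: l => // x [|y l] IH; rewrite rcons_cons is_index_cons => /andP[x0 hl] _.
  rewrite /= (_ : nseq x 1%N = rcons (nseq x.-1 1%N) 1%N); last first.
    by rewrite -[in LHS](prednK x0) -cats1 -[[:: 1%N]]/(nseq 1 1%N) -nseqD addn1.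
  have k0 : (0 < k)%N by case/andP: hl.
  by rewrite incr_last_rcons cat_rcons -[in LHS](prednK k0).
have hd : hdual (y :: l) != [::].
  apply: hdual_neq0 => //; move: hl; rewrite /is_index all_rcons.
  by case/andP.
rewrite rcons_cons !hdual_cons -rcons_cons.
rewrite IH//; case/lastP: (hdual (y :: l)) hd => // s z _.
rewrite incr_last_rcons; case: s => [|d s]; first by rewrite /= cats1 incr_last_rcons cat_rcons.
by rewrite /= -rcons_cons -rcons_cat incr_last_rcons rcons_cat -catA.
Qed.

Lemma hdual_rev k : is_index k -> hdual (rev k) = rev (hdual k).
Proof.
elim: k => // x [|y l] IH; rewrite is_index_cons => /andP[x0 hl].
  by rewrite /= rev_nseq.
rewrite rev_cons hdual_rcons; last 2 first.
- by rewrite /is_index -rev_cons all_rev /= x0.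
- by rewrite rev_cons; case: (rev l).
rewrite IH// hdual_cons rev_cat rev_nseq /incr_last revK; done.
Qed.

Lemma is_index_rev k : is_index (rev k) = is_index k.
Proof. exact: all_rev. Qed.

(** * The exact duality in terms of indices *)

Lemma esum_rev (V : nmodType) r m (F : seq nat -> V) :
  esum r m (fun e => F (rev e)) = esum r m F.
Proof.
rewrite -!(esumE _ _ (leqnn m)).
rewrite (reindex_inj (can_inj (_ : involutive (fun t : r.-tuple 'I_m.+1 => [tuple of rev t])))) /=.
  by apply: eq_big => e; rewrite /vals /wt ?map_rev ?sumn_rev ?revK.
by move=> t; apply: val_inj; rewrite /= revK.
Qed.

Lemma c2_rev k e : size e = size k -> c2 (rev k) (rev e) = c2 k e.
Proof.
move=> se; rewrite /c2 /dep size_rev (reindex_inj rev_ord_inj)/=.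
apply: eq_bigr => i _; have ik := ltn_ord i.
rewrite !nth_rev ?se; [|lia|lia].
rewrite (_ : size k - (size k - i.+1).+1 = i)%N; last lia.
congr 'C(_ - 2, _); lia.
Qed.

Lemma oplus_rev k e : size e = size k -> oplus (rev k) (rev e) = rev (oplus k e).
Proof. by move=> se; rewrite /oplus -rev_zip// map_rev. Qed.

Lemma oplus_index k e : size e = size k -> is_index k -> is_index (oplus k e).
Proof.
elim: k e => [|x k IH] [|y e]// [se] /andP[x0 hk].
by rewrite -[oplus _ _]/((x + y)%N :: oplus k e) is_index_cons IH// addn_gt0 x0.
Qed.

Section ExactDuality.
Variables (K : fieldType) (q : K) (P : nat).

(** The deformation of [n^-x] on the side of the index itself. *)
Definition bletter (x : nat) (n : nat) : K := qb q n * qa q n ^+ x.-1.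
(** The deformation of [n^-(x.1 + x.2)] on the dual side, for an entry [x.1] raised by
    [x.2]. The letters [qa] and [qb] occur here with interchanged roles. *)
Definition aletter (x : nat * nat) (n : nat) : K := qb q n ^+ x.1.-1 * qa q n ^+ x.2.+1.

Theorem exact_duality (k : seq nat) (j : nat) :
  qn q P.+1 = 0 -> (forall m, (0 < m <= P)%N -> qn q m != 0) ->
  is_index k -> k != [::] ->
  \sum_(i < j.+1) (corr_poly q P)`_i * esum (dep k) (j - i) (fun e =>
     (c2 k e)%:R * nsum false 0 P [seq bletter x | x <- rev (oplus k e)]) =
  - esum (dep (hoffman_dual k)) j (fun e =>
      nsum false 0 P [seq aletter x | x <- rev (zip (hoffman_dual k) e)]).
Proof.
move=> q0 qne hk k0; have hr : is_index (rev k) by rewrite is_index_rev.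
have r0 : rev k != [::] by rewrite -size_eq0 size_rev size_eq0.
have := coef_duality q0 qne j hr r0.
rewrite hdual_rev// -hoffman_dualE// !size_rev => E.
rewrite -[in RHS]esum_rev; move: E.
rewrite -(eq_esum (F := fun e => nsum false 0 P
   [seq aletter x | x <- rev (zip (hoffman_dual k) (rev e))])); last first.
  by move=> e se _; rewrite -[in RHS](revK e) -rev_zip// size_rev.
move=> <-; apply: eq_bigr => i _; congr (_ * _); rewrite -[LHS]esum_rev.
apply: eq_esum => e se _; rewrite -[in RHS](revK e) c2_rev ?size_rev//.
by rewrite oplus_rev ?size_rev.
Qed.

End ExactDuality.

(** * Finite multiple zeta-star values *)

Section PrimeField.
Variables (p : nat) (p_pr : prime p).
Local Notation F := 'F_p.

Lemma qn_Fp m : qn (1 : F) m = m%:R.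
Proof. by rewrite /qn (eq_bigr (fun=> 1)) ?sumr_const ?card_ord// => i _; rewrite expr1n. Qed.

Lemma natFp_neq0 m : (0 < m < p)%N -> m%:R != 0 :> F.
Proof.
move=> /andP[m0 mp]; rewrite -(dvdn_pcharf (pchar_Fp p_pr)).
by apply/negP => /(dvdn_leq m0); rewrite leqNgt mp.
Qed.

Lemma size_corr_poly (K : fieldType) (q : K) P : (size (corr_poly q P) <= P.+1)%N.
Proof.
rewrite /corr_poly; elim: P => [|P IH]; first by rewrite big_geq// size_poly1.
rewrite big_nat_recr//=; apply: leq_trans (size_polyMleq _ _) _.
have f2 : (size (1 - 'X * (qa q P.+1)%:P)%R <= 2)%N.
  rewrite (leq_trans (size_polyD _ _))// size_poly1 size_polyN geq_max /=.
  by rewrite (leq_trans (size_polyMleq _ _))// size_polyX size_polyC; case: (_ != 0).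
by rewrite -subn1 leq_subLR (leq_trans (leq_add IH f2))// addn2.
Qed.

(** Both sides have degree less than [p] and agree at the [p] points of the field:
    a nonzero residue [j] is the root of the factor [1 - X / j], and a root of
    [1 - X^(p-1)] by Fermat. *)
Lemma corr_poly_Fp : corr_poly (1 : F) p.-1 = 1 - 'X^(p.-1).
Proof.
have p1 := prime_gt1 p_pr; have p0 := prime_gt0 p_pr.
apply/eqP; rewrite -subr_eq0; apply/eqP; set D := _ - _.
apply: (@roots_geq_poly_eq0 _ D (enum {: F})); last first.
- rewrite -cardE card_Fp// (leq_trans (size_polyD _ _))// geq_max size_polyN.
  rewrite (leq_trans (size_corr_poly _ _)) ?prednK//=.
  rewrite (leq_trans (size_polyD _ _))// geq_max size_poly1 size_polyN size_polyXn prednK//.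
  by rewrite leqnn p0.
- exact: enum_uniq.
apply/allP => x _; rewrite rootE /D !hornerE /corr_poly horner_prod.
case: (eqVneq x 0) => [->|x0].
  rewrite expr0n (_ : (p.-1 == 0)%N = false); last by lia.
  rewrite subr0 big1 ?subrr// => i _.
  by rewrite !hornerE ?mul0r ?subr0.
have xE : (nat_of_ord x)%:R = x by rewrite natr_Zp.
have xp : (x < p)%N by rewrite -[X in (_ < X)%N](Fp_cast p_pr) ltn_ord.
have xpos : (0 < x)%N by rewrite lt0n; apply: contra_neq x0 => e; rewrite -xE e.
have -> : x ^+ p.-1 = 1.
  apply: (mulfI x0); rewrite -exprS prednK// mulr1.
  by have := expf_card x; rewrite card_Fp.
rewrite subrr subr0; rewrite prodf_seq_eq0; apply/hasP; exists (nat_of_ord x).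
  by rewrite mem_index_iota xpos prednK.
rewrite -polyC1 hornerD hornerN hornerM hornerX !hornerC.
by rewrite /qa expr1n qn_Fp xE mul1r mulfV// subrr.
Qed.

Lemma coef_corr_poly_Fp i : (i < p.-1)%N -> (corr_poly (1 : F) p.-1)`_i = (i == 0%N)%:R.
Proof.
by move=> ip; rewrite corr_poly_Fp coefB coef1 coefXn (ltn_eqF ip) subr0.
Qed.

(** For [q = 1] both [qa] and [qb] are [1/n], and only the constant coefficient of
    [1 - X^(p-1)] is seen in degrees below [p - 1]. *)
Lemma duality_Fp k m : (m < p.-1)%N -> is_index k -> k != [::] ->
  esum (dep k) m (fun e => mhs_star F p.-1 (oplus k e) *+ c2 k e) =
  - esum (dep (hoffman_dual k)) m (fun e => mhs_star F p.-1 (oplus (hoffman_dual k) e)).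
Proof.
move=> mp hk k0; have p0 := prime_gt0 p_pr.
have q0 : qn (1 : F) p.-1.+1 = 0 by rewrite qn_Fp prednK// pchar_Fp_0.
have qne j : (0 < j <= p.-1)%N -> qn (1 : F) j != 0.
  by move=> jp; rewrite qn_Fp natFp_neq0; lia.
have := exact_duality m q0 qne hk k0.
rewrite big_ord_recl [X in _ + X]big1 ?addr0; last first.
  by move=> i _; rewrite coef_corr_poly_Fp ?mul0r// lift0; have := ltn_ord i; lia.
rewrite coef_corr_poly_Fp ?mul1r; last exact: leq_ltn_trans mp.
rewrite subn0 => E.
have e1 : esum (dep k) m (fun e => (c2 k e)%:R * nsum false 0 p.-1
    [seq bletter (1 : F) x | x <- rev (oplus k e)]) =
    esum (dep k) m (fun e => mhs_star F p.-1 (oplus k e) *+ c2 k e).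
  apply: eq_esum => e se _; rewrite mulr_natl mhs_starE; congr (_ *+ _).
  have hi : is_index (rev (oplus k e)) by rewrite is_index_rev oplus_index.
  congr nsum; apply/eq_in_map => x xi; apply: funext => n.
  rewrite /bletter /qa /qb expr1n qn_Fp mul1r -exprS prednK//.
  exact: (allP hi).
rewrite -e1 E; congr (- _).
apply: eq_esum => e se _; rewrite mhs_starE /oplus -map_rev /lpow -map_comp.
have hi : is_index (hoffman_dual k) by rewrite hoffman_dualE// hdual_pos.
congr nsum; apply/eq_in_map => x; rewrite mem_rev => xi; apply: funext => n.
rewrite /aletter /qa /qb expr1n qn_Fp mul1r -exprD /=; congr (_ ^+ _).
suff : (0 < x.1)%N by case: (x.1) => // ? _; rewrite addSn addnS.
case: x xi => x y /= /(map_f fst); rewrite /= => xi.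
apply: (allP hi); have := xi; rewrite -/unzip1 -/(unzip1 _) unzip1_zip ?se//.
Qed.

End PrimeField.

Section FiniteValues.
Local Open Scope quotient_scope.

Lemma prodF_sum (I : Type) (s : seq I) (Q : pred I) (F : I -> prodF) p :
  (\sum_(i <- s | Q i) F i) p = \sum_(i <- s | Q i) F i p.
Proof. by elim/big_rec2: _ => // i x y _ <-. Qed.

Lemma prodF_natmul (f : prodF) n p : (f *+ n) p = f p *+ n.
Proof. by elim: n => // n IH; rewrite !mulrS -IH. Qed.

(** The primes [p <= m + 1] are finite in number. *)
Theorem duality_A k m : is_index k -> k != [::] ->
  \sum_(e : (dep k).-tuple 'I_m.+1 | wt (vals e) == m)
    zeta_A_star (oplus k (vals e)) *+ c2 k (vals e) =
  - \sum_(e : (dep (hoffman_dual k)).-tuple 'I_m.+1 | wt (vals e) == m)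
      zeta_A_star (oplus (hoffman_dual k) (vals e)).
Proof.
move=> hk k0; pose f l : prodF := fun p => mhs_star 'F_(val p) (val p).-1 l.
pose u : prodF := \sum_(e : (dep k).-tuple 'I_m.+1 | wt (vals e) == m)
    f (oplus k (vals e)) *+ c2 k (vals e).
pose v : prodF := \sum_(e : (dep (hoffman_dual k)).-tuple 'I_m.+1 | wt (vals e) == m)
    f (oplus (hoffman_dual k) (vals e)).
transitivity (\pi_{ideal_quot sumF} u : calA).
  rewrite raddf_sum; apply: eq_bigr => e _; by rewrite raddfMn.
transitivity (\pi_{ideal_quot sumF} (- v) : calA); last first.
  by rewrite raddfN raddf_sum.
apply/eqP; rewrite -Quotient.idealrBE opprK; apply/asboolP.
have fin : finite_set [set p : prime_nat | (val p < m.+2)%N].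
  apply: (@finite_preimage _ _ `I_m.+2 (fun p : prime_nat => val p)).
    by move=> x y _ _; exact: val_inj.
  exact: finite_II.
apply: sub_finite_set fin => p /=; apply: contraR; rewrite -leqNgt => mp.
have p_pr := valP p.
have mp' : (m < (val p).-1)%N by rewrite -ltnS prednK ?(prime_gt0 p_pr).
have := duality_Fp p_pr mp' hk k0.
rewrite -!(esumE _ _ (leqnn m)) => E.
rewrite -[(u + v) p]/(u p + v p) /u /v !prodF_sum.
under eq_bigr => e _ do rewrite prodF_natmul.
by rewrite E addNr.
Qed.

End FiniteValues.

(** * Asymptotic calculus *)

Section ComplexNorm.
Variable R : realType.
Local Notation C := R[i].

Definition cabs (z : C) : R := ComplexField.Normc.normc z.
Arguments cabs : simpl never.

Lemma cabs0 : cabs 0 = 0. Proof. exact: ComplexField.Normc.normc0. Qed.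
Lemma cabs1 : cabs 1 = 1. Proof. exact: ComplexField.Normc.normc1. Qed.
Lemma cabsM x y : cabs (x * y) = cabs x * cabs y. Proof. exact: ComplexField.Normc.normcM. Qed.
Lemma cabsV x : cabs x^-1 = (cabs x)^-1. Proof. exact: ComplexField.Normc.normcV. Qed.
Lemma cabsN x : cabs (- x) = cabs x. Proof. exact: (normcN (x : Rcomplex R)). Qed.
Lemma cabsD x y : cabs (x + y) <= cabs x + cabs y.
Proof. exact: (@le_normcD R (x : Rcomplex R) y). Qed.
Lemma cabsB x y : cabs (x - y) <= cabs x + cabs y.
Proof. by rewrite (le_trans (cabsD _ _))// cabsN. Qed.
Lemma cabs_ge0 x : 0 <= cabs x. Proof. by case: x => a b; rewrite sqrtr_ge0. Qed.
Lemma cabs_eq0 x : cabs x = 0 -> x = 0. Proof. exact: ComplexField.Normc.eq0_normc. Qed.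
Lemma cabsX x n : cabs (x ^+ n) = cabs x ^+ n.
Proof. by elim: n => [|n IH]; rewrite ?expr0 ?cabs1// !exprS cabsM IH. Qed.
Lemma cabs_real (x : R) : cabs x%:C%C = `|x|.
Proof. by rewrite /cabs /ComplexField.Normc.normc /= expr0n addr0 sqrtr_sqr. Qed.
Lemma cabs_nat n : cabs n%:R = n%:R.
Proof. by rewrite -(rmorph_nat (real_complex R)) cabs_real ger0_norm. Qed.
Lemma cabs_sum (I : Type) (s : seq I) (P : pred I) (F : I -> C) :
  cabs (\sum_(i <- s | P i) F i) <= \sum_(i <- s | P i) cabs (F i).
Proof.
elim/big_rec2: _ => [|i x y _ h]; first by rewrite cabs0.
by rewrite (le_trans (cabsD _ _))// lerD2l.
Qed.
Lemma cabs_distl x y : cabs x - cabs y <= cabs (x - y).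
Proof. by rewrite lerBlDr -[x in leLHS](subrK y) cabsD. Qed.

End ComplexNorm.
Arguments cabs {R} z : simpl never.

Section Harmonic.
Variable R : realType.

Definition harm (N : nat) : R := \sum_(1 <= m < N.+1) m%:R^-1.

Lemma harm0 : harm 0 = 0. Proof. by rewrite /harm big_geq. Qed.
Lemma harmS N : harm N.+1 = harm N + N.+1%:R^-1. Proof. by rewrite /harm big_nat_recr. Qed.
Lemma harm1 : harm 1 = 1. Proof. by rewrite harmS harm0 add0r invr1. Qed.

Lemma harm_mono m n : (m <= n)%N -> harm m <= harm n.
Proof.
elim: n => [|n IH]; first by rewrite leqn0 => /eqP->.
rewrite leq_eqVlt => /orP[/eqP->//|]; rewrite ltnS => /IH h.
by rewrite (le_trans h)// harmS lerDl invr_ge0.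
Qed.

Lemma harm_ge1 N : (0 < N)%N -> 1 <= harm N.
Proof. by move=> N0; rewrite -harm1 harm_mono. Qed.

Lemma harm_ge0 N : 0 <= harm N.
Proof. by rewrite -harm0 harm_mono. Qed.

Lemma harm_double m : (0 < m)%N -> harm m + 2^-1 <= harm (m + m).
Proof.
move=> m0; rewrite /harm (@big_cat_nat _ _ _ m.+1 1 (m + m).+1)//=; last by lia.
rewrite lerD2l.
have -> : (2^-1 : R) = \sum_(m.+1 <= i < (m + m).+1) (m + m)%:R^-1.
  rewrite sumr_const_nat subSS addKn -[RHS]mulr_natr natrD.
  have m0' : (m%:R + m%:R : R) != 0 by rewrite -natrD pnatr_eq0; lia.
  by field.
rewrite !big_nat; apply: ler_sum => i /andP[mi im].
by rewrite lef_pV2 ?posrE ?ltr0n ?ler_nat//; lia.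
Qed.

Lemma harm_unbounded (A : R) : exists N0, forall N, (N0 <= N)%N -> A <= harm N.
Proof.
have h k : k%:R / 2 <= harm (2 ^ k)%N.
  elim: k => [|k IH]; first by rewrite mul0r harm_ge0.
  rewrite expnS mul2n -addnn (le_trans _ (harm_double _)) ?expn_gt0//.
  by rewrite -natr1 mulrDl mul1r lerD2r.
have [k Ak] : exists k : nat, A * 2 <= k%:R.
  have [k /ltW hk] : exists k : nat, A * 2 < k%:R.
    exists (Num.trunc (Num.max 0 (A * 2))).+1.
    apply: (le_lt_trans _ (truncnS_gt _)); by rewrite le_max lexx orbT.
  by exists k.
exists (2 ^ k)%N => N kN; rewrite (le_trans _ (harm_mono kN))// (le_trans _ (h k))//.
by lra.
Qed.

Lemma bernoulli (t : R) s : 0 <= t <= 1 -> 1 - s%:R * t <= (1 - t) ^+ s.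
Proof.
move=> /andP[t0 t1]; elim: s => [|s IH]; first by rewrite expr0 mul0r subr0.
rewrite exprS -natr1.
have h : (1 - t) * (1 - s%:R * t) <= (1 - t) * (1 - t) ^+ s.
  by rewrite ler_wpM2l// subr_ge0.
apply: le_trans h; have s0 : 0 <= (s%:R : R) by []. 
have : 0 <= s%:R * t * t by rewrite !mulr_ge0.
by lra.
Qed.

(** A potential whose decrease at [n] dominates [h_n^s / n^2]; the shift by [2 s] makes
    the numerator grow slowly enough, relatively to the denominator, at every [n]. *)
Definition hpot (s N : nat) : R := (harm N + (2 * s)%:R) ^+ s / N%:R.

(** Write [X] for the base of the power at [n] and [X - d], [d = 1/n], for the one at
    [n - 1]. By Bernoulli [(X - d)^s >= X^s (1 - s d / X) >= X^s (1 - d / 2)] because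
    [X >= 2 s], and [(1 - d / 2) / (n-1) - 1 / n] is exactly half of [1 / (n (n-1))]. *)
Lemma hpot_diff s n : (1 < n)%N -> harm n ^+ s / n%:R ^+ 2 <= 2 * (hpot s n.-1 - hpot s n).
Proof.
case: n => // n n1; rewrite [n.+1.-1]/=.
have n0 : 0 < (n%:R : R) by rewrite ltr0n; lia.
have [nS] : (n.+1%:R : R) = n%:R + 1 by rewrite natr1.
rewrite /hpot; set X := harm n.+1 + (2 * s)%:R.
have hX : harm n + (2 * s)%:R = X - n.+1%:R^-1 by rewrite /X harmS; ring.
have X1 : 1 <= X by rewrite /X (le_trans (harm_ge1 _) (_ : harm n.+1 <= _))// lerDl.
have Xs : 2 * s%:R <= X by rewrite /X natrM lerDr harm_ge0.
have hs : harm n.+1 ^+ s <= X ^+ s by rewrite lerXn2r ?nnegrE ?harm_ge0 ?(le_trans ler01)// lerDl.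
rewrite hX.
have Xp : 0 < X by rewrite (lt_le_trans _ X1).
pose d : R := n.+1%:R^-1.
have d0 : 0 < d by rewrite invr_gt0 ltr0n.
have d1 : d <= 1 by rewrite invf_le1 ?ltr0n// ler1n.
have key : X ^+ s * (1 - d / 2) <= (X - d) ^+ s.
  have -> : X - d = X * (1 - d / X) by rewrite mulrBr mulr1 mulrCA divff ?mulr1// gt_eqF.
  rewrite exprMn ler_pM2l ?exprn_gt0//.
  have t01 : 0 <= d / X <= 1.
    by apply/andP; split; [exact: divr_ge0 (ltW d0) (ltW Xp)|rewrite ler_pdivrMr// mul1r (le_trans d1)].
  apply: le_trans (bernoulli s t01).
  rewrite lerD2l lerN2 mulrCA ler_pM2l// ler_pdivrMr//; lra.
have Y0 : 0 <= X ^+ s by rewrite exprn_ge0// ltW.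
rewrite -/d in hX *.
apply: (@le_trans _ _ (X ^+ s / n.+1%:R ^+ 2)).
  by rewrite ler_wpM2r// invr_ge0 exprn_ge0.
apply: (@le_trans _ _ (2 * (X ^+ s * (1 - d / 2) / n%:R - X ^+ s / n.+1%:R))); last first.
  by rewrite ler_pM2l// lerD2r ler_wpM2r ?invr_ge0// invr_ge0 ltW.
have -> : 2 * (X ^+ s * (1 - d / 2) / n%:R - X ^+ s / n.+1%:R) =
          X ^+ s * (2 * ((1 - d / 2) / n%:R - n.+1%:R^-1)) by ring.
rewrite ler_wpM2l// /d nS.
have n1' : (n%:R + 1 : R) != 0 by lra.
have n0' : (n%:R : R) != 0 by lra.
have -> : 2 * ((1 - (n%:R + 1)^-1 / 2) / n%:R - (n%:R + 1)^-1) = (n%:R * (n%:R + 1))^-1 :> R.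
  by field; rewrite n0' n1'.
rewrite lef_pV2 ?posrE; [nra|nra|nra].
Qed.

Lemma hpot_sum s N M : (0 < N)%N -> (N <= M)%N ->
  \sum_(N.+1 <= n < M.+1) harm n ^+ s / n%:R ^+ 2 <= 2 * hpot s N.
Proof.
move=> N0 NM.
suff : \sum_(N.+1 <= n < M.+1) harm n ^+ s / n%:R ^+ 2 <= 2 * (hpot s N - hpot s M).
  move/le_trans; apply; rewrite ler_pM2l// gerBl /hpot.
  by rewrite divr_ge0// exprn_ge0// addr_ge0 ?harm_ge0.
elim: M NM => [|M IH] NM; first by rewrite big_geq//; lia.
case: (leqP N M) => [NM'|MN]; last first.
  have -> : N = M.+1 by lia.
  by rewrite big_geq// subrr mulr0.
rewrite big_nat_recr//=; apply: le_trans (lerD (IH NM') (@hpot_diff s M.+1 _)) _; first lia.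
by rewrite /=; lra.
Qed.

Lemma hpot_le s N : (0 < N)%N -> hpot s N <= (1 + (2 * s)%:R) ^+ s * (harm N ^+ s / N%:R).
Proof.
move=> N0; rewrite /hpot mulrA ler_wpM2r ?invr_ge0// -exprMn lerXn2r ?nnegrE//.
- by rewrite addr_ge0 ?harm_ge0.
- by rewrite mulr_ge0 ?harm_ge0// addr_ge0.
by rewrite mulrDl mul1r lerD2l ler_peMr// harm_ge1.
Qed.

Lemma hpot_bound s N : (0 < N)%N -> harm N ^+ s / N%:R <= hpot s 1.
Proof.
move=> N0; have /le_trans : harm N ^+ s / N%:R <= hpot s N.
  by rewrite ler_wpM2r ?invr_ge0// lerXn2r ?nnegrE ?harm_ge0 ?addr_ge0 ?harm_ge0// lerDl.
apply; elim: N N0 => // -[|N] IH _ //; apply: le_trans (IH isT).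
rewrite -subr_ge0 -(pmulr_rge0 _ (ltr0n R 2)); apply: le_trans (@hpot_diff s N.+2 isT).
by rewrite divr_ge0 ?exprn_ge0 ?harm_ge0.
Qed.

(** [h^(s+1) / N] is bounded and [h] is unbounded. *)
Lemma harm_ratio_small s (e : R) : 0 < e ->
  exists N0, forall N, (N0 <= N)%N -> harm N ^+ s / N%:R <= e.
Proof.
move=> e0; have [N0 H] := harm_unbounded (hpot s.+1 1 / e).
exists N0.+1 => N NN; have N1 : (0 < N)%N by lia.
have := hpot_bound s.+1 N1; have h1 := harm_ge1 N1.
have := H N (ltnW NN); rewrite ler_pdivrMr// => h2 h3.
have h0 : 0 < harm N by rewrite (lt_le_trans _ h1).
rewrite -(ler_pM2l h0); apply: le_trans h2.
by rewrite (le_trans _ h3)// exprS mulrA.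
Qed.

End Harmonic.

Section Negligible.
Variable R : realType.
Local Notation C := R[i].
Local Notation h := (harm R).
Implicit Types (u v : nat -> C).

(** Growth is measured by harmonic numbers instead of logarithms: the two are comparable
    and harmonic numbers are at least 1 from [N = 1] on, so that their powers are
    monotone in the exponent. *)
Definition tame u := exists (c : R) (J : nat),
  0 <= c /\ forall N, (0 < N)%N -> cabs (u N) <= c * h N ^+ J.

Definition negl u := exists (c : R) (J : nat),
  0 <= c /\ forall N, (0 < N)%N -> cabs (u N) <= c * (h N ^+ J / N%:R).

Lemma harm_exp_mono N i j : (0 < N)%N -> (i <= j)%N -> h N ^+ i <= h N ^+ j.
Proof. by move=> N0 ij; rewrite ler_weXn2l// harm_ge1. Qed.

Lemma eq_negl u v : (forall N, (0 < N)%N -> u N = v N) -> negl u -> negl v.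
Proof. by move=> uv [c [J [c0 H]]]; exists c, J; split=> // N N0; rewrite -uv// H. Qed.

Lemma eq_tame u v : (forall N, (0 < N)%N -> u N = v N) -> tame u -> tame v.
Proof. by move=> uv [c [J [c0 H]]]; exists c, J; split=> // N N0; rewrite -uv// H. Qed.

Lemma tame_cst z : tame (fun=> z).
Proof. by exists (cabs z), 0%N; split=> [|N _]; rewrite ?cabs_ge0// expr0 mulr1. Qed.

Lemma tameD u v : tame u -> tame v -> tame (fun N => u N + v N).
Proof.
move=> [c [J [c0 H]]] [d [L [d0 G]]]; exists (c + d), (maxn J L); split=> [|N N0].
  by rewrite addr_ge0.
rewrite (le_trans (cabsD _ _))// mulrDl lerD//.
  by rewrite (le_trans (H N N0))// ler_wpM2l// harm_exp_mono// leq_maxl.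
by rewrite (le_trans (G N N0))// ler_wpM2l// harm_exp_mono// leq_maxr.
Qed.

Lemma tameM u v : tame u -> tame v -> tame (fun N => u N * v N).
Proof.
move=> [c [J [c0 H]]] [d [L [d0 G]]]; exists (c * d), (J + L)%N; split=> [|N N0].
  by rewrite mulr_ge0.
by rewrite cabsM exprD mulrACA ler_pM ?cabs_ge0 ?H ?G.
Qed.

Lemma negl0 : negl (fun=> 0).
Proof. by exists 0, 0%N; split=> // N _; rewrite cabs0 mul0r. Qed.

Lemma neglD u v : negl u -> negl v -> negl (fun N => u N + v N).
Proof.
move=> [c [J [c0 H]]] [d [L [d0 G]]]; exists (c + d), (maxn J L); split=> [|N N0].
  by rewrite addr_ge0.
rewrite (le_trans (cabsD _ _))// mulrDl lerD//.
  rewrite (le_trans (H N N0))// ler_wpM2l// ler_wpM2r ?invr_ge0//.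
  by rewrite harm_exp_mono// leq_maxl.
rewrite (le_trans (G N N0))// ler_wpM2l// ler_wpM2r ?invr_ge0//.
by rewrite harm_exp_mono// leq_maxr.
Qed.

Lemma neglN u : negl u -> negl (fun N => - u N).
Proof. by move=> [c [J [c0 H]]]; exists c, J; split=> // N N0; rewrite cabsN H. Qed.

Lemma neglMl u v : tame u -> negl v -> negl (fun N => u N * v N).
Proof.
move=> [c [J [c0 H]]] [d [L [d0 G]]]; exists (c * d), (J + L)%N; split=> [|N N0].
  by rewrite mulr_ge0.
have -> : c * d * (h N ^+ (J + L) / N%:R) = c * h N ^+ J * (d * (h N ^+ L / N%:R)).
  by rewrite exprD; ring.
by rewrite cabsM ler_pM ?cabs_ge0 ?H ?G.
Qed.

Lemma neglMr u v : negl u -> tame v -> negl (fun N => u N * v N).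
Proof.
by move=> nu tv; apply: (eq_negl _ (neglMl tv nu)) => N _; rewrite mulrC.
Qed.

Lemma negl_sum (I : Type) (s : seq I) (P : pred I) (u : I -> nat -> C) :
  (forall i, P i -> negl (u i)) -> negl (fun N => \sum_(i <- s | P i) u i N).
Proof.
move=> H; elim: s => [|i s IH].
  by apply: (eq_negl _ negl0) => N _; rewrite big_nil.
case Pi : (P i).
  by apply: (eq_negl _ (neglD (H i Pi) IH)) => N _; rewrite big_cons Pi.
by apply: (eq_negl _ IH) => N _; rewrite big_cons Pi.
Qed.

Lemma negl_tame u : negl u -> tame u.
Proof.
move=> [c [J [c0 H]]]; exists c, J; split=> // N N0; rewrite (le_trans (H N N0))//.
by rewrite ler_wpM2l// ler_pdivrMr ?ltr0n// ler_peMr ?ler1n// exprn_ge0// harm_ge0.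
Qed.

Definition asym u v := negl (fun N => u N - v N).

Lemma asym_refl u : asym u u.
Proof. by apply: (eq_negl _ negl0) => N _; rewrite subrr. Qed.

Lemma asym_sym u v : asym u v -> asym v u.
Proof. by move/neglN; apply: eq_negl => N _; rewrite opprB. Qed.

Lemma asym_trans u v w : asym u v -> asym v w -> asym u w.
Proof. by move=> uv vw; apply: (eq_negl _ (neglD uv vw)) => N _; rewrite addrA subrK. Qed.

Lemma asymD u u' v v' : asym u u' -> asym v v' ->
  asym (fun N => u N + v N) (fun N => u' N + v' N).
Proof. by move=> a b; apply: (eq_negl _ (neglD a b)) => N _; ring. Qed.

Lemma asymN u u' : asym u u' -> asym (fun N => - u N) (fun N => - u' N).
Proof. by move/neglN; apply: eq_negl => N _; ring. Qed.

Lemma asym_tame u v : asym u v -> tame v -> tame u.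
Proof. by move=> /negl_tame uv tv; apply: (eq_tame _ (tameD uv tv)) => N _; rewrite subrK. Qed.

Lemma asymM u u' v v' : asym u u' -> asym v v' -> tame u' -> tame v' ->
  asym (fun N => u N * v N) (fun N => u' N * v' N).
Proof.
move=> a b tu tv; have tu0 := asym_tame a tu.
by apply: (eq_negl _ (neglD (neglMl tu0 b) (neglMr a tv))) => N _; ring.
Qed.

Lemma asym_sum (I : Type) (s : seq I) (P : pred I) (u v : I -> nat -> C) :
  (forall i, P i -> asym (u i) (v i)) ->
  asym (fun N => \sum_(i <- s | P i) u i N) (fun N => \sum_(i <- s | P i) v i N).
Proof. by move=> /(negl_sum s); apply: eq_negl => N _; rewrite sumrB. Qed.

Lemma eq_asym u u' v v' : (forall N, (0 < N)%N -> u N = u' N) ->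
  (forall N, (0 < N)%N -> v N = v' N) -> asym u v -> asym u' v'.
Proof. by move=> e f; apply: eq_negl => N N0; rewrite e// f. Qed.

Lemma tame_horner (D : {poly C}) u : tame u -> tame (fun N => D.[u N]).
Proof.
move=> tu; elim/poly_ind: D => [|D c IH].
  by apply: (eq_tame _ (tame_cst 0)) => N _; rewrite horner0.
by apply: (eq_tame _ (tameD (tameM IH tu) (tame_cst c))) => N _; rewrite hornerMXaddC.
Qed.

Lemma asym_horner (D : {poly C}) u v : asym u v -> tame v ->
  asym (fun N => D.[u N]) (fun N => D.[v N]).
Proof.
move=> uv tv; elim/poly_ind: D => [|D c IH].
  by apply: (eq_asym _ _ (asym_refl (fun=> 0))) => N _; rewrite horner0.
apply: (eq_asym _ _ (asymD (asymM IH uv (tame_horner D tv) tv) (asym_refl (fun=> c)))) => N _;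
  by rewrite hornerMXaddC.
Qed.

Definition small u := forall e : R, 0 < e -> exists N0, forall N, (N0 <= N)%N -> cabs (u N) <= e.

Lemma negl_small u : negl u -> small u.
Proof.
move=> [c [J [c0 H]]] e e0; have ec : 0 < e / (c + 1) by rewrite divr_gt0// ltr_wpDl.
have [N0 G] := harm_ratio_small J ec; exists N0.+1 => N NN.
have N1 : (0 < N)%N by lia.
have := G N (ltnW NN); rewrite ler_pdivlMr ?ltr_wpDl// => g.
apply: le_trans (H N N1) (le_trans _ g); rewrite mulrDr mulr1 mulrC lerDl.
by rewrite divr_ge0 ?exprn_ge0 ?harm_ge0.
Qed.

Lemma small_cst z : small (fun=> z) -> z = 0.
Proof.
move=> H; apply: cabs_eq0; apply/eqP/negPn/negP => z0.
have zp : 0 < cabs z by rewrite lt_def z0 cabs_ge0.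
have e0 : 0 < cabs z / 2 by rewrite divr_gt0.
by have [N0 /(_ N0 (leqnn _))] := H _ e0; lra.
Qed.

Definition diverges u := forall A : R, exists N0, forall N, (N0 <= N)%N -> A <= cabs (u N).

(** If [D(u) u + c] is small while [u] diverges, then [D(u)] is small as well; so the
    coefficients vanish one after the other, from the top. *)
Lemma horner_small_eq0 (D : {poly C}) u : diverges u -> small (fun N => D.[u N]) -> D = 0.
Proof.
move=> du; elim/poly_ind: D => [//|D c IH] H.
have D0 : D = 0.
  apply: IH => e e0; have [N1 H1] := H 1 ltr01.
  have [N2 H2] := du ((cabs c + 1) / e).
  exists (maxn N1 N2) => N; rewrite geq_max => /andP[n1 n2].
  have := H1 N n1; rewrite hornerMXaddC => h1.
  have u0 : 0 < cabs (u N).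
    by apply: lt_le_trans (H2 N n2); rewrite divr_gt0// ltr_wpDl// cabs_ge0.
  have h2 : cabs (D.[u N] * u N) <= cabs c + 1.
    rewrite -[_ * _](addrK c) (le_trans (cabsB _ _))// addrC; lra.
  rewrite -(ler_pM2r u0) -cabsM (le_trans h2)//.
  by have := H2 N n2; rewrite ler_pdivrMr// mulrC.
rewrite D0 mul0r add0r in H *; apply/eqP; rewrite polyC_eq0; apply/eqP.
by apply: small_cst => e /H[N0 G]; exists N0 => N /G; rewrite hornerC.
Qed.

End Negligible.

(** * Estimates for nested sums *)

Section Estimates.
Variable R : realType.
Local Notation C := R[i].
Local Notation h := (harm R).

Lemma harmE N : \sum_(1 <= n < N.+1) (n%:R^-1 : R) = h N.
Proof. by []. Qed.

Variable T : eqType.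
Implicit Types (l : seq T) (F G : T -> nat -> C).

Lemma nsum_le d N l F (c : R) : 0 <= c ->
  (forall x n, x \in l -> (0 < n <= N)%N -> cabs (F x n) <= c / n%:R) ->
  cabs (nsum d 0 N (map F l)) <= (c * h N) ^+ size l.
Proof.
move=> c0; elim: l N => [|x l IH] N H; first by rewrite /= cabs1.
rewrite [map _ _]/= nsum_cons (le_trans (cabs_sum _ _ _))// exprS -mulrA -{1}harmE.
rewrite mulr_suml mulr_sumr !big_nat; apply: ler_sum => n nN.
rewrite cabsM mulrA ler_pM ?cabs_ge0//; first by rewrite H ?mem_head.
apply: le_trans (IH _ _) _ => [y m yl mn|].
  by apply: H; [rewrite inE yl orbT|move: mn nN; lia].
by rewrite lerXn2r ?nnegrE ?mulr_ge0 ?harm_ge0// ler_wpM2l// harm_mono//; move: nN; lia.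
Qed.

(** Perturbing every letter by a relative error [k] perturbs the nested sum by a
    relative error of the same order. *)
Lemma nsum_diff1 N l F G (c k : R) : 0 <= c -> 0 <= k ->
  (forall x n, x \in l -> (0 < n <= N)%N ->
     [/\ cabs (F x n) <= c / n%:R, cabs (G x n) <= c / n%:R &
         cabs (F x n - G x n) <= k * (c / n%:R)]) ->
  cabs (nsum false 0 N (map F l) - nsum false 0 N (map G l)) <=
  k * (size l)%:R * (c * h N) ^+ size l.
Proof.
move=> c0 k0; elim: l N => [|x l IH] N H; first by rewrite /= subrr cabs0 mulr0 mul0r.
rewrite ![map _ (_ :: _)]/= !nsum_cons -sumrB (le_trans (cabs_sum _ _ _))// exprS.
rewrite [size (_ :: _)]/=; set s := size l; have -> : k * s.+1%:R * (c * h N * (c * h N) ^+ s) =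
  \sum_(1 <= n < N.+1) n%:R^-1 * (k * s.+1%:R * c * (c * h N) ^+ s).
  by rewrite -mulr_suml harmE; ring.
rewrite !big_nat; apply: ler_sum => n nN; rewrite [(n - _)%N]subn0.
have hn : (c * h n) ^+ s <= (c * h N) ^+ s.
  by rewrite lerXn2r ?nnegrE ?mulr_ge0 ?harm_ge0// ler_wpM2l// harm_mono//; move: nN; lia.
have Hl y m : y \in l -> (0 < m <= n)%N -> [/\ cabs (F y m) <= c / m%:R,
    cabs (G y m) <= c / m%:R & cabs (F y m - G y m) <= k * (c / m%:R)].
  by move=> yl mn; apply: H; [rewrite inE yl orbT|move: mn nN; lia].
have [Fx Gx Dx] := H x n (mem_head _ _) nN.
have -> : F x n * nsum false 0 n (map F l) - G x n * nsum false 0 n (map G l) =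
  (F x n - G x n) * nsum false 0 n (map F l) +
  G x n * (nsum false 0 n (map F l) - nsum false 0 n (map G l)) by ring.
rewrite (le_trans (cabsD _ _))// !cabsM.
have n0 : 0 <= (n%:R^-1 : R) by rewrite invr_ge0.
have e1 : cabs (F x n - G x n) * cabs (nsum false 0 n (map F l)) <=
   k * (c / n%:R) * (c * h N) ^+ s.
  rewrite ler_pM ?cabs_ge0//; apply: le_trans hn; apply: nsum_le => // y m yl mn.
  by have [] := Hl y m yl mn.
have e2 : cabs (G x n) * cabs (nsum false 0 n (map F l) - nsum false 0 n (map G l)) <=
   c / n%:R * (k * s%:R * (c * h N) ^+ s).
  rewrite ler_pM ?cabs_ge0// (le_trans (IH _ Hl))//.
  by rewrite ler_wpM2l// mulr_ge0.
apply: le_trans (lerD e1 e2) _; rewrite -natr1 le_eqVlt; apply/orP; left; apply/eqP; ring.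
Qed.

(** If the error of each letter is only [k c] instead of [k c / n], a factor [N] is
    lost. *)
Lemma nsum_diff2 N l F G (c k : R) : 0 <= c -> 0 <= k ->
  (forall x n, x \in l -> (0 < n <= N)%N ->
     [/\ cabs (F x n) <= c / n%:R, cabs (G x n) <= c / n%:R &
         cabs (F x n - G x n) <= k * c]) ->
  cabs (nsum false 0 N (map F l) - nsum false 0 N (map G l)) <=
  k * N%:R * (size l)%:R * (c * h N) ^+ size l.
Proof.
move=> c0 k0; elim: l N => [|x l IH] N H; first by rewrite /= subrr cabs0 mulr0 mul0r.
rewrite ![map _ (_ :: _)]/= !nsum_cons -sumrB (le_trans (cabs_sum _ _ _))// exprS.
rewrite ?[size (_ :: _)]/=; set s := size l.
have -> : k * N%:R * s.+1%:R * (c * h N * (c * h N) ^+ s) =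
  \sum_(1 <= n < N.+1) (k * s.+1%:R * (c * h N) * (c * h N) ^+ s).
  by rewrite sumr_const_nat subn1 /= -mulr_natr; ring.
rewrite !big_nat; apply: ler_sum => n nN; rewrite [(n - _)%N]subn0.
have hn : (c * h n) ^+ s <= (c * h N) ^+ s.
  by rewrite lerXn2r ?nnegrE ?mulr_ge0 ?harm_ge0// ler_wpM2l// harm_mono//; move: nN; lia.
have Hl y m : y \in l -> (0 < m <= n)%N -> [/\ cabs (F y m) <= c / m%:R,
    cabs (G y m) <= c / m%:R & cabs (F y m - G y m) <= k * c].
  by move=> yl mn; apply: H; [rewrite inE yl orbT|move: mn nN; lia].
have [Fx Gx Dx] := H x n (mem_head _ _) nN.
have -> : F x n * nsum false 0 n (map F l) - G x n * nsum false 0 n (map G l) =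
  (F x n - G x n) * nsum false 0 n (map F l) +
  G x n * (nsum false 0 n (map F l) - nsum false 0 n (map G l)) by ring.
rewrite (le_trans (cabsD _ _))// !cabsM.
have n1 : (n%:R : R) != 0 by rewrite pnatr_eq0; move: nN; lia.
have h1 : 1 <= h N by apply: harm_ge1; move: nN; lia.
have Y0 : 0 <= (c * h N) ^+ s by rewrite exprn_ge0// mulr_ge0// harm_ge0.
have e1 : cabs (F x n - G x n) * cabs (nsum false 0 n (map F l)) <=
   k * (c * h N) * (c * h N) ^+ s.
  rewrite ler_pM ?cabs_ge0//.
    by rewrite (le_trans Dx)// ler_wpM2l// ler_peMr.
  apply: le_trans hn; apply: nsum_le => // y m yl mn.
  by have [] := Hl y m yl mn.
have e2 : cabs (G x n) * cabs (nsum false 0 n (map F l) - nsum false 0 n (map G l)) <=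
   c / n%:R * (k * n%:R * s%:R * (c * h N) ^+ s).
  rewrite ler_pM ?cabs_ge0// (le_trans (IH _ Hl))//.
  by rewrite ler_wpM2l// !mulr_ge0.
apply: le_trans (lerD e1 e2) _.
have -> : c / n%:R * (k * n%:R * s%:R * (c * h N) ^+ s) = c * (k * s%:R * (c * h N) ^+ s).
  by field.
have : c * (k * s%:R * (c * h N) ^+ s) <= c * h N * (k * s%:R * (c * h N) ^+ s).
  by rewrite ler_wpM2r ?mulr_ge0// ler_peMr.
move/(lerD (lexx (k * (c * h N) * (c * h N) ^+ s)))/le_trans; apply.
rewrite -natr1 le_eqVlt; apply/orP; left; apply/eqP; ring.
Qed.

(** A letter of size [1 / n^2] at the largest variable [n] absorbs the factor [n] which
    [nsum_diff2] loses on the variables below it. *)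
Lemma nsum_diff_top N x l F G (c k : R) : 0 <= c -> 0 <= k ->
  (forall y n, y \in l -> (0 < n <= N)%N ->
     [/\ cabs (F y n) <= c / n%:R, cabs (G y n) <= c / n%:R &
         cabs (F y n - G y n) <= k * c]) ->
  (forall n, (0 < n <= N)%N ->
     cabs (G x n) <= c / n%:R ^+ 2 /\ cabs (F x n - G x n) <= k * (c / n%:R)) ->
  cabs (nsum false 0 N (map F (x :: l)) - nsum false 0 N (map G (x :: l))) <=
  k * (size l).+1%:R * (c * h N) ^+ (size l).+1.
Proof.
move=> c0 k0 H Hx.
rewrite ![map _ (_ :: _)]/= !nsum_cons -sumrB (le_trans (cabs_sum _ _ _))// exprS.
rewrite ?[size (_ :: _)]/=; set s := size l.
have -> : k * s.+1%:R * (c * h N * (c * h N) ^+ s) =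
  \sum_(1 <= n < N.+1) n%:R^-1 * (k * s.+1%:R * c * (c * h N) ^+ s).
  by rewrite -mulr_suml harmE; ring.
rewrite !big_nat; apply: ler_sum => n nN; rewrite [(n - _)%N]subn0.
have hn : (c * h n) ^+ s <= (c * h N) ^+ s.
  by rewrite lerXn2r ?nnegrE ?mulr_ge0 ?harm_ge0// ler_wpM2l// harm_mono//; move: nN; lia.
have Hl y m : y \in l -> (0 < m <= n)%N -> [/\ cabs (F y m) <= c / m%:R,
    cabs (G y m) <= c / m%:R & cabs (F y m - G y m) <= k * c].
  by move=> yl mn; apply: H => //; move: mn nN; lia.
have [Gx Dx] := Hx n nN.
have -> : F x n * nsum false 0 n (map F l) - G x n * nsum false 0 n (map G l) =
  (F x n - G x n) * nsum false 0 n (map F l) +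
  G x n * (nsum false 0 n (map F l) - nsum false 0 n (map G l)) by ring.
rewrite (le_trans (cabsD _ _))// !cabsM.
have n1 : (n%:R : R) != 0 by rewrite pnatr_eq0; move: nN; lia.
have e1 : cabs (F x n - G x n) * cabs (nsum false 0 n (map F l)) <=
   k * (c / n%:R) * (c * h N) ^+ s.
  rewrite ler_pM ?cabs_ge0//; apply: le_trans hn; apply: nsum_le => // y m yl mn.
  by have [] := Hl y m yl mn.
have e2 : cabs (G x n) * cabs (nsum false 0 n (map F l) - nsum false 0 n (map G l)) <=
   c / n%:R ^+ 2 * (k * n%:R * s%:R * (c * h N) ^+ s).
  rewrite ler_pM ?cabs_ge0// (le_trans (nsum_diff2 c0 k0 Hl))//.
  by rewrite ler_wpM2l// !mulr_ge0.
apply: le_trans (lerD e1 e2) _; rewrite -natr1 le_eqVlt; apply/orP; left; apply/eqP.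
by field.
Qed.

End Estimates.

(** * Convergence *)

Definition invn (K : fieldType) (n : nat) : K := n%:R^-1.
(** Admissibility for indices listed from the largest variable down. *)
Definition adm_top (l : seq nat) : bool := is_index l && (1 < head 2 l)%N.

Section Convergence.
Local Open Scope classical_set_scope.
Variable R : realType.
Local Notation C := R[i].
Local Notation h := (harm R).

Lemma nsum_ge0 d N l : 0 <= nsum d 0 N (lpow (invn R) l).
Proof.
elim: l N => [|x l IH] N //; rewrite [lpow _ _]/= nsum_cons.
by apply: sumr_ge0 => n _; rewrite mulr_ge0// exprn_ge0// invr_ge0.
Qed.

Lemma nsum_real d N l :
  (nsum d 0 N (lpow (invn R) l))%:C%C = nsum d 0 N (lpow (invn C) l).
Proof.
rewrite nsum_rmorph /lpow -map_comp; congr nsum; apply: eq_map => x; apply: funext => n /=.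
by rewrite rmorphXn /invn fmorphV rmorph_nat.
Qed.

Lemma invn_pow_le n k : (0 < n)%N -> (0 < k)%N -> invn R n ^+ k <= n%:R^-1.
Proof.
move=> n0 k0; rewrite -[leRHS]expr1 /invn ler_wiXn2l ?invr_ge0//.
by rewrite invf_le1 ?ltr0n// ler1n.
Qed.

Lemma nsum_le_real d N l : is_index l -> nsum d 0 N (lpow (invn R) l) <= h N ^+ size l.
Proof.
move=> hl; have := @nsum_le R _ d N l (fun x n => invn C n ^+ x) 1 ler01.
rewrite -[map _ _]/(lpow _ _) -nsum_real cabs_real ger0_norm ?nsum_ge0// mul1r; apply.
move=> x n xl /andP[n0 nN]; rewrite cabsX /invn cabsV cabs_nat mul1r.
by apply: invn_pow_le => //; exact: (allP hl).
Qed.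

Lemma nsum_mono d l : {homo (fun N => nsum d 0 N (lpow (invn R) l)) : m n / (m <= n)%N >-> m <= n}.
Proof.
case: l => // x l; apply: homo_leq => [//|? ? ?|n]; first exact: le_trans.
rewrite [lpow _ _]/= nsumS// lerDl mulr_ge0 ?nsum_ge0// exprn_ge0// invr_ge0//.
Qed.

(** The terms beyond [N] are at most [h_n^s / n^2], whose tail is controlled by
    [hpot]. *)
Lemma nsum_tail d l : adm_top l -> exists2 c : R, 0 <= c &
  forall N M, (0 < N <= M)%N ->
    nsum d 0 M (lpow (invn R) l) - nsum d 0 N (lpow (invn R) l) <=
    c * (h N ^+ (size l).-1 / N%:R).
Proof.
case: l => [|k l] /andP[hl k2].
  by exists 0 => // N M _; rewrite /= subrr mul0r.
move: hl; rewrite is_index_cons => /andP[_ hl].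
set s := size l; exists (2 * (1 + (2 * s)%:R) ^+ s).
  by rewrite mulr_ge0// exprn_ge0// addr_ge0.
move=> N M /andP[N0 NM]; rewrite [lpow _ _]/= !nsum_cons.
rewrite (big_cat_nat (n := N.+1))//= addrAC subrr add0r.
rewrite -mulrA; apply: (le_trans _ (ler_wpM2l _ (hpot_le R s N0))) => //.
apply: (le_trans _ (hpot_sum R s N0 NM)).
rewrite !big_nat; apply: ler_sum => n /andP[Nn nM].
have n0 : (0 < n)%N by lia.
rewrite mulrC ler_pM ?nsum_ge0 ?exprn_ge0 ?invr_ge0//.
  apply: le_trans (nsum_le_real _ _ hl) _; rewrite lerXn2r ?nnegrE ?harm_ge0//.
  by rewrite harm_mono// leq_subr.
rewrite -exprVn /invn ler_wiXn2l ?invr_ge0//.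
by rewrite invf_le1 ?ltr0n// ler1n.
Qed.

Definition nsum_lim d l : R := limn (fun N => nsum d 0 N (lpow (invn R) l)).

Lemma nsum_cvg d l : adm_top l ->
  (fun N => nsum d 0 N (lpow (invn R) l)) @ \oo --> nsum_lim d l.
Proof.
move=> al; have [c c0 H] := nsum_tail d al.
apply: nondecreasing_is_cvgn; first exact: nsum_mono.
exists (nsum d 0 1 (lpow (invn R) l) + c) => x [N _ <-].
case: N => [|N].
  by rewrite (le_trans (nsum_mono d l (leq0n 1)))// lerDl.
rewrite -lerBlDl (le_trans (H 1%N N.+1 _))// harm1 expr1n divr1 mulr1//.
Qed.

Lemma nsum_lim_asym d l : adm_top l ->
  asym (fun N => nsum d 0 N (lpow (invn C) l)) (fun=> (nsum_lim d l)%:C%C).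
Proof.
move=> al; have [c c0 H] := nsum_tail d al; exists c, (size l).-1; split=> // N N0.
rewrite -nsum_real -rmorphB cabs_real distrC ger0_norm.
  rewrite lerBlDr; apply: limr_le; first by apply/cvg_ex; eexists; exact: nsum_cvg.
  by exists N => // M /= NM; rewrite -lerBlDr H// N0.
rewrite subr_ge0; apply: limr_ge; first by apply/cvg_ex; eexists; exact: nsum_cvg.
by exists N => // M /= NM; exact: nsum_mono.
Qed.

End Convergence.

(** * Good families of weights *)

Section Good.
Variable R : realType.
Local Notation C := R[i].
Local Notation h := (harm R).

(** The weights [1/n] and both deformations of them at a root of unity near 1 are of this
    kind; [N] is at the same time the length of the chain and the quality of the
    approximation. *)
Definition good (w : nat -> nat -> C) := exists2 c : R, 1 <= c &
  forall N m, (0 < m <= N)%N ->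
    cabs (w N m) <= c / m%:R /\ cabs (w N m - m%:R^-1) <= c / N%:R.

Lemma good_invn : good (fun=> invn C).
Proof.
exists 1 => // N m /andP[m0 mN]; rewrite /invn subrr cabs0 cabsV cabs_nat mul1r.
by rewrite divr_ge0.
Qed.

Lemma cabs_subX (x y : C) (A : R) k : cabs x <= A -> cabs y <= A ->
  cabs (x ^+ k - y ^+ k) <= k%:R * cabs (x - y) * A ^+ k.-1.
Proof.
move=> xA yA; have A0 : 0 <= A by apply: le_trans xA; exact: cabs_ge0.
elim: k => [|k IH]; first by rewrite subrr cabs0 !mul0r.
have -> : x ^+ k.+1 - y ^+ k.+1 = x ^+ k * (x - y) + (x ^+ k - y ^+ k) * y.
  by rewrite !exprSr; ring.
rewrite (le_trans (cabsD _ _))// !cabsM cabsX -natr1 [k.+1.-1]/=.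
have e1 : cabs x ^+ k * cabs (x - y) <= A ^+ k * cabs (x - y).
  by rewrite ler_wpM2r ?cabs_ge0// lerXn2r ?nnegrE ?cabs_ge0.
have e2 : cabs (x ^+ k - y ^+ k) * cabs y <= k%:R * cabs (x - y) * A ^+ k.-1 * A.
  by rewrite ler_pM ?cabs_ge0.
apply: le_trans (lerD e1 e2) _; case: k {IH e1 e2} => [|k].
  by rewrite !expr0 !mul0r; lra.
by rewrite [k.+1.-1]/= -mulrA -exprSr le_eqVlt; apply/orP; left; apply/eqP; ring.
Qed.

(** The powers of good weights satisfy the hypotheses of [nsum_diff2] and, from the square
    on, those on the top letter in [nsum_diff_top]. *)
Lemma good_pow w : good w -> forall W, exists2 c : R, 1 <= c & forall N k n,
  (0 < k <= W)%N -> (0 < n <= N)%N ->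
  [/\ cabs (w N n ^+ k) <= c / n%:R, cabs (invn C n ^+ k) <= c / n%:R,
      cabs (w N n ^+ k - invn C n ^+ k) <= N%:R^-1 * c &
      (1 < k)%N -> cabs (invn C n ^+ k) <= c / n%:R ^+ 2 /\
        cabs (w N n ^+ k - invn C n ^+ k) <= N%:R^-1 * (c / n%:R)].
Proof.
move=> [c c1 H] W; have c0 : 0 <= c by apply: le_trans c1.
exists (W.+1%:R * c ^+ W).
  by rewrite -[leLHS]mulr1 ler_pM// ?ler1n// exprn_ege1.
move=> N k n /andP[k0 kW] /andP[n0 nN].
have [H1 H2] := H N n (introT andP (conj n0 nN)).
have nR : 1 <= (n%:R : R) by rewrite ler1n.
have ni : 0 <= (n%:R^-1 : R) by rewrite invr_ge0.
have ni1 : (n%:R^-1 : R) <= 1 by rewrite invf_le1// ltr0n.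
have hi : cabs (invn C n) <= c / n%:R by rewrite /invn cabsV cabs_nat ler_peMl.
have cW1 : 1 <= c ^+ W by rewrite exprn_ege1.
have cW : 1 <= W.+1%:R * c ^+ W by rewrite -[leLHS]mulr1 ler_pM// ler1n.
have ck : c ^+ k <= W.+1%:R * c ^+ W.
  by rewrite -[leLHS]mul1r ler_pM ?exprn_ge0 ?ler1n// ler_weXn2l.
have ikb j : (0 < j <= k)%N -> (n%:R^-1 : R) ^+ k <= n%:R^-1 ^+ j.
  by move=> /andP[_ jk]; rewrite ler_wiXn2l.
have dk : cabs (w N n ^+ k - invn C n ^+ k) <=
    N%:R^-1 * (W.+1%:R * c ^+ W * n%:R^-1 ^+ k.-1).
  apply: le_trans (cabs_subX k H1 hi) _.
  rewrite /invn; have kN : 0 <= (k%:R : R) by [].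
  apply: (@le_trans _ _ (k%:R * (c / N%:R) * (c / n%:R) ^+ k.-1)).
    by rewrite ler_wpM2r ?exprn_ge0 ?divr_ge0// ler_wpM2l.
  rewrite exprMn.
  have -> : k%:R * (c / N%:R) * (c ^+ k.-1 * n%:R^-1 ^+ k.-1) =
     N%:R^-1 * (k%:R * (c * c ^+ k.-1) * n%:R^-1 ^+ k.-1) by ring.
  rewrite -exprS prednK//; apply: ler_wpM2l; first by rewrite invr_ge0.
  apply: ler_wpM2r; first by rewrite exprn_ge0.
  by rewrite ler_pM ?exprn_ge0 ?ler_nat ?ler_weXn2l// ltnW.
have P0 : 0 <= W.+1%:R * c ^+ W by apply: le_trans cW.
have Ni : 0 <= (N%:R^-1 : R) by rewrite invr_ge0.
split.
- rewrite cabsX (le_trans (lerXn2r _ _ _ H1)) ?nnegrE ?cabs_ge0 ?divr_ge0// exprMn.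
  by rewrite ler_pM ?exprn_ge0// -[leRHS]expr1 ikb.
- rewrite cabsX /invn cabsV cabs_nat -[leLHS]mul1r ler_pM ?exprn_ge0//.
  by rewrite -[leRHS]expr1 ikb.
- by rewrite (le_trans dk)// ler_wpM2l// ler_piMr// exprn_ile1.
move=> k1; split.
  rewrite cabsX /invn cabsV cabs_nat -[leLHS]mul1r ler_pM ?exprn_ge0//.
  by rewrite -exprVn ikb.
rewrite (le_trans dk)// ler_wpM2l// ler_wpM2l//.
by rewrite -[leRHS]expr1 ler_wiXn2l// -ltnS prednK.
Qed.

Lemma mem_wt x l : x \in l -> (x <= wt l)%N.
Proof.
elim: l => // y l IH; rewrite inE /wt /= => /orP[/eqP->|/IH]; first exact: leq_addr.
rewrite /wt; lia.
Qed.

Lemma good_tame w : good w -> tame (fun N => nsum false 0 N (lpow (w N) [:: 1%N])).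
Proof.
move=> [c c1 H]; exists c, 1%N; split=> [|N N0]; first exact: le_trans c1.
have := @nsum_le R _ false N [:: 1%N] (fun x n => w N n ^+ x) c (le_trans ler01 c1).
rewrite !expr1; apply => x n; rewrite inE => /eqP-> nN; rewrite expr1.
by have [] := H N n nN.
Qed.

(** There are [N] terms, each with an error [O(1/N)]. The difference need not tend to
    zero: for the weights [qa] and [qb] it has a nonzero limit. *)
Lemma good_T1_harm w : good w -> exists c : R, forall N, (0 < N)%N ->
  cabs (nsum false 0 N (lpow (w N) [:: 1%N]) - (h N)%:C%C) <= c.
Proof.
move=> [c c1 H]; exists c => N N0.
have -> : (h N)%:C%C = \sum_(1 <= n < N.+1) n%:R^-1 :> C.
  by rewrite rmorph_sum; apply: eq_bigr => n _; rewrite fmorphV rmorph_nat.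
rewrite /= -sumrB (le_trans (cabs_sum _ _ _))//.
have -> : c = \sum_(1 <= n < N.+1) c / N%:R.
  rewrite sumr_const_nat subn1 /= -mulr_natr.
  have N1 : (N%:R : R) != 0 by rewrite pnatr_eq0 -lt0n.
  by field.
rewrite !big_nat; apply: ler_sum => n nN; rewrite mulr1 expr1.
by have [] := H N n nN.
Qed.

(** Convergent sums do not see the difference between a good family and [1/n]. *)
Lemma good_adm w l : good w -> adm_top l ->
  asym (fun N => nsum false 0 N (lpow (w N) l)) (fun=> (nsum_lim R false l)%:C%C).
Proof.
move=> gw al; apply: asym_trans (nsum_lim_asym _ _ al).
case: l al => [|k l] al; first by apply: asym_refl.
have [c c1 H] := good_pow gw (wt (k :: l)); have c0 : 0 <= c by apply: le_trans c1.
case/andP: al => hl; rewrite [head _ _]/= => k2.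
exists ((size l).+1%:R * c ^+ (size l).+1), (size l).+1; split.
  by rewrite mulr_ge0// exprn_ge0.
move=> N N0.
have Ni : 0 <= (N%:R^-1 : R) by rewrite invr_ge0.
have := @nsum_diff_top R _ N k l (fun x n => w N n ^+ x) (fun x n => invn C n ^+ x)
  c N%:R^-1 c0 Ni.
move=> /(_ _ _)/le_trans; apply.
- move=> y n yl nN; have yk : y \in k :: l by rewrite inE yl orbT.
  have yW : (0 < y <= wt (k :: l))%N by rewrite mem_wt// andbT; exact: (allP hl).
  by have [] := H N y n yW nN.
- move=> n nN; have kW : (0 < k <= wt (k :: l))%N by rewrite mem_wt ?mem_head// andbT; lia.
  by have [_ _ _] := H N k n kW nN; apply.
by rewrite exprMn le_eqVlt; apply/orP; left; apply/eqP; ring.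
Qed.

(** Mixed products such as [a^i b^j] differ from pure powers of one weight by a relative
    error [O(1/N)], unless they consist of a single factor of the wrong kind. *)
Definition close_letters (T : eqType) (l : seq T) (wtl : T -> nat) (w : nat -> nat -> C)
    (F : nat -> T -> nat -> C) :=
  exists2 c : R, 0 <= c & forall N x n, x \in l -> (0 < n <= N)%N ->
    [/\ cabs (F N x n) <= c / n%:R, cabs (w N n ^+ wtl x) <= c / n%:R &
        cabs (F N x n - w N n ^+ wtl x) <= N%:R^-1 * (c / n%:R)].

Lemma close_letters_asym (T : eqType) (l : seq T) (wtl : T -> nat) (w : nat -> nat -> C)
    (F : nat -> T -> nat -> C) : close_letters l wtl w F ->
  asym (fun N => nsum false 0 N (map (F N) l))
       (fun N => nsum false 0 N (lpow (w N) (map wtl l))).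
Proof.
move=> [c c0 H]; exists ((size l)%:R * c ^+ size l), (size l); split.
  by rewrite mulr_ge0// exprn_ge0.
move=> N N0; have Ni : 0 <= (N%:R^-1 : R) by rewrite invr_ge0.
rewrite /lpow -map_comp.
have := @nsum_diff1 R _ N l (F N) (fun x n => w N n ^+ wtl x) c N%:R^-1 c0 Ni (H N).
by move/le_trans; apply; rewrite exprMn le_eqVlt; apply/orP; left; apply/eqP; ring.
Qed.

End Good.

(** * Harmonic products *)

Arguments nsum : simpl never.
Arguments is_index : simpl never.

(** Formal integral combinations of indices, which can be evaluated for all weights and
    all truncations simultaneously. *)
Definition evalc (K : comNzRingType) (d : bool) (w : nat -> K) (N : nat)
    (E : seq (int * seq nat)) : K :=
  \sum_(c <- E) c.1%:~R * nsum d 0 N (lpow w c.2).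

(** Either one of the two largest variables exceeds the other or they coincide. In star
    sums both of the first two terms contain the diagonal, which explains the sign of
    the third. *)
Lemma nsum_mul (K : comNzRingType) (d : bool) N (g h : nat -> K) f f' :
  nsum d 0 N (g :: f) * nsum d 0 N (h :: f') =
  \sum_(1 <= n < N.+1)
    (g n * (nsum d 0 (n - d) f * nsum d 0 (n - d) (h :: f')) +
     h n * (nsum d 0 (n - d) (g :: f) * nsum d 0 (n - d) f') +
     (-1) ^+ (~~ d) * (g n * h n) * (nsum d 0 (n - d) f * nsum d 0 (n - d) f')).
Proof.
elim: N => [|N IH]; first by rewrite !nsum_cons_nn big_geq ?mulr0.
rewrite big_nat_recr//= -IH !nsumS//; case: d {IH}.
  rewrite [(N.+1 - true)%N]subSS subn0 expr0; ring.
rewrite [(N.+1 - false)%N]subn0 !nsumS// [(N.+1 - false)%N]subn0 expr1; ring.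
Qed.

Lemma evalc_cat (K : comNzRingType) d (w : nat -> K) N E E' :
  evalc d w N (E ++ E') = evalc d w N E + evalc d w N E'.
Proof. by rewrite /evalc big_cat. Qed.

Lemma evalc_seq1 (K : comNzRingType) d (w : nat -> K) N c :
  evalc d w N [:: c] = c.1%:~R * nsum d 0 N (lpow w c.2).
Proof. by rewrite /evalc big_seq1. Qed.

Lemma evalc_one (K : comNzRingType) d (w : nat -> K) N l :
  evalc d w N [:: (1, l)] = nsum d 0 N (lpow w l).
Proof. by rewrite evalc_seq1 /= mulr1z mul1r. Qed.

Lemma evalc_neg (K : comNzRingType) d (w : nat -> K) N l :
  evalc d w N [:: (-1, l)] = - nsum d 0 N (lpow w l).
Proof. by rewrite evalc_seq1 /= mulrN1z mulN1r. Qed.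

Lemma evalc_map_cons (K : comNzRingType) d (w : nat -> K) N (s : int) k E :
  evalc d w N [seq (s * c.1, k :: c.2) | c <- E] =
  s%:~R * \sum_(1 <= n < N.+1) w n ^+ k * evalc d w (n - d) E.
Proof.
rewrite /evalc big_map; under [in RHS]eq_bigr => n _ do rewrite mulr_sumr.
rewrite exchange_big/= mulr_sumr; apply: eq_bigr => c _.
rewrite intrM -mulrA; congr (_ * _); rewrite mulr_sumr; apply: eq_bigr => n _.
by rewrite mulrCA.
Qed.

(** The expansion is the same for all rings, weights and truncations; this uniformity is
    what lets one polynomial regularize all good families. Products of indices whose
    largest variables have exponents at least 2 involve only such indices. *)
Lemma harmonic_product d u v : is_index u -> is_index v ->
  exists2 E : seq (int * seq nat),
    all (fun c => is_index c.2 &&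
      ((1 < head 2 u)%N && (1 < head 2 v)%N ==> (1 < head 2 c.2)%N)) E &
    forall (K : comNzRingType) (w : nat -> K) N,
      nsum d 0 N (lpow w u) * nsum d 0 N (lpow w v) = evalc d w N E.
Proof.
have [n] := ubnP (size u + size v); elim: n u v => // n IH [|k u] [|l v] sz hu hv.
- by exists [:: (1, [::])] => // K w N; rewrite evalc_one mulr1.
- exists [:: (1, l :: v)]; first by rewrite all_seq1 hv; apply/implyP => /andP[].
  by move=> K w N; rewrite evalc_one nsum_nil mul1r.
- exists [:: (1, k :: u)]; first by rewrite all_seq1 hu; apply/implyP => /andP[].
  by move=> K w N; rewrite evalc_one nsum_nil mulr1.
have := hu; have := hv; rewrite !is_index_cons => /andP[l0 hv'] /andP[k0 hu'].
have [|E1 A1 H1] := IH u (l :: v) _ hu' hv; first by move: sz => /=; lia.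
have [|E2 A2 H2] := IH (k :: u) v _ hu hv'; first by move: sz => /=; lia.
have [|E3 A3 H3] := IH u v _ hu' hv'; first by move: sz => /=; lia.
exists ([seq (1 * c.1, k :: c.2) | c <- E1] ++ [seq (1 * c.1, l :: c.2) | c <- E2] ++
   [seq ((-1) ^+ (~~ d) * c.1, (k + l)%N :: c.2) | c <- E3]).
  rewrite !all_cat !all_map; apply/and3P; split.
  - apply: sub_all A1 => c /= /andP[hc _]; rewrite is_index_cons k0 hc /=.
    by apply/implyP => /andP[].
  - apply: sub_all A2 => c /= /andP[hc _]; rewrite is_index_cons l0 hc /=.
    by apply/implyP => /andP[].
  - apply: sub_all A3 => c /= /andP[hc _]; rewrite is_index_cons hc andbT addn_gt0 k0 /=.
    by apply/implyP => /andP[]; lia.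
move=> K w N; rewrite [lpow w (k :: u)]/= [lpow w (l :: v)]/= nsum_mul !big_split/=.
rewrite !evalc_cat !evalc_map_cons !mul1r addrA; congr (_ + _ + _).
- by apply: eq_bigr => j _; rewrite -H1.
- by apply: eq_bigr => j _; rewrite -H2.
rewrite mulr_sumr; apply: eq_bigr => j _; rewrite -H3 exprD.
by rewrite rmorphXn rmorphN rmorph1 !mulrA.
Qed.

(** The number of divergent variables at the top of a nested sum. *)
Definition lead (l : seq nat) : nat := find (fun x => x != 1%N) l.

Lemma lead_ones l : is_index l -> exists u,
  [/\ l = nseq (lead l) 1%N ++ u, is_index u & (1 < head 2 u)%N].
Proof.
elim: l => [|x l IH]; first by exists [::].
rewrite is_index_cons => /andP[x0 hl]; rewrite /lead /=.
case: (eqVneq x 1%N) => [->|x1] /=.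
  have [u [e hu u2]] := IH hl; exists u; split=> //.
  by rewrite {1}e.
by exists (x :: l); rewrite is_index_cons x0 hl /=; split=> //; lia.
Qed.

(** Multiplying by the depth-one sum inserts an entry 1 at every place or raises an entry
    by 1. Of the insertions, [n + 1] lengthen the leading run of ones; every other term
    has a leading run of at most [n]. Solved for the longest run, this is the recursion
    that regularizes. *)
Lemma ones_product n u : is_index u -> (1 < head 2 u)%N ->
  exists2 E : seq (int * seq nat),
    all (fun c => is_index c.2 && (lead c.2 <= n)%N) E &
    forall (K : comNzRingType) (w : nat -> K) N,
      nsum false 0 N (lpow w [:: 1%N]) * nsum false 0 N (lpow w (nseq n 1%N ++ u)) =
      n.+1%:R * nsum false 0 N (lpow w (nseq n.+1 1%N ++ u)) + evalc false w N E.
Proof.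
move=> hu u2; elim: n => [|n [E A H]].
  case: u hu u2 => [|k u] hu u2.
    by exists [::] => // K w N; rewrite /evalc big_nil addr0 mul1r mulr1.
  have := hu; rewrite is_index_cons => /andP[k0 hu'].
  have [E A H] := @harmonic_product false [:: 1%N] u isT hu'.
  exists ([seq (1 * c.1, k :: c.2) | c <- E] ++ [:: (-1, k.+1 :: u)]).
    rewrite all_cat all_map /= andbT; apply/andP; split.
      apply: sub_all A => c /= /andP[hc _]; rewrite is_index_cons k0 hc /lead /=.
      by move: u2 => /=; case: k {hu k0} => [|[|k]].
    rewrite is_index_cons hu' /lead /=; by move: u2 => /=; case: k {hu k0 H} => [|[|k]].
  move=> K w N; rewrite [nseq 0 _ ++ _]/= [nseq 1 _ ++ _]/=.
  rewrite [lpow w [:: 1%N]]/= [lpow w (k :: u)]/= nsum_mul !big_split/=.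
  rewrite evalc_cat evalc_map_cons evalc_neg !mul1r addrA; congr (_ + _ + _).
  - by apply: eq_bigr => j _; rewrite mul1r.
  - by apply: eq_bigr => j _; rewrite -H.
  rewrite [lpow w (k.+1 :: u)]/= nsum_cons -sumrN; apply: eq_bigr => j _.
  by rewrite nsum_nil [w j ^+ k.+1]exprS; ring.
exists ([seq (1 * c.1, 1%N :: c.2) | c <- E] ++ [:: (-1, 2%N :: (nseq n 1%N ++ u))]).
  rewrite all_cat all_map /= andbT; apply/andP; split.
    by apply: sub_all A => c /=.
  by rewrite is_index_cons {1}/is_index all_cat all_nseq orbT [all _ u]hu.
move=> K w N; rewrite [nseq n.+1 _ ++ _]/= [nseq n.+2 _ ++ _]/=.
set x := nseq n 1%N ++ u in H *.
rewrite [lpow w [:: 1%N]]/= [lpow w (1%N :: x)]/= nsum_mul !big_split/=.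
rewrite evalc_cat evalc_map_cons evalc_neg !mul1r -natr1 mulrDl mul1r.
have -> : \sum_(1 <= i < N.+1) w i ^+ 1 * (nsum false 0 (i - 0) [:: fun m => w m ^+ 1] *
      nsum false 0 (i - 0) (lpow w x)) =
    n.+1%:R * nsum false 0 N (lpow w [:: 1, 1 & x]%N) +
    \sum_(1 <= j < N.+1) w j ^+ 1 * evalc false w (j - 0) E.
  rewrite [lpow w (1%N :: 1%N :: x)]/= nsum_cons mulr_sumr -big_split/=.
  apply: eq_bigr => j _; have := H K w (j - 0)%N; rewrite [lpow w [:: 1%N]]/= => ->.
  by rewrite mulrDr mulrCA.
have -> : \sum_(1 <= i < N.+1) w i ^+ 1 * (1 * nsum false 0 (i - 0) [:: fun m => w m ^+ 1 & lpow w x]) =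
   nsum false 0 N (lpow w [:: 1, 1 & x]%N).
  by apply: eq_bigr => j _; rewrite mul1r.
have -> : \sum_(1 <= i < N.+1) (-1) ^+ 1 * (w i ^+ 1 * w i ^+ 1) * (1 * nsum false 0 (i - 0) (lpow w x)) =
   - nsum false 0 N (lpow w (2%N :: x)).
  rewrite [lpow w (2%N :: x)]/= nsum_cons -sumrN; apply: eq_bigr => j _.
  by rewrite expr2 !expr1; ring.
ring.
Qed.

(** A weak inequality is a strict one or an equality, and equal variables merge their
    exponents. *)
Lemma strict_expansion l : is_index l ->
  exists2 E : seq (int * seq nat),
    all (fun c => is_index c.2 && ((1 < head 2 l)%N ==> (1 < head 2 c.2)%N)) E &
    forall (K : comNzRingType) (w : nat -> K) N,
      nsum false 0 N (lpow w l) = evalc true w N E.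
Proof.
elim: l => [_|k l IH].
  by exists [:: (1, [::])] => // K w N; rewrite evalc_one.
rewrite is_index_cons => /andP[k0 /IH[E A H]] {IH}.
(* the term in which the new variable equals the next one *)
pose merge (c : int * seq nat) := if c.2 is x :: c' then [:: (c.1, (k + x)%N :: c')] else [::].
exists ([seq (1 * c.1, k :: c.2) | c <- E] ++ flatten [seq merge c | c <- E]).
  rewrite all_cat all_map; apply/andP; split.
    apply: sub_all A => c /= /andP[hc _]; rewrite is_index_cons k0 hc /=.
    exact: implybb.
  elim: E A {H} => // -[s [|x c]] E IHE /andP[/andP[hc _] /IHE] //= ->.
  rewrite andbT is_index_cons addn_gt0 k0 /=.
  move: hc; rewrite is_index_cons => /andP[x0 ->].
  by apply/implyP => _; move: k0 x0; lia.
move=> K w N; rewrite evalc_cat evalc_map_cons mul1r [lpow w (k :: l)]/= nsum_cons.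
under eq_bigr => n _ do rewrite H.
have merge_eval n : (0 < n)%N -> w n ^+ k * evalc true w n E =
    w n ^+ k * evalc true w (n - 1) E +
    \sum_(c <- flatten [seq merge c | c <- E])
       c.1%:~R * (w n ^+ (head 0 c.2)%N * nsum true 0 (n - 1) (lpow w (behead c.2))).
  move=> n0; elim: (E) => [|c E' IHE].
    by rewrite /evalc !big_nil mulr0 addr0.
  have := IHE; rewrite /evalc !big_cons [flatten _]/= big_cat/= mulrDr => ->.
  rewrite mulrDr -!addrA; set a := (w n ^+ k * \sum_(c <- E') _).
  set b := (\sum_(c <- flatten _) _).
  case: c => s [|x c] /=; first by rewrite big_nil add0r.
  rewrite big_seq1 /=.
  have -> : nsum true 0 n (lpow w (x :: c)) =
     nsum true 0 (n - 1) (lpow w (x :: c)) + w n ^+ x * nsum true 0 (n - 1) (lpow w c).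
    by case: n n0 {a b IHE} => // n _; rewrite subn1 [lpow _ _]/= nsumS// subn1.
  by rewrite exprD; ring.
rewrite big_nat; under eq_bigr => n /andP[n0 _] do rewrite [(n - _)%N]subn0 merge_eval//.
rewrite -big_nat big_split/=; congr (_ + _).
rewrite exchange_big/= /evalc; elim: (E) => [|[s [|x c]] E' IHE] //=.
  by rewrite !big_nil.
by rewrite !big_cons IHE mulr_sumr.
Qed.

(** * The span of multiple zeta values *)

Section Span.
Variable R : realType.
Local Notation C := R[i].

Lemma asym_cst (z z' : C) : asym (fun=> z) (fun=> z') -> z = z'.
Proof.
move=> /negl_small H; apply/eqP; rewrite -subr_eq0; apply/eqP; exact: small_cst.
Qed.

Lemma nsum_lim_nil d : nsum_lim R d [::] = 1.
Proof. by rewrite /nsum_lim lim_cst. Qed.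

Lemma admissible_rev k : admissible k = adm_top (rev k).
Proof.
rewrite /admissible /adm_top is_index_rev; congr (_ && (1 < _)%N).
by case/lastP: k => // s x; rewrite last_rcons rev_rcons.
Qed.

Lemma zetaE k : zeta R k = nsum_lim R true (rev k).
Proof. by rewrite /zeta /nsum_lim; congr (limn _); apply: funext => N; rewrite mhsE. Qed.

Lemma zeta_starE k : admissible k -> zeta_star R k = nsum_lim R false (rev k).
Proof.
move=> ak; rewrite /zeta_star ak /nsum_lim; congr (limn _); apply: funext => N; rewrite mhs_starE //.
Qed.

Lemma evalc_asym d E : all (fun c : int * seq nat => adm_top c.2) E ->
  asym (fun N => evalc d (invn C) N E)
       (fun=> \sum_(c <- E) c.1%:~R * (nsum_lim R d c.2)%:C%C).
Proof.
elim: E => [|c E IH] /=.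
  by move=> _; apply: (eq_asym _ _ (asym_refl (fun=> 0))) => N _; rewrite ?/evalc big_nil.
case/andP=> ac /IH H.
have H1 := asymM (asym_refl (fun=> c.1%:~R)) (nsum_lim_asym R d ac) (tame_cst _) (tame_cst _).
by apply: (eq_asym _ _ (asymD H1 H)) => N _; rewrite ?/evalc big_cons.
Qed.

Lemma nsum_lim_evalc d E : \sum_(c <- E) (c.1%:~R : C) * (nsum_lim R d c.2)%:C%C =
  (\sum_(c <- E) c.1%:~R * nsum_lim R d c.2)%:C%C.
Proof. by rewrite rmorph_sum; apply: eq_bigr => c _; rewrite rmorphM rmorph_int. Qed.

Lemma spanD x y : @mzv_span R x -> @mzv_span R y -> @mzv_span R (x + y).
Proof.
move=> [s hs ->] [t ht ->]; exists (s ++ t); first by rewrite all_cat hs.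
by rewrite big_cat.
Qed.

Lemma span0 : @mzv_span R 0.
Proof. by exists [::]; rewrite ?big_nil. Qed.

Lemma spanZ (a : rat) x : @mzv_span R x -> @mzv_span R (ratr a * x).
Proof.
move=> [s hs ->]; exists [seq (a * c.1, c.2) | c <- s]; first by rewrite all_map.
by rewrite big_map mulr_sumr; apply: eq_bigr => c _; rewrite rmorphM mulrA.
Qed.

Lemma spanZint (a : int) x : @mzv_span R x -> @mzv_span R (a%:~R * x).
Proof. by move=> /(spanZ a%:~R); rewrite ratr_int. Qed.

Lemma spanN x : @mzv_span R x -> @mzv_span R (- x).
Proof. by move=> /(spanZint (-1)); rewrite rmorphN rmorph1 mulN1r. Qed.

Lemma span_sum (I : Type) (s : seq I) (P : pred I) (F : I -> R) :
  (forall i, P i -> @mzv_span R (F i)) -> @mzv_span R (\sum_(i <- s | P i) F i).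
Proof. by move=> H; elim/big_rec: _ => [|i x /H]; [exact: span0|exact: spanD]. Qed.

Lemma span_sum_mem (I : eqType) (s : seq I) (F : I -> R) :
  (forall i, i \in s -> @mzv_span R (F i)) -> @mzv_span R (\sum_(i <- s) F i).
Proof. by move=> H; rewrite big_seq; apply: span_sum. Qed.

Lemma span_nsum_lim_strict l : adm_top l -> @mzv_span R (nsum_lim R true l).
Proof.
move=> al; exists [:: (1, rev l)]; first by rewrite /= admissible_rev revK al.
by rewrite big_seq1 rmorph1 mul1r zetaE revK.
Qed.

Lemma span1 : @mzv_span R 1.
Proof. by rewrite -(nsum_lim_nil true); apply: span_nsum_lim_strict. Qed.

(** The identity [strict_expansion] holds for every truncation, hence in the limit. *)
Lemma span_nsum_lim_star l : adm_top l -> @mzv_span R (nsum_lim R false l).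
Proof.
move=> al; have /andP[hl l2] := al.
have [E A H] := strict_expansion hl.
have AE : all (fun c : int * seq nat => adm_top c.2) E.
  by apply: sub_all A => c; rewrite l2 /= /adm_top.
have e2 := eq_asym (fun N _ => esym (H _ (invn C) N)) (fun _ _ => erefl) (evalc_asym true AE).
have := asym_trans (asym_sym (nsum_lim_asym R false al)) e2.
move=> /asym_cst; rewrite nsum_lim_evalc => /complexI ->.
by apply: span_sum_mem => c /(allP AE) ac; apply: spanZint; exact: span_nsum_lim_strict.
Qed.

(** The harmonic product of admissible indices involves admissible indices only, so it
    passes to the limit. *)
Lemma spanM x y : @mzv_span R x -> @mzv_span R y -> @mzv_span R (x * y).
Proof.
move=> [s hs ->] [t ht ->]; rewrite mulr_suml; apply: span_sum_mem => c /(allP hs) ac.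
rewrite mulr_sumr; apply: span_sum_mem => e /(allP ht) ae.
rewrite mulrACA -rmorphM; apply: spanZ; rewrite !zetaE.
move: ac ae; rewrite !admissible_rev; set u := rev c.2; set v := rev e.2 => au av.
have /andP[hu u2] := au; have /andP[hv v2] := av.
have [E A H] := harmonic_product true hu hv.
have AE : all (fun c : int * seq nat => adm_top c.2) E.
  by apply: sub_all A => z; rewrite u2 v2 /= /adm_top.
have e1 := asymM (nsum_lim_asym R true au) (nsum_lim_asym R true av) (tame_cst _) (tame_cst _).
have e2 := eq_asym (fun N _ => esym (H _ (invn C) N)) (fun _ _ => erefl) (evalc_asym true AE).
have := asym_trans (asym_sym e1) e2.
move=> /asym_cst; rewrite nsum_lim_evalc -rmorphM => /complexI ->.
by apply: span_sum_mem => z /(allP AE) az; apply: spanZint; exact: span_nsum_lim_strict.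
Qed.

(** * Regularization polynomials *)

Definition span_poly (P : {poly R}) := forall i, @mzv_span R P`_i.

Definition cpoly (P : {poly R}) : {poly C} := map_poly (real_complex R) P.

(** The depth-one, weight-one sum, the only source of divergence. *)
Definition starT (w : nat -> nat -> C) (N : nat) : C := nsum false 0 N (lpow (w N) [:: 1%N]).

(** One polynomial [P] has to serve all good families of weights at once. *)
Definition reg_spec (l : seq nat) (P : {poly R}) := span_poly P /\
  forall w : nat -> nat -> C, good w ->
    asym (fun N => nsum false 0 N (lpow (w N) l)) (fun N => (cpoly P).[starT w N]).

Lemma reg_spec_evalc n E :
  (forall l, is_index l -> (lead l <= n)%N -> exists P, reg_spec l P) ->
  all (fun c : int * seq nat => is_index c.2 && (lead c.2 <= n)%N) E ->
  exists2 P, span_poly P & forall w : nat -> nat -> C, good w ->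
    asym (fun N => evalc false (w N) N E) (fun N => (cpoly P).[starT w N]).
Proof.
move=> H; elim: E => [|c E IH] /=.
  exists 0 => [i|w gw]; first by rewrite coef0; exact: span0.
  apply: (eq_asym _ _ (asym_refl (fun=> 0))) => N _; rewrite /evalc ?big_nil//.
  by rewrite /cpoly rmorph0 horner0.
case/andP=> /andP[hc lc] /IH[P SP HP]; have [Q [SQ HQ]] := H _ hc lc.
exists (c.1%:~R *: Q + P) => [i|w gw].
  by rewrite coefD coefZ; apply: spanD => //; apply: spanZint.
have H1 := asymM (asym_refl (fun=> c.1%:~R)) (HQ w gw) (tame_cst _)
  (tame_horner _ (good_tame gw)).
apply: (eq_asym _ _ (asymD H1 (HP w gw))) => N _; first by rewrite /evalc big_cons.
by rewrite /cpoly rmorphD /= map_polyZ hornerD hornerZ rmorph_int.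
Qed.

(** Induction on the number of leading ones. Without any the sums converge, to a value
    that is common to all good families. Otherwise [ones_product] expresses the sum
    through the depth-one sum and sums with fewer leading ones, uniformly in the
    weights. *)
Theorem regularization l : is_index l -> exists P, reg_spec l P.
Proof.
have [n] := ubnP (lead l); elim: n l => // n IH l; rewrite ltnS => ln hl.
have [u [e hu u2]] := lead_ones hl.
case: (posnP (lead l)) => [l0|l0].
  have al : adm_top l by rewrite e l0 /adm_top hu.
  exists (nsum_lim R false l)%:P; split=> [i|w gw].
    by rewrite coefC; case: eqP => _; [exact: span_nsum_lim_star|exact: span0].
  apply: (eq_asym _ _ (good_adm gw al)) => N _ //.
  by rewrite /cpoly map_polyC hornerC.
pose j := (lead l).-1; have jl : lead l = j.+1 by rewrite prednK.
have [E A H] := ones_product j hu u2.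
have IHj v : is_index v -> (lead v <= j)%N -> exists P, reg_spec v P.
  by move=> hv lv; apply: IH => //; lia.
have hone : is_index (nseq j 1%N ++ u) by rewrite /is_index all_cat all_nseq orbT.
have lone : (lead (nseq j 1%N ++ u) <= j)%N.
  rewrite /lead find_cat (_ : has _ _ = false) ?has_nseq ?andbF//.
  rewrite size_nseq; case: (u) u2 => [|y v] /=; first by rewrite addn0.
  by case: (eqVneq y 1%N) => [->//|]; rewrite addn0.
have [P0 [S0 H0]] := IHj _ hone lone.
have [PE SE HE] := reg_spec_evalc IHj A.
exists ((ratr (j.+1%:R^-1)) *: ('X * P0 - PE)); split=> [i|w gw].
  rewrite coefZ; apply: spanZ; rewrite coefB coefXM; apply: spanD; last exact: spanN.
  by case: eqP => _; [exact: span0|].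
have tT := good_tame gw.
have A1 := asymM (asym_refl (starT w)) (H0 w gw) tT (tame_horner _ tT).
have A2 := asymD A1 (asymN (HE w gw)).
have tR : tame (fun N => starT w N * (cpoly P0).[starT w N] - (cpoly PE).[starT w N]).
  apply: tameD; first exact: tameM tT (tame_horner _ tT).
  apply: (eq_tame _ (tameM (tame_cst (-1)) (tame_horner (cpoly PE) tT))) => N _.
  by rewrite mulN1r.
have A3 := asymM (asym_refl (fun=> j.+1%:R^-1)) A2 (tame_cst _) tR.
apply: (eq_asym _ _ A3) => N _.
  have := H C (w N) N; rewrite -/(starT w N) => ->; rewrite addrK e jl mulrA mulVf ?mul1r//.
  by rewrite pnatr_eq0.
have -> : cpoly (ratr j.+1%:R^-1 *: ('X * P0 - PE)) =
    j.+1%:R^-1 *: ('X * cpoly P0 - cpoly PE).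
  have -> : ratr j.+1%:R^-1 = j.+1%:R^-1 :> R by rewrite fmorphV rmorph_nat.
  rewrite /cpoly map_polyZ rmorphB /= fmorphV rmorph_nat; congr (_ *: (_ - _)).
  by rewrite rmorphM /= map_polyX.
by rewrite hornerZ hornerD hornerN hornerM hornerX.
Qed.

End Span.

(** * Regularized values *)

Section Gamma.
Local Open Scope classical_set_scope.
Variable R : realType.
Local Notation h := (harm R).
Local Notation gamma := (euler_gamma R).

Lemma series_harmonic n : series (@harmonic R) n = h n.
Proof.
rewrite /series /harm /= big_add1 /=; apply: eq_bigr => i _ //.
Qed.

Lemma lnS_bounds n : (0 < n)%N ->
  (n.+1%:R^-1 : R) <= ln (n.+1%:R : R) - ln (n%:R : R) <= n%:R^-1.
Proof.
move=> n0; have np : 0 < (n%:R : R) by rewrite ltr0n.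
have Sp : 0 < (n.+1%:R : R) by rewrite ltr0n.
have S1 : (n.+1%:R : R) = n%:R + 1 by rewrite natr1.
apply/andP; split; last first.
  rewrite -ln_div ?posrE// (_ : n.+1%:R / n%:R = 1 + n%:R^-1 :> R).
    by apply: le_ln1Dx; apply: lt_trans (_ : 0 < _); rewrite ?invr_gt0// ltrN10.
  by rewrite S1; field; rewrite gt_eqF.
have e : ln (n%:R : R) = ln n.+1%:R + ln (n%:R / n.+1%:R).
  by rewrite ln_div ?posrE//; ring.
have : ln (n%:R / n.+1%:R : R) <= - n.+1%:R^-1.
  rewrite (_ : n%:R / n.+1%:R = 1 + - n.+1%:R^-1 :> R).
    by apply: le_ln1Dx; rewrite ltrN2 invf_lt1// ltr1n; lia.
  by rewrite S1; field; rewrite -S1 gt_eqF.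
by rewrite e opprD addrA subrr sub0r lerNr.
Qed.

Definition hln (n : nat) : R := h n - ln n%:R.

Lemma hln_step n : (0 < n)%N -> 0 <= hln n - hln n.+1 <= n%:R^-1 - n.+1%:R^-1.
Proof.
move=> n0; have := lnS_bounds n0; rewrite /hln harmS.
move: (ln (n.+1%:R : R)) (n.+1%:R^-1 : R) (ln (n%:R : R)) (n%:R^-1 : R) => u v w z /andP[a b].
by apply/andP; split; lra.
Qed.

Lemma hln_dist n m : (0 < n <= m)%N -> 0 <= hln n - hln m <= n%:R^-1 - m%:R^-1.
Proof.
move=> /andP[n0]; elim: m => [|m IH]; first by lia.
rewrite leq_eqVlt => /orP[/eqP->|]; first by rewrite !subrr lexx.
rewrite ltnS => nm; have m0 : (0 < m)%N by lia.
have := IH nm; have := hln_step m0; move: (n%:R^-1 : R) (m%:R^-1 : R) (m.+1%:R^-1 : R).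
move=> u v w /andP[a b] /andP[c d].
by apply/andP; split; lra.
Qed.

Lemma ln_nat_ge0 n : 0 <= ln (n%:R : R).
Proof. by case: n => [|n]; [rewrite ln0|rewrite ln_ge0// ler1n]. Qed.

Lemma gamma_cvg : (fun n => series harmonic n - ln (n%:R : R)) @ \oo --> gamma.
Proof.
have e : (fun n => series harmonic n - ln (n%:R : R)) = hln.
  by apply: funext => n; rewrite series_harmonic.
rewrite /euler_gamma e; apply: (@near_nonincreasing_is_cvgn _ _ (hln 1 - 1)).
  exists 1%N => // n /= n1 m nm; have : (0 < n <= m)%N by rewrite n1.
  by move/hln_dist => /andP[]; rewrite subr_ge0.
exists 1%N => // n /= n1; have /hln_dist/andP[_] : (0 < 1 <= n)%N by [].
have : 0 <= (n%:R^-1 : R) by rewrite invr_ge0.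
by rewrite invr1; move: (n%:R^-1 : R) => u a b; lra.
Qed.

(** [h_n - log n] decreases to Euler's constant, by steps of at most
    [1/n - 1/(n+1)]. *)
Lemma gamma_rate n : (0 < n)%N -> 0 <= hln n - gamma <= n%:R^-1.
Proof.
move=> n0; have cv := gamma_cvg.
have e : (fun n => series harmonic n - ln (n%:R : R)) = hln.
  by apply: funext => j; rewrite series_harmonic.
have gE : gamma = limn hln by rewrite /euler_gamma e.
have cvh : cvgn hln by apply/cvg_ex; exists gamma; rewrite -e.
rewrite subr_ge0 lerBlDl -lerBlDr gE; apply/andP; split.
  apply: limr_le => //; exists n => // m /= nm.
  have /hln_dist/andP[+ _] : (0 < n <= m)%N by rewrite n0.
  by rewrite subr_ge0.
apply: limr_ge => //; exists n => // m /= nm.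
have /hln_dist/andP[_] : (0 < n <= m)%N by rewrite n0.
have : 0 <= (m%:R^-1 : R) by rewrite invr_ge0.
by move: (m%:R^-1 : R) => u a b; lra.
Qed.

Lemma harm_ln n : (0 < n)%N -> ln (n%:R : R) <= h n <= 1 + ln (n%:R : R).
Proof.
move=> n0; have /hln_dist : (0 < 1 <= n)%N by [].
rewrite /hln ln1 harm1 invr1 subr0 => /andP[a b].
have c : 0 <= (n%:R^-1 : R) by rewrite invr_ge0.
by apply/andP; split; lra.
Qed.

End Gamma.

Section RegularizedValue.
Local Open Scope classical_set_scope.
Variable R : realType.
Local Notation C := R[i].
Local Notation h := (harm R).
Local Notation gamma := (euler_gamma R).

Let t (N : nat) : C := (ln N%:R + gamma)%:C%C.

Lemma t_asym : asym (fun N => (h N)%:C%C) t.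
Proof.
exists 1, 0%N; split=> // N N0; rewrite -rmorphB cabs_real expr0 mul1r div1r.
have /andP[a b] := gamma_rate R N0.
by rewrite opprD addrA ger0_norm.
Qed.

Lemma h_tame : tame (fun N => (h N)%:C%C).
Proof.
by exists 1, 1%N; split=> // N N0; rewrite cabs_real ger0_norm ?harm_ge0// expr1 mul1r.
Qed.

Lemma t_tame : tame t.
Proof. exact: asym_tame (asym_sym t_asym) h_tame. Qed.

Lemma diverges_near (u v : nat -> C) (c : R) : (forall N, (0 < N)%N -> cabs (u N - v N) <= c) ->
  diverges v -> diverges u.
Proof.
move=> H dv A; have [N0 G] := dv (A + c); exists N0.+1 => N NN.
have N1 : (0 < N)%N by lia.
have := G N (ltnW NN); have := H N N1; rewrite -cabsN opprB => a b.
have := cabs_distl (v N) (u N); lra.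
Qed.

Lemma h_diverges : diverges (fun N => (h N)%:C%C).
Proof.
move=> A; have [N0 H] := harm_unbounded A; exists N0 => N NN.
by rewrite cabs_real ger0_norm ?harm_ge0// H.
Qed.

Lemma t_diverges : diverges t.
Proof.
apply: (@diverges_near _ (fun N => (h N)%:C%C) 1) h_diverges => N N0.
rewrite -cabsN opprB -rmorphB cabs_real opprD addrA.
have /andP[a b] := gamma_rate R N0; rewrite ger0_norm// (le_trans b)//.
by rewrite invf_le1 ?ltr0n// ler1n.
Qed.

Lemma cpolyE (P : {poly R}) x : (cpoly P).[x%:C%C] = (P.[x])%:C%C.
Proof. by rewrite /cpoly horner_map. Qed.

Lemma cpolyC (x : R) : cpoly x%:P = (x%:C%C)%:P.
Proof. by rewrite /cpoly map_polyC. Qed.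

Lemma starT_invn N : starT (fun=> invn C) N = (h N)%:C%C.
Proof.
rewrite /starT -nsum_real /= nsum_cons; congr (_%:C)%C.
by apply: eq_bigr => n _; rewrite mulr1.
Qed.

Lemma cpoly_inj : injective (@cpoly R).
Proof. by move=> P Q /polyP H; apply/polyP => i; have := H i; rewrite !coef_map => /complexI. Qed.

Lemma reg_asym k (P : {poly R}) : reg_spec (rev k) P ->
  asym (fun N => (mhs_star R N k)%:C%C) (fun N => (P.[ln N%:R + gamma])%:C%C).
Proof.
move=> [_ /(_ _ (good_invn R)) H].
have H1 := asym_trans H (eq_asym (fun N _ => congr1 _ (esym (starT_invn N))) (fun _ _ => erefl)
   (asym_horner (cpoly P) t_asym t_tame)).
apply: (eq_asym _ _ H1) => N _; last by rewrite -cpolyE.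
by rewrite -nsum_real mhs_starE.
Qed.

Lemma is_reg_poly_spec k (P : {poly R}) : reg_spec (rev k) P -> is_reg_poly k P.
Proof.
move=> /reg_asym[c [J [c0 H]]]; exists J; apply/eqO_exP.
exists (c * 2 ^+ J + 1); first by rewrite ltr_wpDl// mulr_ge0// exprn_ge0.
have [N0 G] := harm_unbounded (2 : R).
exists N0.+1 => // N /= NN; have N1 : (0 < N)%N by lia.
have := H N N1; rewrite -rmorphB cabs_real => /le_trans; apply.
have /andP[a b] := harm_ln R N1; have g := G N (ltnW NN).
(* [ln N] is at least 1 here, so that [h N <= 1 + ln N <= 2 ln N] *)
have l1 : 1 <= ln (N%:R : R) by lra.
have l0 : 0 <= ln (N%:R : R) by lra.
have Ni : 0 <= (N%:R^-1 : R) by rewrite invr_ge0.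
rewrite ger0_norm; last by rewrite mulr_ge0// exprn_ge0.
have : h N ^+ J <= (2 * ln N%:R) ^+ J.
  by rewrite lerXn2r ?nnegrE ?harm_ge0 ?mulr_ge0//; lra.
rewrite exprMn => e; apply: (@le_trans _ _ (c * (2 ^+ J * ln N%:R ^+ J / N%:R))).
  by rewrite ler_wpM2l// ler_wpM2r.
have : 0 <= (N%:R^-1 : R) * ln N%:R ^+ J by rewrite mulr_ge0// exprn_ge0.
by set z := _ * _ ^+ J; move=> z0; rewrite (_ : c * _ = c * 2 ^+ J * z); [lra|rewrite /z; ring].
Qed.

(** Two regularization polynomials have a small difference along the divergent sequence
    [log N + gamma]. *)
Lemma is_reg_poly_uniq k (P Q : {poly R}) : reg_spec (rev k) P -> is_reg_poly k Q -> Q = P.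
Proof.
move=> SP [J /eqO_exP[c c0 [N1 _ H]]].
apply: cpoly_inj; apply/eqP; rewrite -subr_eq0; apply/eqP.
apply: (horner_small_eq0 t_diverges) => e e0.
have e2 : 0 < e / 2 by rewrite divr_gt0.
have [N2 H2] := negl_small (reg_asym SP) e2.
have ec : 0 < e / 2 / c by rewrite divr_gt0.
have [N3 H3] := harm_ratio_small J ec.
exists (maxn N1 (maxn N2 N3)).+1 => N NN.
have N0 : (0 < N)%N by lia.
have h1 : `|mhs_star R N k - Q.[ln N%:R + gamma]| <= c * `|N%:R^-1 * ln N%:R ^+ J|.
  by apply: H => /=; lia.
have h2 : `|mhs_star R N k - P.[ln N%:R + gamma]| <= e / 2.
  by rewrite -cabs_real rmorphB; apply: H2; lia.
have h3 : h N ^+ J / N%:R <= e / 2 / c by apply: H3; lia.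
have /andP[a _] := harm_ln R N0; have l0 := ln_nat_ge0 R N.
have h4 : c * `|N%:R^-1 * ln N%:R ^+ J| <= e / 2.
  rewrite -(divfK (lt0r_neq0 c0) (e / 2)) mulrC ler_wpM2r ?(ltW c0)//.
  apply: le_trans h3; rewrite ger0_norm ?mulr_ge0 ?invr_ge0 ?exprn_ge0// mulrC.
  by rewrite ler_wpM2r ?invr_ge0// lerXn2r ?nnegrE ?harm_ge0.
rewrite /t hornerD hornerN !cpolyE -rmorphB cabs_real.
have -> : Q.[ln N%:R + gamma] - P.[ln N%:R + gamma] =
  (mhs_star R N k - P.[ln N%:R + gamma]) - (mhs_star R N k - Q.[ln N%:R + gamma]) by ring.
by rewrite (le_trans (ler_normB _ _))//; lra.
Qed.

(** For the weights [1/n] the depth-one sum is [log N + gamma] up to a negligible error,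
    so [P] is the harmonic regularization polynomial; in the convergent case it has to be
    constant, equal to the limit. *)
Theorem zeta_star_spec k (P : {poly R}) : reg_spec (rev k) P -> zeta_star R k = P.[0].
Proof.
move=> SP; case ak : (admissible k); last first.
  rewrite /zeta_star ak /zeta_star_reg; congr (_.[0]).
  apply: (is_reg_poly_uniq SP); apply: xgetPex; exists P; exact: is_reg_poly_spec.
rewrite zeta_starE//; have ar : adm_top (rev k) by rewrite -admissible_rev.
suff -> : P = (nsum_lim R false (rev k))%:P by rewrite hornerC.
apply: cpoly_inj; apply/eqP; rewrite -subr_eq0; apply/eqP.
apply: (horner_small_eq0 h_diverges); apply: negl_small.
have [_ /(_ _ (good_invn R)) H] := SP.
apply: (eq_negl _ (asym_trans (asym_sym H) (nsum_lim_asym R false ar))) => N _.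
by rewrite starT_invn hornerD hornerN cpolyC hornerC.
Qed.

End RegularizedValue.

(** * Roots of unity near 1 *)

Section Trigonometry.
Local Open Scope classical_set_scope.
Variable R : realType.
Implicit Types x : R.

Lemma sin_MVT x : 0 < x -> exists2 c, 0 < c < x & sin x = cos c * x.
Proof.
move=> x0; have [|c] := @MVT R sin cos 0 x x0 (fun y _ => is_derive_sin y).
  by apply: continuous_subspaceT => y; exact: continuous_sin.
by rewrite in_itv /= => cx; rewrite sin0 !subr0 => e; exists c.
Qed.

Lemma cos_MVT x : 0 < x -> exists2 c, 0 < c < x & 1 - cos x = sin c * x.
Proof.
move=> x0; have [|c] := @MVT R cos (fun y => - sin y) 0 x x0 (fun y _ => is_derive_cos y).
  by apply: continuous_subspaceT => y; exact: continuous_cos.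
rewrite in_itv /= => cx; rewrite cos0 subr0 => e; exists c => //.
by rewrite -opprB e mulNr opprK.
Qed.

Lemma sin_le_id x : 0 <= x -> sin x <= x.
Proof.
rewrite le_eqVlt => /orP[/eqP<-|x0]; first by rewrite sin0.
have [c _ ->] := sin_MVT x0; rewrite -[leRHS]mul1r ler_wpM2r ?(ltW x0) ?cos_le1//.
Qed.

Lemma cos_ge_lin x : 0 <= x -> 1 - x <= cos x.
Proof.
rewrite le_eqVlt => /orP[/eqP<-|x0]; first by rewrite cos0 subr0.
have [c _ e] := cos_MVT x0; rewrite lerBlDr -lerBlDl e -[leRHS]mul1r ler_wpM2r ?(ltW x0) ?sin_le1//.
Qed.

Lemma sin_ge_quad x : 0 <= x -> x - x ^+ 2 <= sin x.
Proof.
rewrite le_eqVlt => /orP[/eqP<-|x0]; first by rewrite sin0 expr0n subr0.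
have [c /andP[c0 cx] ->] := sin_MVT x0.
have -> : x - x ^+ 2 = (1 - x) * x by ring.
by rewrite ler_wpM2r ?(ltW x0)// (le_trans _ (cos_ge_lin (ltW c0)))// lerB// ltW.
Qed.

(** With [y = x / 2], [sin x = 2 sin y cos y = x cos c cos y] for some [c] in [(0, y)],
    and both cosines are at least [cos (pi / 4)], whose square is [1/2]. *)
Lemma sin_ge_half x : 0 <= x <= pi / 2 -> x / 2 <= sin x.
Proof.
move=> /andP[x0 xp]; have pi0 : 0 < pi :> R := pi_gt0 R.
have [/eqP->|xn0] := boolP (x == 0); first by rewrite mul0r sin0.
have {x0}x0 : 0 < x by rewrite lt_def xn0.
(* the half angle lies where cosines are at least [cos (pi / 4)] *)
pose y := x / 2; have y0 : 0 < y by rewrite divr_gt0.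
have yp : y <= pi / 4 by rewrite /y; lra.
have xE : x = y *+ 2 by rewrite /y -mulr_natr; field.
have [c /andP[c0 cy] sy] := sin_MVT y0.
have c2 : cos (pi / 4) ^+ 2 = 2^-1 :> R.
  have := cos_mulr2n (pi / 4 : R).
  have -> : (pi / 4) *+ 2 = pi / 2 :> R by rewrite -mulr_natr; field.
  rewrite cos_pihalf -mulr_natr => e; lra.
have c4 : 0 <= cos (pi / 4) :> R by rewrite ltW// cos_gt0_pihalf//; apply/andP; split; lra.
have mono u : 0 <= u -> u <= pi / 4 -> cos (pi / 4) <= cos u.
  move=> u0 up; rewrite leNgt ltr_cos ?in_itv /= -?leNgt//; apply/andP; split; lra.
have h1 : cos (pi / 4) <= cos c by apply: mono; lra.
have h2 : cos (pi / 4) <= cos y by apply: mono; lra.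
rewrite [in leRHS]xE sin_mulr2n sy -mulr_natr.
have h3 : cos (pi / 4) ^+ 2 <= cos y * cos c by rewrite expr2 ler_pM.
have : y * 2^-1 <= y * (cos y * cos c) by rewrite -c2 ler_pM2l.
by rewrite /y in y0 *; lra.
Qed.

End Trigonometry.

(** ** The q-integers at a root of unity *)

Section RootFamily.
Variable R : realType.
Local Notation C := R[i].

Definition expi (t : R) : C := (cos t +i* sin t)%C.

Lemma expiD t u : expi (t + u) = expi t * expi u.
Proof. by rewrite /expi cosD sinD; simpc; congr (_ +i* _)%C; ring. Qed.

Lemma expi0 : expi 0 = 1.
Proof. by rewrite /expi cos0 sin0. Qed.

Lemma expiX t n : expi t ^+ n = expi (n%:R * t).
Proof.
elim: n => [|n IH]; first by rewrite mul0r expi0.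
by rewrite exprS IH -expiD -natr1; congr expi; ring.
Qed.

Lemma cabs_expi t : cabs (expi t) = 1.
Proof. by rewrite /cabs /ComplexField.Normc.normc /= cos2Dsin2 sqrtr1. Qed.

Lemma expi_neq0 t : expi t != 0.
Proof. by apply/negP => /eqP e; have := cabs_expi t; rewrite e cabs0 => /eqP; rewrite eq_sym oner_eq0. Qed.

Definition theta (N : nat) : R := pi / (N.*2.+1)%:R.
(** The primitive root of unity [exp (2 pi i / (2N+1))], as a square because
    [[m]_q] has a simple expression in terms of the half angle ([qn_sin]). *)
Definition rootq (N : nat) : C := expi (theta N) ^+ 2.

(** [[m]_q = exp (i (m-1) t) sin (m t) / sin t] for [q = exp (2 i t)]. *)
Lemma qn_sin t m : expi t * qn (expi t ^+ 2) m * (sin t)%:C%C =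
  expi t ^+ m * (sin (m%:R * t))%:C%C.
Proof.
elim: m => [|m IH]; first by rewrite qn0 mul0r sin0 !mulr0 mul0r.
have -> : expi t * qn (expi t ^+ 2) m.+1 * (sin t)%:C%C =
   expi t * ((sin t)%:C%C + expi t * (expi t * qn (expi t ^+ 2) m * (sin t)%:C%C)).
  by rewrite qnS; ring.
rewrite IH exprS -[RHS]mulrA; congr (_ * _).
rewrite !expiX; set u := m%:R * t.
have -> : m.+1%:R * t = u + t by rewrite -natr1 mulrDl mul1r.
have e1 : sin t = sin (u + t) * cos u - cos (u + t) * sin u.
  by rewrite -sinB; congr sin; ring.
rewrite mulrA -expiD [t + u]addrC /expi; simpc; congr (_ +i* _)%C.
  by rewrite {1}e1; ring.
by ring.
Qed.

Variable N : nat.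
Hypothesis N0 : (0 < N)%N.
Local Notation th := (theta N).
Local Notation q := (rootq N).

Lemma theta_gt0 : 0 < th.
Proof. by rewrite divr_gt0// pi_gt0. Qed.

Lemma theta_mul : (N.*2.+1)%:R * th = pi.
Proof. by rewrite /theta mulrCA divff ?mulr1// pnatr_eq0. Qed.

Lemma sin_mtheta_gt0 m : (0 < m <= N.*2)%N -> 0 < sin (m%:R * th).
Proof.
move=> /andP[m0 mN]; apply: sin_gt0_pi; rewrite mulr_gt0 ?ltr0n ?theta_gt0//=.
by rewrite -theta_mul ltr_pM2r ?theta_gt0// ltr_nat ltnS.
Qed.

Lemma sin_theta_gt0 : 0 < sin th.
Proof. by have := @sin_mtheta_gt0 1; rewrite mul1r; apply; lia. Qed.

Lemma qn_root_eq0 : qn q (N.*2).+1 = 0.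
Proof.
have := qn_sin th (N.*2).+1; rewrite theta_mul sinpi mulr0 => /eqP.
rewrite !mulf_eq0 (negbTE (expi_neq0 _)) /= => /orP[/eqP//|/eqP/complexI e].
by have := sin_theta_gt0; rewrite e ltxx.
Qed.

Lemma cabs_qn m : (m <= N.*2)%N -> cabs (qn q m) = sin (m%:R * th) / sin th.
Proof.
move=> mN; have sp := sin_theta_gt0; have := congr1 (@cabs R) (qn_sin th m).
rewrite !cabsM cabsX cabs_expi expr1n !mul1r !cabs_real (ger0_norm (ltW sp)).
rewrite ger0_norm => [<-|]; first by rewrite mulfK// gt_eqF.
case: m mN => [|m] mN; first by rewrite mul0r sin0.
by rewrite ltW// sin_mtheta_gt0.
Qed.

Lemma qn_root_neq0 m : (0 < m <= N.*2)%N -> qn q m != 0.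
Proof.
move=> mN; have /andP[_ m2] := mN; apply/negP => /eqP e; have := cabs_qn m2.
rewrite e cabs0 => /esym/eqP; apply/negP; rewrite gt_eqF// divr_gt0 ?sin_theta_gt0//.
exact: sin_mtheta_gt0.
Qed.

Lemma cabs_1q_le : cabs (1 - q) <= 4 / N%:R.
Proof.
have e : 1 - q = (0 +i* (- (2 * sin th)))%C * expi th.
  rewrite /rootq expr2 /expi; simpc; congr (_ +i* _)%C; last by ring.
  by have := cos2Dsin2 th; rewrite !expr2 => h; lra.
rewrite e cabsM cabs_expi mulr1 /cabs /ComplexField.Normc.normc /= expr0n add0r sqrtr_sqr.
rewrite normrN ger0_norm; last by rewrite mulr_ge0// ltW// sin_theta_gt0.
apply: (@le_trans _ _ (2 * th)).
  by rewrite ler_pM2l// sin_le_id// ltW// theta_gt0.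
have pi4 : pi <= 4 :> R by have := pihalf_lt2 R; lra.
have Np : 0 < (N%:R : R) by rewrite ltr0n.
rewrite ler_pdivlMr// /theta.
have M0 : 0 < (N.*2.+1%:R : R) by rewrite ltr0n.
have -> : 2 * (pi / N.*2.+1%:R) * N%:R = pi * (N.*2%:R / N.*2.+1%:R) :> R.
  by rewrite -mul2n natrM; ring.
apply: le_trans pi4; rewrite ler_piMr ?pi_ge0// ler_pdivrMr// mul1r ler_nat //.
Qed.

Lemma cabs_q : cabs q = 1.
Proof. by rewrite /rootq cabsX cabs_expi expr1n. Qed.

Lemma cabs_qn_le m : cabs (qn q m) <= m%:R.
Proof.
rewrite /qn (le_trans (cabs_sum _ _ _))// (eq_bigr (fun=> 1)).
  by rewrite sumr_const card_ord.
by move=> i _; rewrite cabsX cabs_q expr1n.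
Qed.

Lemma cabs_qn_ge m : (m <= N)%N -> m%:R / 2 <= cabs (qn q m).
Proof.
move=> mN; rewrite cabs_qn; last by rewrite -addnn (leq_trans mN)// leq_addr.
have t0 := theta_gt0; have s0 := sin_theta_gt0.
rewrite ler_pdivlMr//; apply: (@le_trans _ _ (m%:R * th / 2)).
  have h : sin th <= th by rewrite sin_le_id// ltW.
  by have := ler_wpM2l (ler0n R m) h; lra.
apply: sin_ge_half; apply/andP; split; first by rewrite mulr_ge0// ltW.
have : m%:R * th <= N%:R * th by rewrite ler_pM2r// ler_nat.
move/le_trans; apply; rewrite ler_pdivlMr// -theta_mul mulrAC -natrM ler_pM2r// ler_nat; lia.
Qed.

Lemma cabs_qb_le m : (0 < m <= N)%N -> cabs (qb q m) <= 2 / m%:R.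
Proof.
move=> /andP[m0 mN]; rewrite /qb cabsV -[leRHS]invrK lef_pV2 ?posrE.
- by rewrite invf_div cabs_qn_ge.
- by apply: lt_le_trans (cabs_qn_ge mN); rewrite divr_gt0// ltr0n.
by rewrite invr_gt0 divr_gt0// ltr0n.
Qed.

(** [m - [m]_q = (1 - q) ([0]_q + ... + [m-1]_q)] is [O(m^2 / N)], and the two
    denominators are of order [m]. *)
Lemma cabs_qb_diff m : (0 < m <= N)%N -> cabs (qb q m - m%:R^-1) <= 8 / N%:R.
Proof.
move=> /andP[m0 mN].
have mR : (m%:R : C) != 0 by rewrite pnatr_eq0 -lt0n.
have qnz : qn q m != 0 by apply: qn_root_neq0; rewrite m0 -addnn (leq_trans mN)// leq_addr.
have e : qb q m - m%:R^-1 = (m%:R - qn q m) * (qb q m * m%:R^-1).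
  by rewrite /qb; field; rewrite mR qnz.
have e2 : m%:R - qn q m = (1 - q) * \sum_(i < m) qn q i.
  elim: (m) => [|j IH]; first by rewrite qn0 big_ord0; ring.
  rewrite big_ord_recr /= mulrDr -IH -natr1.
  have -> : qn q j.+1 = qn q j + q ^+ j by rewrite /qn big_ord_recr.
  by rewrite exprqn; ring.
have m0R : 0 < (m%:R : R) by rewrite ltr0n.
have h1 : cabs (m%:R - qn q m) <= 4 / N%:R * (m%:R * m%:R).
  rewrite e2 cabsM ler_pM ?cabs_ge0 ?cabs_1q_le// (le_trans (cabs_sum _ _ _))//.
  have -> : (m%:R * m%:R : R) = \sum_(i < m) m%:R by rewrite sumr_const card_ord -[RHS]mulr_natr.
  apply: ler_sum => i _; rewrite (le_trans (cabs_qn_le _))// ler_nat ltnW//.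
have h2 : cabs (qb q m * m%:R^-1) <= 2 / m%:R * m%:R^-1.
  by rewrite cabsM [cabs m%:R^-1]cabsV cabs_nat ler_wpM2r ?invr_ge0// cabs_qb_le// m0.
rewrite e cabsM (le_trans (ler_pM (cabs_ge0 _) (cabs_ge0 _) h1 h2))//.
rewrite le_eqVlt; apply/orP; left; apply/eqP; field.
by rewrite !gt_eqF ?ltr0n.
Qed.

Lemma qa_qb m : (0 < m <= N.*2)%N -> qa q m = qb q m - (1 - q).
Proof.
move=> mN; have qnz := qn_root_neq0 mN.
by rewrite /qa /qb exprqn; field.
Qed.

(** [0 = [p]_q = [m]_q + q^m [p-m]_q]. *)
Lemma qb_reflect m : (0 < m <= N.*2)%N -> qb q (N.*2.+1 - m) = - qa q m.
Proof.
move=> mN; have qnz := qn_root_neq0 mN.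
have rN : (0 < N.*2.+1 - m <= N.*2)%N by lia.
have rnz := qn_root_neq0 rN.
have q0 : q ^+ m != 0 by rewrite expf_neq0// /rootq expf_neq0// expi_neq0.
have : qn q m + q ^+ m * qn q (N.*2.+1 - m) = 0.
  by rewrite -qnD subnKC ?qn_root_eq0//; lia.
move=> e; have e1 : qn q m = - (q ^+ m * qn q (N.*2.+1 - m)).
  by apply/eqP; rewrite -subr_eq0 opprK e.
by rewrite /qa /qb e1; field; rewrite rnz q0.
Qed.

Lemma qa_reflect m : (0 < m <= N.*2)%N -> qa q (N.*2.+1 - m) = - qb q m.
Proof.
move=> mN; have rN : (0 < N.*2.+1 - m <= N.*2)%N by lia.
by rewrite qa_qb// qb_reflect// qa_qb//; ring.
Qed.

End RootFamily.

Section GoodRoots.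
Variable R : realType.
Local Notation C := R[i].

Lemma good_qb : good (fun N => qb (rootq R N)).
Proof.
exists 8; first by lra.
move=> N m mN; have N0 : (0 < N)%N by lia.
split; last exact: cabs_qb_diff.
apply: le_trans (cabs_qb_le R N0 mN) _; rewrite ler_wpM2r ?invr_ge0//; lra.
Qed.

Lemma good_qa : good (fun N => qa (rootq R N)).
Proof.
exists 12; first by lra.
move=> N m mN; have N0 : (0 < N)%N by lia.
have mN2 : (0 < m <= N.*2)%N by lia.
split.
  rewrite /qa cabsM cabsX cabs_q expr1n mul1r -[_^-1]/(qb (rootq R N) m).
  by apply: le_trans (cabs_qb_le R N0 mN) _; rewrite ler_wpM2r ?invr_ge0//; lra.
rewrite qa_qb// addrAC (le_trans (cabsB _ _))//.
have h1 := cabs_qb_diff R N0 mN; have h2 := cabs_1q_le R N0; lra.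
Qed.

(** [- pi i]. *)
Definition mpii : C := (0 +i* (- pi))%C.

(** [1 - q] is close to [- 2 pi i / (2N+1)]. *)
Lemma rootq_asym : asym (fun N => N%:R * (1 - rootq R N)) (fun=> mpii).
Proof.
(* the real and the imaginary error are at most 4 t and 9 t, and t <= 2 / N,
   so that any constant from 26 on is large enough *)
exists 40, 0%N; split=> // N N0; rewrite expr0 mul1r.
have t0 := theta_gt0 R N; set t := theta R N in t0 *.
have s0 := sin_theta_gt0 R N0; rewrite -/t in s0.
have Np : 0 < (N%:R : R) by rewrite ltr0n.
have N2t : N%:R * (2 * t) = pi - t.
  by have := theta_mul R N; rewrite -/t -natr1 -mul2n natrM => e; lra.
have pi4 : pi <= 4 :> R by have := pihalf_lt2 R; lra.
have tN : t <= 2 / N%:R.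
  rewrite ler_pdivlMr//; lra.
have e : N%:R * (1 - rootq R N) - mpii =
   (N%:R * (2 * sin t ^+ 2))%:C%C + (0 +i* (pi - N%:R * sin (2 * t)))%C.
  have -> : sin (2 * t) = 2 * (cos t * sin t).
    by rewrite mulr_natl sin_mulr2n -mulr_natl.
  rewrite /rootq /mpii expr2 /expi -/t -[X in X * _](rmorph_nat (real_complex R)).
  simpc; congr (_ +i* _)%C; last by ring.
  have := cos2Dsin2 t; rewrite !expr2 => h.
  have -> : cos t * cos t = 1 - sin t * sin t by lra.
  by ring.
rewrite e (le_trans (cabsD _ _))//.
have -> : cabs (0 +i* (pi - N%:R * sin (2 * t)))%C = `|pi - N%:R * sin (2 * t)|.
  by rewrite /cabs /ComplexField.Normc.normc /= expr0n add0r sqrtr_sqr.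
rewrite cabs_real ger0_norm; last by rewrite !mulr_ge0// ltW.
have h1 : sin t <= t by rewrite sin_le_id// ltW.
have h2 : sin (2 * t) <= 2 * t by rewrite sin_le_id// mulr_ge0// ltW.
have h3 : 2 * t - (2 * t) ^+ 2 <= sin (2 * t) by rewrite sin_ge_quad// mulr_ge0// ltW.
have b1 : N%:R * (2 * sin t ^+ 2) <= 4 * t.
  have : sin t ^+ 2 <= t ^+ 2 by rewrite lerXn2r ?nnegrE ?(ltW t0) ?(ltW s0).
  rewrite -(ler_pM2l Np) => h; rewrite mulrCA.
  have -> : 4 * t = 2 * (2 * t) by ring.
  rewrite ler_pM2l// (le_trans h)// expr2 mulrA ler_pM2r//; lra.
have b2 : N%:R * sin (2 * t) <= pi - t by rewrite -N2t ler_pM2l.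
have b3 : pi - 9 * t <= N%:R * sin (2 * t).
  have : N%:R * (2 * t - (2 * t) ^+ 2) <= N%:R * sin (2 * t) by rewrite ler_pM2l.
  apply: le_trans.
  have -> : N%:R * (2 * t - (2 * t) ^+ 2) = (pi - t) - (pi - t) * (2 * t) by rewrite -N2t; ring.
  have : 0 <= (4 - pi + t) * t by rewrite mulr_ge0 ?ltW//; lra.
  by lra.
rewrite ger0_norm; last by lra.
have -> : 40 / N%:R = 20 * (2 / N%:R) :> R by ring.
lra.
Qed.

End GoodRoots.

(** * The correction factor at a root of unity *)

Section CorrPolyRoot.
Variables (K : fieldType) (q : K) (P : nat).
Local Notation p := P.+1.
Hypothesis qn_root : qn q p = 0.
Hypothesis qn_neq0 : forall m, (0 < m <= P)%N -> qn q m != 0.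
Hypothesis p_neq0 : p%:R != 0 :> K.

Lemma q_neq1 : 1 - q != 0.
Proof.
apply/negP; rewrite subr_eq0 => /eqP e; move: qn_root; rewrite /qn -e.
rewrite (eq_bigr (fun=> 1)); last by move=> i _; rewrite expr1n.
by rewrite sumr_const card_ord => /eqP; apply/negP.
Qed.

Lemma q_prim : p.-primitive_root q.
Proof.
apply/andP; split=> //; apply/forallP => i; rewrite unity_rootE.
have -> : (q ^+ i.+1 == 1) = (qn q i.+1 == 0).
  rewrite exprqn -[LHS]subr_eq0 addrAC subrr sub0r oppr_eq0 mulf_eq0.
  by rewrite (negbTE q_neq1).
case: (eqVneq i.+1 p) => [->|ip]; first by rewrite qn_root !eqxx.
by rewrite (negbTE (qn_neq0 _)) ?(negbTE ip)//; have := ltn_ord i; move: ip; lia.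
Qed.

(** The factorization of [(X^p - 1) / (X - 1)], with the roots inverted by
    [j |-> p - j]; the constant of proportionality is seen at [X = 0]. *)
Lemma prod_1q : \prod_(1 <= j < p) (1 - (q ^+ j)%:P * 'X) = \sum_(i < p) 'X^i :> {poly K}.
Proof.
have X1 : ('X - 1 : {poly K}) != 0 by rewrite -polyC1 polyXsubC_eq0.
have e1 : \prod_(1 <= i < p) ('X - (q ^+ i)%:P) = \sum_(i < p) 'X^i :> {poly K}.
  apply: (mulfI X1); rewrite -subrX1 -(factor_Xn_sub_1 q_prim).
  by rewrite [RHS]big_ltn// expr0 polyC1.
have e2 : \prod_(1 <= j < p) (1 - (q ^+ j)%:P * 'X) =
   (\prod_(1 <= j < p) - q ^+ j)%:P * \sum_(i < p) 'X^i.
  rewrite rmorph_prod -e1 [X in _ * X]big_nat_rev/= -big_split/=.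
  rewrite !big_nat; apply: eq_bigr => j /andP[j1 jp].
  have -> : (1 + p - j.+1 = p - j)%N by lia.
  rewrite mulrBr -polyCM mulNr -exprD subnKC ?(ltnW jp)//.
  by rewrite (prim_expr_order q_prim) !polyCN opprK mulNr addrC.
rewrite e2; suff -> : \prod_(1 <= j < p) - q ^+ j = 1 by rewrite mul1r.
have := congr1 (fun f => f.[0]) e2; rewrite hornerM hornerC horner_sum horner_prod.
rewrite big1 => [|i _]; last by rewrite hornerD hornerN hornerM hornerX mulr0 subr0 -polyC1 hornerC.
rewrite big_ord_recl [X in _ = _ * (_ + X)]big1 => [|i _]; last by rewrite hornerXn expr0n.
by rewrite hornerXn expr0 addr0 mulr1.
Qed.

(** Substituting [1 + (1 - q) X] for the variable in [prod_1q] turns the factor at [j]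
    into [(1 - q^j) (1 - a_j X)], and the product of the [1 - q^j] is [p]. *)
Lemma corr_poly_root :
  p%:R *: corr_poly q P = \sum_(i < p) (1 + (1 - q) *: 'X) ^+ i.
Proof.
have e1 : \prod_(1 <= j < p) (1 - q ^+ j) = p%:R.
  have := congr1 (fun f => f.[1]) prod_1q; rewrite horner_prod horner_sum.
  rewrite [RHS](eq_bigr (fun=> 1)) => [|i _]; last by rewrite hornerXn expr1n.
  rewrite sumr_const card_ord => <-; apply: eq_bigr => j _.
  by rewrite hornerD hornerN hornerM hornerX mulr1 -polyC1 !hornerC.
have -> : \sum_(i < p) (1 + (1 - q) *: 'X) ^+ i =
  (\sum_(i < p) 'X^i) \Po (1 + (1 - q) *: 'X).
  rewrite rmorph_sum; apply: eq_bigr => i _ /=.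
  by rewrite comp_Xn_poly.
have compE j : (1 - (q ^+ j)%:P * 'X) \Po (1 + (1 - q) *: 'X) =
    1 - (q ^+ j)%:P * (1 + (1 - q) *: 'X).
  by rewrite rmorphB rmorph1 rmorphM /= comp_polyC comp_polyX.
rewrite -prod_1q rmorph_prod -e1 -mul_polyC rmorph_prod -big_split/=.
rewrite !big_nat; apply: eq_bigr => j jp.
have qj : qn q j != 0 by apply: qn_neq0.
rewrite compE; transitivity ((1 - q ^+ j)%:P * (1 - 'X * (qa q j)%:P)).
  by rewrite polyCB polyC1.
have -> : 1 - q ^+ j = (1 - q) * qn q j by rewrite exprqn; ring.
rewrite mulrBr mulr1 mulrCA -polyCM.
have -> : (1 - q) * qn q j * qa q j = (1 - q) * q ^+ j by rewrite /qa; field.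
by rewrite -mul_polyC exprqn !(polyCM, polyCB) polyC1; ring.
Qed.

Lemma coef_1X (c : K) i j : ((1 + c *: 'X) ^+ i)`_j = 'C(i, j)%:R * c ^+ j.
Proof.
elim: i j => [|i IH] j.
  by rewrite expr0 coef1; case: j => [|j]; rewrite ?bin0 ?mul1r// bin0n mul0r.
rewrite exprS mulrDl mul1r coefD IH -scalerAl coefZ coefXM.
case: j => [|j]; first by rewrite !bin0 mulr0 addr0.
by rewrite /= IH binS natrD exprS; ring.
Qed.

(** The binomial numbers in [corr_poly_root] add up along a column of the Pascal
    triangle. *)
Lemma coef_corr_poly_root j : (corr_poly q P)`_j = 'C(p, j.+1)%:R * (1 - q) ^+ j / p%:R.
Proof.
apply: (mulfI p_neq0); rewrite -coefZ corr_poly_root coef_sum.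
rewrite (eq_bigr (fun i : 'I_p => 'C(i, j)%:R * (1 - q) ^+ j)); last first.
  by move=> i _; rewrite coef_1X.
rewrite -mulr_suml -natr_sum.
have -> : (\sum_(i < p) 'C(i, j) = 'C(p, j.+1))%N.
  elim: (p) => [|n IH]; first by rewrite big_ord0 bin0n.
  by rewrite big_ord_recr IH /= binS addnC.
by rewrite mulrCA mulfV ?mulr1.
Qed.

End CorrPolyRoot.

(** * Asymptotics of sums over the full chain *)

Section FullChain.
Variable R : realType.
Local Notation C := R[i].

Lemma close_letters_sub (T : eqType) (l l' : seq T) wtl (w : nat -> nat -> C) F :
  {subset l' <= l} -> close_letters l wtl w F -> close_letters l' wtl w F.
Proof. by move=> sl [c c0 H]; exists c => // N x n /sl xl; exact: H. Qed.

Lemma nsum_scale (K : comNzRingType) (T : Type) d a N (l : seq T) (s : T -> K) (F : T -> nat -> K) :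
  nsum d a N [seq (fun n => s x * F x n) | x <- l] =
  (\prod_(x <- l) s x) * nsum d a N [seq F x | x <- l].
Proof.
elim: l N => [|x l IH] N; first by rewrite big_nil mulr1.
rewrite [map _ _]/= [in RHS]/= !nsum_cons big_cons mulr_sumr; apply: eq_bigr => n _.
by rewrite IH; ring.
Qed.

Definition reg_poly_of (l : seq nat) : {poly R} := xget 0 [set P | reg_spec l P]%classic.

Lemma reg_poly_ofP l : is_index l -> reg_spec l (reg_poly_of l).
Proof. by move=> hl; apply: xgetPex; exact: regularization. Qed.

Lemma is_index_take i l : is_index l -> is_index (take i l).
Proof. by rewrite -{1}(cat_take_drop i l) /is_index all_cat => /andP[]. Qed.

Lemma is_index_drop i l : is_index l -> is_index (drop i l).
Proof. by rewrite -{1}(cat_take_drop i l) /is_index all_cat => /andP[]. Qed.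

Lemma mixed_reg (T : eqType) (l : seq T) wtl w F : good w ->
  is_index (map wtl l) -> close_letters l wtl w F ->
  asym (fun N => nsum false 0 N (map (F N) l))
       (fun N => (cpoly (reg_poly_of (map wtl l))).[starT w N]).
Proof.
move=> gw hl cF; apply: asym_trans (close_letters_asym cF) _.
by have [_] := reg_poly_ofP hl; apply.
Qed.

(** The chain up to [2N] is cut at [N] and its upper half reflected by
    [n |-> 2N+1 - n]; the hypothesis on [F] makes that half a sum in the weights [wh] up
    to sign. Both halves are then replaced by their regularization polynomials. *)
Lemma full_asym (T : eqType) (l : seq T) (wtl : T -> nat) (wl wh : nat -> nat -> C)
    (F Fh : nat -> T -> nat -> C) :
  good wl -> good wh -> is_index (map wtl l) ->
  close_letters l wtl wl F -> close_letters l wtl wh Fh ->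
  (forall N x n, x \in l -> (0 < n <= N)%N ->
     F N x (N.*2.+1 - n)%N = (-1) ^+ wtl x * Fh N x n) ->
  asym (fun N => nsum false 0 N.*2 (map (F N) l))
    (fun N => \sum_(i < (size l).+1) (-1) ^+ wt (map wtl (take i l)) *
       (cpoly (reg_poly_of (rev (map wtl (take i l))))).[starT wh N] *
       (cpoly (reg_poly_of (map wtl (drop i l)))).[starT wl N]).
Proof.
move=> gl gh hl cl ch hF.
have e N : nsum false 0 N.*2 (map (F N) l) =
   \sum_(i < (size l).+1) (-1) ^+ wt (map wtl (take i l)) *
      nsum false 0 N (map (Fh N) (rev (take i l))) *
      nsum false 0 N (map (F N) (drop i l)).
  rewrite (@nsum_split _ N); last by rewrite -addnn leq_addr.
  rewrite size_map; apply: eq_bigr => i _; rewrite -map_drop -map_take; congr (_ * _).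
  rewrite (nsum_reflect (c := N.*2.+1)) //; last by rewrite -addnn leq_addr.
  rewrite subnn (_ : (N.*2.+1 - N.+1 = N)%N); last by rewrite subSS -addnn addnK.
  rewrite -map_comp -map_rev.
  have sub : {subset rev (take i l) <= l} by move=> x; rewrite mem_rev => /mem_take.
  have eqx M : (M <= N)%N ->
    nsum false 0 M [seq ((fun g n => g (N.*2.+1 - n)%N) \o F N) j | j <- rev (take i l)] =
    nsum false 0 M [seq (fun n => (-1) ^+ wtl x * Fh N x n) | x <- rev (take i l)].
    elim: (rev (take i l)) M sub => // x s IHs M sub MN.
    rewrite ![map _ (_ :: _)]/= !nsum_cons !big_nat; apply: eq_bigr => n /andP[n0 nM].
    have nN : (0 < n <= N)%N by rewrite n0 (leq_trans _ MN).
    rewrite [(n - _)%N]subn0 IHs ?(leq_trans _ MN)//.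
      by congr (_ * _); rewrite /= hF// sub// mem_head.
    by move=> y ys; apply: sub; rewrite inE ys orbT.
  rewrite eqx// nsum_scale; congr (_ * _).
  have -> : \prod_(x <- rev (take i l)) (-1 : C) ^+ wtl x = (-1) ^+ wt (map wtl (rev (take i l))).
    by elim: (rev _) => [|x s IHs]; rewrite ?big_nil ?big_cons// IHs -exprD.
  by congr (_ ^+ _); rewrite map_rev /wt sumn_rev.
have hT : forall i, is_index (rev (map wtl (take i l))) by move=> i; rewrite is_index_rev map_take is_index_take.
have hD : forall i, is_index (map wtl (drop i l)) by move=> i; rewrite map_drop is_index_drop.
apply: (eq_asym (fun N _ => esym (e N)) (fun _ _ => erefl)).
apply: asym_sum => i _; apply: asymM; last 2 first.
- by apply: tameM; [exact: tame_cst|exact: tame_horner (good_tame gh)].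
- exact: tame_horner (good_tame gl).
- apply: asymM; [exact: asym_refl| |exact: tame_cst|exact: tame_horner (good_tame gh)].
  rewrite -map_rev; apply: mixed_reg => //; first by rewrite map_rev.
  by apply: close_letters_sub ch => x; rewrite mem_rev => /mem_take.
apply: mixed_reg => //; apply: close_letters_sub cl => x /mem_drop //.
Qed.

Local Notation q := (rootq R).

Lemma good_close (w v : nat -> nat -> C) : good w -> good v ->
  exists2 c : R, 1 <= c & forall N n, (0 < n <= N)%N ->
    [/\ cabs (w N n) <= c / n%:R, cabs (v N n) <= c / n%:R & cabs (v N n - w N n) <= c / N%:R].
Proof.
move=> [c c1 H] [d d1 G]; exists (c + d); first by lra.
move=> N n nN; have [H1 H2] := H N n nN; have [G1 G2] := G N n nN.
have n0 : 0 <= (n%:R^-1 : R) by rewrite invr_ge0.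
have cw0 : 0 <= c / n%:R by rewrite mulr_ge0//; lra.
have dw0 : 0 <= d / n%:R by rewrite mulr_ge0//; lra.
rewrite !mulrDl; split; [lra|lra|].
have -> : v N n - w N n = (v N n - n%:R^-1) - (w N n - n%:R^-1) by ring.
by rewrite (le_trans (cabsB _ _))// addrC lerD.
Qed.

(** A product of [i] factors [w] and [j] factors [v] has size [n^-(i+j)], while
    exchanging a [v] for a [w] costs an absolute error [O(1/N)]. As soon as there are two
    factors, the remaining one makes this a relative error. A single factor must
    already be of the kind [w]. *)
Lemma cabs_prod_close (w v : nat -> nat -> C) W : good w -> good v ->
  exists2 c : R, 0 <= c & forall N n i j, (0 < n <= N)%N -> (0 < i + j <= W)%N ->
    (i + j = 1 -> i = 1)%N ->
    [/\ cabs (w N n ^+ i * v N n ^+ j) <= c / n%:R, cabs (w N n ^+ (i + j)) <= c / n%:R &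
        cabs (w N n ^+ i * v N n ^+ j - w N n ^+ (i + j)) <= N%:R^-1 * (c / n%:R)].
Proof.
move=> gw gv; have [c c1 H] := good_close gw gv; have c0 : 0 <= c by apply: le_trans c1.
exists (W.+1%:R * c ^+ W); first by rewrite mulr_ge0// exprn_ge0.
move=> N n i j nN /andP[ij0 ijW] ij1; have [H1 H2 H3] := H N n nN.
have /andP[n0 nN'] := nN.
have nR : 1 <= (n%:R : R) by rewrite ler1n.
have ni : 0 <= (n%:R^-1 : R) by rewrite invr_ge0.
have ni1 : (n%:R^-1 : R) <= 1 by rewrite invf_le1// ltr0n.
have Ni : 0 <= (N%:R^-1 : R) by rewrite invr_ge0.
have cW1 : 1 <= c ^+ W by rewrite exprn_ege1.
have A0 : 0 <= c / n%:R by rewrite mulr_ge0.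
have bnd : (c / n%:R) ^+ (i + j) <= W.+1%:R * c ^+ W / n%:R.
  rewrite exprMn ler_pM ?exprn_ge0//; last by rewrite -[leRHS]expr1 ler_wiXn2l.
  by rewrite -[leLHS]mul1r ler_pM ?exprn_ge0 ?ler1n// ler_weXn2l.
split.
- apply: le_trans bnd; rewrite cabsM !cabsX exprD ler_pM ?exprn_ge0 ?cabs_ge0//.
    by rewrite lerXn2r ?nnegrE ?cabs_ge0.
  by rewrite lerXn2r ?nnegrE ?cabs_ge0.
- by apply: le_trans bnd; rewrite cabsX lerXn2r ?nnegrE ?cabs_ge0.
case: j ij0 ijW ij1 bnd => [|j] ij0 ijW ij1 bnd.
  by rewrite addn0 mulr1 subrr cabs0 !mulr_ge0// exprn_ge0.
have ij2 : (1 < i + j.+1)%N.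
  rewrite addnS ltnS lt0n; apply/negP => /eqP ij_0.
  by move: ij1 ij_0; rewrite addnS => + e; rewrite e => /(_ erefl) i1; rewrite i1 in e.
rewrite exprD -mulrBr cabsM cabsX.
have d1 := cabs_subX j.+1 H2 H1.
apply: (@le_trans _ _ ((c / n%:R) ^+ i * (j.+1%:R * (c / N%:R) * (c / n%:R) ^+ j))).
  rewrite ler_pM ?cabs_ge0 ?exprn_ge0 ?cabs_ge0//.
    by rewrite lerXn2r ?nnegrE ?cabs_ge0.
  apply: le_trans d1 _; rewrite ler_wpM2r ?exprn_ge0// ler_wpM2l//.
have -> : (c / n%:R) ^+ i * (j.+1%:R * (c / N%:R) * (c / n%:R) ^+ j) =
    N%:R^-1 * (j.+1%:R * c ^+ (i + j).+1 * n%:R^-1 ^+ (i + j)).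
  rewrite !exprMn [c ^+ (i + j).+1]exprS !exprD; ring.
rewrite ler_wpM2l// ler_pM ?mulr_ge0 ?exprn_ge0//.
  rewrite ler_pM ?exprn_ge0// ?ler_nat ?ler_weXn2l//.
    by rewrite ltnS (leq_trans _ ijW)// addnS ltnW// ltnS leq_addl.
  by rewrite -addnS.
by rewrite -[leRHS]expr1 ler_wiXn2l//; move: ij2; rewrite addnS ltnS.
Qed.

End FullChain.

(** * Symmetric multiple zeta-star values *)

Section Symmetric.
Variable R : realType.
Local Notation C := R[i].
Local Notation q := (rootq R).
Local Notation d := (mpii R).
Local Notation wa := (fun N => qa (rootq R N)).
Local Notation wb := (fun N => qb (rootq R N)).
Local Notation Ta := (starT wa).
Local Notation Tb := (starT wb).

Lemma mem_index l x : is_index l -> x \in l -> (0 < x)%N.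
Proof. by move=> /allP; apply. Qed.

Lemma bletter_close (l : seq nat) (w v : nat -> nat -> C) : good w -> good v -> is_index l ->
  close_letters l id w (fun N x n => w N n * v N n ^+ x.-1).
Proof.
move=> gw gv hl; have [c c0 H] := cabs_prod_close (wt l) gw gv; exists c => // N x n xl nN.
have x0 := mem_index hl xl.
have := H N n 1%N x.-1 nN; rewrite add1n (prednK x0) expr1; apply=> //.
by rewrite x0 mem_wt.
Qed.

Lemma aletter_close (l : seq (nat * nat)) (w v : nat -> nat -> C) : good w -> good v ->
  (forall x, x \in l -> 0 < x.1)%N ->
  close_letters l (fun x => x.1 + x.2)%N w (fun N x n => v N n ^+ x.1.-1 * w N n ^+ x.2.+1).
Proof.
move=> gw gv hl; pose W := wt [seq (x.1 + x.2)%N | x <- l].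
have [c c0 H] := cabs_prod_close W gw gv; exists c => // N x n xl nN.
have x0 := hl x xl; have e : (x.2.+1 + x.1.-1 = x.1 + x.2)%N.
  by rewrite addSn -addnS prednK// addnC.
have := H N n x.2.+1 x.1.-1 nN; rewrite e mulrC; apply.
  by rewrite addn_gt0 x0 mem_wt//; apply/mapP; exists x.
by case: (x.1) x0 => // a _; rewrite addSn => -[] /eqP; rewrite addn_eq0 => /andP[_ /eqP->].
Qed.

(** Each of the [N] terms of the difference is [1 - q]. *)
Lemma Tb_Ta : asym Tb (fun N => Ta N + d).
Proof.
have e N : (0 < N)%N -> Tb N = Ta N + N%:R * (1 - q N).
  move=> N0; rewrite /starT ![lpow _ _]/= !nsum_cons.
  have -> : N%:R * (1 - q N) = \sum_(1 <= n < N.+1) (1 - q N).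
    by rewrite sumr_const_nat subn1 mulr_natl.
  rewrite -big_split/= !big_nat; apply: eq_bigr => n /andP[n0 nN].
  rewrite nsum_nil !expr1 !mulr1 (@qa_qb _ _ N0); first by rewrite subrK.
  by rewrite n0 -addnn (leq_trans (nN : (n <= N)%N))// leq_addr.
apply: (eq_asym (fun N N0 => esym (e N N0)) (fun _ _ => erefl)).
by apply: asymD; [exact: asym_refl|exact: rootq_asym].
Qed.

(** The polynomial of a full chain in the variable [Ta]; [sl] and [sh] express through it
    the depth-one sums of the lower and of the reflected upper half. Only one of the two
    is [Ta] itself, the other is [Ta - pi i]. *)
Definition chain_poly (sl sh : {poly C}) (l : seq nat) : {poly C} :=
  \sum_(i < (size l).+1) (-1) ^+ wt (take i l) *:
    ((cpoly (reg_poly_of R (rev (take i l))) \Po sh) * (cpoly (reg_poly_of R (drop i l)) \Po sl)).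

Lemma chain_asym (T : eqType) (l : seq T) (wtl : T -> nat) (wl wh : nat -> nat -> C)
    (F Fh : nat -> T -> nat -> C) (sl sh : {poly C}) :
  good wl -> good wh -> is_index (map wtl l) ->
  close_letters l wtl wl F -> close_letters l wtl wh Fh ->
  asym (starT wl) (fun N => sl.[Ta N]) -> asym (starT wh) (fun N => sh.[Ta N]) ->
  (forall N x n, x \in l -> (0 < n <= N)%N ->
     F N x (N.*2.+1 - n)%N = (-1) ^+ wtl x * Fh N x n) ->
  asym (fun N => nsum false 0 N.*2 (map (F N) l))
    (fun N => (chain_poly sl sh (map wtl l)).[Ta N]).
Proof.
move=> gl gh hl cl ch al ah hF; apply: asym_trans (full_asym gl gh hl cl ch hF) _.
have tTa := good_tame (@good_qa R).
have tl : tame (fun N => sl.[Ta N]) by exact: tame_horner.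
have th : tame (fun N => sh.[Ta N]) by exact: tame_horner.
apply: (eq_asym (fun _ _ => erefl) (u' := fun N => _)
  (v := fun N => \sum_(i < (size l).+1) (-1) ^+ wt (map wtl (take i l)) *
       (cpoly (reg_poly_of R (rev (map wtl (take i l))))).[sh.[Ta N]] *
       (cpoly (reg_poly_of R (map wtl (drop i l)))).[sl.[Ta N]])) => [N _|].
  rewrite /chain_poly size_map horner_sum; apply: eq_bigr => i _.
  by rewrite hornerZ hornerM !horner_comp -!map_take -!map_drop mulrA.
apply: asym_sum => i _; apply: asymM; last 2 first.
- by apply: tameM; [exact: tame_cst|exact: tame_horner].
- exact: tame_horner.
- apply: asymM; [exact: asym_refl| |exact: tame_cst|exact: tame_horner].
  exact: asym_horner.
exact: asym_horner.
Qed.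

Let sX : {poly C} := 'X.
Let sD : {poly C} := 'X + d%:P.

Lemma asym_sX : asym Ta (fun N => sX.[Ta N]).
Proof. by apply: (eq_asym _ _ (asym_refl Ta)) => N _; rewrite /sX ?hornerX. Qed.

Lemma asym_sD : asym Tb (fun N => sD.[Ta N]).
Proof. by apply: (eq_asym _ _ Tb_Ta) => N _ //; rewrite /sD hornerD hornerX hornerC. Qed.

Lemma bletter_asym l : is_index l ->
  asym (fun N => nsum false 0 N.*2 [seq bletter (q N) x | x <- l])
       (fun N => (chain_poly sD sX l).[Ta N]).
Proof.
move=> hl; have gb := @good_qb R; have ga := @good_qa R.
have := @chain_asym _ l id wb wa (fun N x n => wb N n * wa N n ^+ x.-1)
  (fun N x n => wa N n * wb N n ^+ x.-1) sD sX gb ga.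
rewrite map_id; apply=> //; [exact: bletter_close|exact: bletter_close|exact: asym_sD|exact: asym_sX|].
move=> N x n xl nN; have x0 := mem_index hl xl.
have N0 : (0 < N)%N by move: nN; lia.
have n2 : (0 < n <= N.*2)%N by move: nN; lia.
have e : (-1) ^+ x = - (-1) ^+ x.-1 :> C by rewrite -[in LHS](prednK x0) exprS mulN1r.
by rewrite qb_reflect// qa_reflect// e [(- qb _ _) ^+ _]exprNn; ring.
Qed.

Lemma aletter_asym (l : seq (nat * nat)) : (forall x, x \in l -> 0 < x.1)%N ->
  asym (fun N => nsum false 0 N.*2 [seq aletter (q N) x | x <- l])
       (fun N => (chain_poly sX sD [seq (x.1 + x.2)%N | x <- l]).[Ta N]).
Proof.
move=> hl; have gb := @good_qb R; have ga := @good_qa R.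
have := @chain_asym _ l (fun x => x.1 + x.2)%N wa wb
  (fun N x n => wb N n ^+ x.1.-1 * wa N n ^+ x.2.+1)
  (fun N x n => wa N n ^+ x.1.-1 * wb N n ^+ x.2.+1) sX sD ga gb.
apply=> //; [|exact: aletter_close|exact: aletter_close|exact: asym_sX|exact: asym_sD|].
  by apply/allP => _ /mapP[x xl ->]; rewrite addn_gt0 hl.
move=> N x n xl nN; have x0 := hl x xl.
have N0 : (0 < N)%N by move: nN; lia.
have n2 : (0 < n <= N.*2)%N by move: nN; lia.
have e : (-1) ^+ (x.1 + x.2) = (-1) ^+ x.1.-1 * (-1) ^+ x.2.+1 :> C.
  by rewrite -exprD addnS -addSn prednK.
rewrite qb_reflect// qa_reflect// e [(- qa _ _) ^+ _]exprNn [(- qb _ _) ^+ _]exprNn; ring.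
Qed.

(** ** The constant [pi] *)

Lemma d_sqr : d ^+ 2 = (- (pi ^+ 2))%:C%C.
Proof. by rewrite /mpii expr2; simpc; congr (_ +i* _)%C; ring. Qed.

Lemma nsum1_fold N (g : nat -> C) :
  nsum false 0 N.*2 [:: g] =
  nsum false 0 N [:: g] + nsum false 0 N [:: fun n => g (N.*2.+1 - n)%N].
Proof.
rewrite (@nsum_split _ N); last by rewrite -addnn leq_addr.
rewrite big_ord_recr big_ord1 /= mul1r mulr1; congr (_ + _).
rewrite (nsum_reflect (c := N.*2.+1)) //; last by rewrite -addnn leq_addr.
by rewrite subnn (_ : (N.*2.+1 - N.+1 = N)%N)//; rewrite subSS -addnn addnK.
Qed.

Lemma Cnat_neq0 n : (0 < n)%N -> n%:R != 0 :> C.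
Proof. by move=> n0; rewrite pnatr_eq0 -lt0n. Qed.

(** For [k = (1)] and exponent 1 the exact duality reads
    [4 sum a_n b_n + (N (1 - q))^2 = - sum a_n^2 - sum b_n^2], and in the limit
    [4 zeta(2) - pi^2 = - 2 zeta(2)]. *)
Lemma zeta2_pi : pi ^+ 2 = 6 * zeta R [:: 2%N].
Proof.
pose z : C := (nsum_lim R false [:: 2%N])%:C%C.
have ga := @good_qa R; have gb := @good_qb R.
have za := good_adm ga (isT : adm_top [:: 2%N]).
have zb := good_adm gb (isT : adm_top [:: 2%N]).
pose ab N := nsum false 0 N [:: fun n => qb (q N) n * qa (q N) n].
have zab : asym ab (fun=> z).
  have := @close_letters_asym R _ [:: 2%N] id wb (fun N x n => wb N n * wa N n ^+ x.-1)
    (bletter_close gb ga (isT : is_index [:: 2%N])).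
  move=> /asym_trans/(_ zb); apply: eq_asym => // N _.
suff e : asym (fun=> 6 * z) (fun=> - d ^+ 2).
  have := asym_cst e; rewrite d_sqr -rmorphN opprK /z -(rmorph_nat (real_complex R)) -rmorphM.
  move=> /complexI <-; congr (_ * _); rewrite zetaE.
  have e3 : (fun N => nsum false 0 N (lpow (invn R) [:: 2%N])) =
      (fun N => nsum true 0 N (lpow (invn R) (rev [:: 2%N]))).
    by apply: funext => N; rewrite /= !nsum_cons; apply: eq_bigr => n _; rewrite !nsum_nil.
  by rewrite /nsum_lim e3.
(* the exact duality for the index (1) with one extra power *)
have key N : (0 < N)%N ->
   4 * ab N + (N%:R * (1 - q N)) ^+ 2 =
   - (nsum false 0 N (lpow (wa N) [:: 2%N]) + nsum false 0 N (lpow (wb N) [:: 2%N])).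
  move=> N0; have p0 := Cnat_neq0 (isT : (0 < N.*2.+1)%N).
  have qr := qn_root_eq0 R N0; have qn0' := @qn_root_neq0 R N N0.
  have red n : (0 < n <= N)%N -> (0 < n <= N.*2)%N by lia.
  have S2 : nsum false 0 N.*2 [:: bletter (q N) 2] = 2 * ab N.
    rewrite nsum1_fold mulr_natl mulr2n /ab; congr (_ + _); rewrite !nsum_cons !big_nat;
      apply: eq_bigr => n nN; rewrite /bletter expr1 //.
    by rewrite qb_reflect ?red// qa_reflect ?red//; ring.
  have S1 : nsum false 0 N.*2 [:: bletter (q N) 1] = N%:R * (1 - q N).
    rewrite nsum1_fold !nsum_cons -big_split/=.
    have -> : N%:R * (1 - q N) = \sum_(1 <= n < N.+1) (1 - q N).
      by rewrite sumr_const_nat subn1 mulr_natl.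
    rewrite !big_nat; apply: eq_bigr => n nN; rewrite /bletter !expr0 !nsum_nil !mulr1.
    by rewrite qb_reflect ?red// qa_qb ?red//; ring.
  have S3 : nsum false 0 N.*2 [:: aletter (q N) (1, 1)%N] =
      nsum false 0 N (lpow (wa N) [:: 2%N]) + nsum false 0 N (lpow (wb N) [:: 2%N]).
    rewrite nsum1_fold; congr (_ + _); rewrite !nsum_cons !big_nat;
      apply: eq_bigr => n nN; rewrite /aletter /= expr0 mul1r //.
    by rewrite qa_reflect ?red// sqrrN.
  have := @exact_duality C (q N) N.*2 [:: 1%N] 1 qr qn0' isT isT.
  have -> : hoffman_dual [:: 1%N] = [:: 1%N] by [].
  rewrite -[dep _]/1%N !big_ord_recl big_ord0 !esumS !big_ord_recl !big_ord0 /= !addr0 !add0r.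
  rewrite !(coef_corr_poly_root qr qn0' p0) /c2 !big_ord1 /= -[bump 0 0]/1%N -[(1 + 1)%N]/2%N -[(1 + 0)%N]/1%N.
  rewrite S1 S2 S3 expr0 expr1 bin1 bin0 => <-.
  have -> : 'C(2 + 1 + 1 - 2, 1) = 2%N by [].
  have -> : 'C(N.*2.+1, 2) = (N.*2.+1 * N)%N by rewrite bin2 /= -doubleMr doubleK.
  rewrite natrM; field.
  by rewrite nat1r.
have a1 := asymD (asymM (asym_refl (fun=> 4)) zab (tame_cst _) (tame_cst _))
  (asymM (@rootq_asym R) (@rootq_asym R) (tame_cst _) (tame_cst _)).
have a2 := asymN (asymD za zb).
have a3 : asym (fun=> 4 * z + d * d) (fun=> - (z + z)).
  apply: asym_trans (asym_sym a1) (asym_trans _ a2).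
  by apply: (eq_asym _ _ (asym_refl _)) => N N0 //; rewrite -key// expr2.
have := asym_cst a3 => e.
suff -> : 6 * z = - d ^+ 2 by exact: asym_refl.
have -> : 6 * z = 4 * z + d * d + (z + z) - d ^+ 2 by ring.
by rewrite e; ring.
Qed.

Lemma pi2_span : @mzv_span R (pi ^+ 2).
Proof.
rewrite zeta2_pi -[6](ratr_nat R 6); apply: spanZ; rewrite zetaE.
exact: span_nsum_lim_strict.
Qed.

(** ** Reduction modulo [pi * i] *)

(** The ring [Z[pi i]], in which two coordinates suffice because [pi^2] belongs to
    [Z]. *)
Definition zc (x : C) := exists z1 z2 : R,
  [/\ mzv_span z1, mzv_span z2 & x = z1%:C%C + d * z2%:C%C].

Definition zideal (x : C) := exists2 y, zc y & x = d * y.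

Lemma zc_real x : @mzv_span R x -> zc x%:C%C.
Proof. by move=> hx; exists x, 0; split=> //; [exact: span0|rewrite mulr0 addr0]. Qed.

Lemma zc0 : zc 0. Proof. exact: (zc_real (span0 R)). Qed.
Lemma zc1 : zc 1. Proof. exact: (zc_real (span1 R)). Qed.

Lemma zcD x y : zc x -> zc y -> zc (x + y).
Proof.
move=> [a [b [ha hb ->]]] [e [f [he hf ->]]]; exists (a + e), (b + f).
by split; [exact: spanD|exact: spanD|rewrite !rmorphD /=; ring].
Qed.

Lemma zcM x y : zc x -> zc y -> zc (x * y).
Proof.
move=> [a [b [ha hb ->]]] [e [f [he hf ->]]].
exists (a * e - pi ^+ 2 * (b * f)), (a * f + b * e); split.
- by apply: spanD; [exact: spanM|apply: spanN; apply: spanM; [exact: pi2_span|exact: spanM]].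
- by apply: spanD; exact: spanM.
have pE : (pi ^+ 2)%:C%C = - d ^+ 2 :> C by rewrite d_sqr rmorphN opprK.
have e1 : (pi ^+ 2 * (b * f))%:C%C = - d ^+ 2 * (b%:C%C * f%:C%C) :> C.
  by rewrite -pE -!rmorphM.
have e2 : (a * e - pi ^+ 2 * (b * f))%:C%C = a%:C%C * e%:C%C - (pi ^+ 2 * (b * f))%:C%C :> C.
  by rewrite -rmorphM -rmorphB.
by rewrite e2 e1 rmorphD !rmorphM /=; ring.
Qed.

Lemma zcX x n : zc x -> zc (x ^+ n).
Proof. by move=> hx; elim: n => [|n IH]; [exact: zc1|rewrite exprS; exact: zcM]. Qed.

Lemma zc_d : zc d.
Proof. by exists 0, 1; split; [exact: span0|exact: span1|rewrite add0r mulr1]. Qed.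

Lemma zc_nat n : zc n%:R.
Proof.
rewrite -(rmorph_nat (real_complex R)); apply: zc_real.
by rewrite -(mulr1 n%:R) -(ratr_nat R n); apply: spanZ; exact: span1.
Qed.

Lemma zc_sign n : zc ((-1) ^+ n).
Proof.
by apply: zcX; rewrite -(rmorph1 (real_complex R)) -rmorphN; apply: zc_real; apply: spanN; exact: span1.
Qed.

Lemma zc_invn n : zc n%:R^-1.
Proof.
rewrite -(rmorph_nat (real_complex R)) -fmorphV; apply: zc_real.
have -> : (n%:R^-1 : R) = ratr (n%:R^-1) * 1 by rewrite mulr1 fmorphV rmorph_nat.
by apply: spanZ; exact: span1.
Qed.

Lemma zc_sum (I : Type) (s : seq I) (P : pred I) (F : I -> C) :
  (forall i, P i -> zc (F i)) -> zc (\sum_(i <- s | P i) F i).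
Proof. by move=> H; elim/big_rec: _ => [|i x /H]; [exact: zc0|exact: zcD]. Qed.

Lemma zideal0 : zideal 0. Proof. by exists 0; [exact: zc0|rewrite mulr0]. Qed.

Lemma zidealD x y : zideal x -> zideal y -> zideal (x + y).
Proof. by move=> [a ha ->] [b hb ->]; exists (a + b); [exact: zcD|ring]. Qed.

Lemma zidealM x y : zc x -> zideal y -> zideal (x * y).
Proof. by move=> hx [a ha ->]; exists (x * a); [exact: zcM|ring]. Qed.

Lemma zidealMr x y : zideal x -> zc y -> zideal (x * y).
Proof. by move=> hx hy; rewrite mulrC; exact: zidealM. Qed.

Lemma zideal_sum (I : Type) (s : seq I) (P : pred I) (F : I -> C) :
  (forall i, P i -> zideal (F i)) -> zideal (\sum_(i <- s | P i) F i).
Proof. by move=> H; elim/big_rec: _ => [|i x /H]; [exact: zideal0|exact: zidealD]. Qed.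

Lemma zideal_zc x : zideal x -> zc x.
Proof. by move=> [y hy ->]; apply: zcM => //; exact: zc_d. Qed.

(** The real part of [- pi i (a - pi i b)] is [- pi^2 b], a multiple of [zeta(2)]. *)
Lemma zideal_real x : zideal x%:C%C -> x \in @zeta2_ideal R.
Proof.
move=> [_ [a [b [ha hb ->]]] /(congr1 (@complex.Re R))]; rewrite /mpii; simpc => /= e.
apply/asboolP; exists (- (ratr 6 * b)); first by apply: spanN; exact: spanZ.
have := zeta2_pi; rewrite e (ratr_nat R 6) expr2 => h.
transitivity (- (pi * pi * b)); first by ring.
by rewrite h; ring.
Qed.

Definition zcong (x y : C) := zideal (x - y).

Lemma zcong_refl x : zcong x x. Proof. by rewrite /zcong subrr; exact: zideal0. Qed.

Lemma zcongM x x' y y' : zc x -> zc y' -> zcong x x' -> zcong y y' ->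
  zcong (x * y) (x' * y').
Proof.
move=> hx hy a b; rewrite /zcong (_ : _ - _ = x * (y - y') + (x - x') * y'); last by ring.
by apply: zidealD; [exact: zidealM|exact: zidealMr].
Qed.

Lemma zcong_sum (I : Type) (s : seq I) (P : pred I) (F G : I -> C) :
  (forall i, P i -> zcong (F i) (G i)) ->
  zcong (\sum_(i <- s | P i) F i) (\sum_(i <- s | P i) G i).
Proof. by move=> H; rewrite /zcong -sumrB; exact: zideal_sum. Qed.

Lemma zcD_cong x y : zcong x y -> zc y -> zc x.
Proof. by move=> /zideal_zc h hy; rewrite -(subrK y x); exact: zcD. Qed.

(** A shift of the argument by [- pi i] is invisible modulo [zideal]. *)
Lemma span_poly_cong (P : {poly R}) (t : C) : span_poly P -> t = 0 \/ t = d ->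
  zcong (cpoly P).[t] (P.[0])%:C%C.
Proof.
move=> SP [->|->]; first by rewrite -(rmorph0 (real_complex R)) cpolyE; exact: zcong_refl.
rewrite -cpolyE rmorph0 !horner_coef; apply: zcong_sum => i _.
rewrite /zcong -mulrBr; apply: zidealM; first by rewrite coef_map; exact: zc_real.
case: (nat_of_ord i) => [|j]; first by rewrite !expr0 subrr; exact: zideal0.
by rewrite expr0n subr0 exprS; exists (d ^+ j) => //; apply: zcX; exact: zc_d.
Qed.

Lemma horner0_span (P : {poly R}) : span_poly P -> @mzv_span R P.[0].
Proof. by move=> SP; rewrite horner_coef0. Qed.

Lemma zeta_S_star_repE l : is_index l ->
  zeta_S_star_rep R (rev l) =
  \sum_(i < (size l).+1) (-1) ^+ wt (take i l) *
    ((reg_poly_of R (rev (take i l))).[0] * (reg_poly_of R (drop i l)).[0]).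
Proof.
move=> hl; rewrite /zeta_S_star_rep /dep size_rev (reindex_inj rev_ord_inj)/=.
apply: eq_bigr => i _; have il : (i <= size l)%N by rewrite -ltnS.
rewrite subSS take_rev drop_rev subKn// revK.
have -> : wt (rev (take i l)) = wt (take i l) by rewrite /wt sumn_rev.
rewrite (@zeta_star_spec R _ (reg_poly_of R (drop i l))); last by rewrite revK; apply: reg_poly_ofP; exact: is_index_drop.
rewrite (@zeta_star_spec R _ (reg_poly_of R (rev (take i l)))); last first.
  by apply: reg_poly_ofP; rewrite is_index_rev; exact: is_index_take.
by rewrite -mulrA [in RHS]mulrC mulrC; congr (_ * _); rewrite mulrC.
Qed.

(** The constant terms of the regularization polynomials are the regularized values
    ([zeta_star_spec]), so the cut of the full chain reproduces, term by term, the sum that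
    defines the symmetric value. *)
Lemma chain_poly_cong (sl sh : {poly C}) l : is_index l ->
  sl.[0] = 0 \/ sl.[0] = d -> sh.[0] = 0 \/ sh.[0] = d ->
  zcong (chain_poly sl sh l).[0] (zeta_S_star_rep R (rev l))%:C%C.
Proof.
move=> hl hsl hsh; rewrite zeta_S_star_repE// rmorph_sum /chain_poly horner_sum.
apply: zcong_sum => i _; rewrite hornerZ hornerM !horner_comp rmorphM rmorphXn rmorphN rmorph1 /=.
have ht := is_index_take i hl; have hd := is_index_drop i hl.
have [St _] := @reg_poly_ofP R (rev (take i l)) (etrans (is_index_rev _) ht).
have [Sd _] := @reg_poly_ofP R _ hd.
have c1 := span_poly_cong St hsh; have c2' := span_poly_cong Sd hsl.
have z1 := zc_real (horner0_span St); have z2 := zc_real (horner0_span Sd).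
have z1' := zcD_cong c1 z1; have z2' := zcD_cong c2' z2.
rewrite rmorphM; apply: zcongM.
- exact: zc_sign.
- exact: zcM.
- exact: zcong_refl.
exact: zcongM.
Qed.

Lemma rep_span l : is_index l -> @mzv_span R (zeta_S_star_rep R (rev l)).
Proof.
move=> hl; rewrite zeta_S_star_repE//; apply: span_sum => i _.
have ht := is_index_take i hl; have hd := is_index_drop i hl.
have [St _] := @reg_poly_ofP R (rev (take i l)) (etrans (is_index_rev _) ht).
have [Sd _] := @reg_poly_ofP R _ hd.
apply: spanM; last by apply: spanM; exact: horner0_span.
by elim: (wt _) => [|n IH]; [exact: span1|rewrite exprS mulN1r; exact: spanN].
Qed.

(** ** The correction factors *)

(** [(- 2 pi i)^j / (j+1)!]. *)
Fixpoint corr_lim (j : nat) : C :=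
  if j is i.+1 then corr_lim i * (2 * d * i.+2%:R^-1) else 1.

Lemma corr_lim_zideal j : (0 < j)%N -> zideal (corr_lim j).
Proof.
have gz i : zc (corr_lim i).
  elim: i => [|i IH]; first exact: zc1.
  by apply: zcM => //; apply: zcM; [apply: zcM; [exact: zc_nat|exact: zc_d]|exact: zc_invn].
case: j => // j _; exists (corr_lim j * (2 * j.+2%:R^-1)); last by rewrite /=; ring.
by apply: zcM => //; apply: zcM; [exact: zc_nat|exact: zc_invn].
Qed.

(** The ratio of consecutive coefficients [binom(p, j+1) (1 - q)^j / p] is
    [(p - j - 1) (1 - q) / (j + 2)], where [p - 1 = 2N]. *)
Lemma corr_poly_asym j : asym (fun N => (corr_poly (q N) N.*2)`_j) (fun=> corr_lim j).
Proof.
have cE N i : (0 < N)%N -> (corr_poly (q N) N.*2)`_i =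
    'C(N.*2.+1, i.+1)%:R * (1 - q N) ^+ i / N.*2.+1%:R.
  move=> N0; apply: coef_corr_poly_root; [exact: qn_root_eq0|exact: qn_root_neq0|exact: Cnat_neq0].
have eps : asym (fun N => 1 - q N) (fun=> 0).
  exists 4, 0%N; split=> // N N0; rewrite subr0 expr0 mul1r; exact: cabs_1q_le.
elim: j => [|j IH].
  apply: (eq_asym _ _ (asym_refl (fun=> 1))) => N N0 //.
  by rewrite cE// bin1 expr0 mulr1 divff// Cnat_neq0.
have a1 : asym (fun N => (2 * (N%:R * (1 - q N)) - j%:R * (1 - q N)) * j.+2%:R^-1)
    (fun=> 2 * d * j.+2%:R^-1).
  apply: asymM; [|exact: asym_refl|exact: tame_cst|exact: tame_cst].
  have h1 := asymM (asym_refl (fun=> 2)) (@rootq_asym R) (tame_cst _) (tame_cst _).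
  have h2 := asymM (asym_refl (fun=> j%:R)) eps (tame_cst _) (tame_cst _).
  by apply: (eq_asym _ _ (asymD h1 (asymN h2))) => N _ //; rewrite mulr0 subr0.
apply: (eq_asym _ _ (asymM IH a1 (tame_cst _) (tame_cst _))) => N N0 //.
rewrite !cE// exprSr.
have p0 : N.*2.+1%:R != 0 :> C by exact: Cnat_neq0.
have j0 : j.+2%:R != 0 :> C by exact: Cnat_neq0.
have e : 'C(N.*2.+1, j.+2)%:R * j.+2%:R = 'C(N.*2.+1, j.+1)%:R * (2 * N%:R - j%:R) :> C.
  have h := mul_bin_left N.*2.+1 j.+1; rewrite -natrM mulnC h natrM mulrC.
  case: (leqP j.+1 N.*2.+1) => jN; last by rewrite bin_small// !mul0r.
  by rewrite natrB// -[N.*2.+1]add1n -[j.+1]add1n !natrD -mul2n natrM; ring.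
have -> : 'C(N.*2.+1, j.+2)%:R = 'C(N.*2.+1, j.+1)%:R * (2 * N%:R - j%:R) * j.+2%:R^-1 :> C.
  by rewrite -e mulfK.
by ring.
Qed.

(** ** Conclusion *)

Lemma asym_esum r m (u v : seq nat -> nat -> C) :
  (forall e, size e = r -> asym (u e) (v e)) ->
  asym (fun N => esum r m (fun e => u e N)) (fun N => esum r m (fun e => v e N)).
Proof.
elim: r m u v => [|r IH] m u v H /=.
  by case: (m == 0)%N; [exact: H|exact: asym_refl].
by apply: asym_sum => i _; apply: (IH _ (fun e => u (val i :: e)) (fun e => v (val i :: e))) => e se; apply: H; rewrite /= se.
Qed.

Lemma horner_esum r m (F : seq nat -> {poly C}) x :
  (esum r m F).[x] = esum r m (fun e => (F e).[x]).
Proof.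
elim: r m F => [|r IH] m F /=; first by case: (m == 0)%N; rewrite ?horner0.
by rewrite horner_sum; apply: eq_bigr => i _; rewrite IH.
Qed.

Lemma zcong_esum r m (F G : seq nat -> C) :
  (forall e, size e = r -> zcong (F e) (G e)) -> zcong (esum r m F) (esum r m G).
Proof.
elim: r m F G => [|r IH] m F G H /=.
  by case: (m == 0)%N; [exact: H|exact: zcong_refl].
by apply: zcong_sum => i _; apply: IH => e se; apply: H; rewrite /= se.
Qed.

Lemma zc_esum r m (F : seq nat -> C) :
  (forall e, size e = r -> zc (F e)) -> zc (esum r m F).
Proof.
elim: r m F => [|r IH] m F H /=; first by case: (m == 0)%N; [exact: H|exact: zc0].
by apply: zc_sum => i _; apply: IH => e se; apply: H; rewrite /= se.
Qed.

Lemma real_esum r m (F : seq nat -> R) :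
  (esum r m F)%:C%C = esum r m (fun e => (F e)%:C%C).
Proof.
elim: r m F => [|r IH] m F /=; first by case: (m == 0)%N.
by rewrite rmorph_sum; apply: eq_bigr => i _; exact: IH.
Qed.

Lemma Ta_diverges : diverges Ta.
Proof.
have [c H] := good_T1_harm (@good_qa R).
exact: (diverges_near H (@h_diverges R)).
Qed.

(** Along the root-of-unity family the exact duality says that the polynomial [D] below
    is small at the divergent argument [Ta], so [D = 0]; its constant term modulo [zideal]
    is the left side, which is real. *)
Theorem rep_duality k m : is_index k -> k != [::] ->
  esum (dep k) m (fun e => (c2 k e)%:R * zeta_S_star_rep R (oplus k e)) +
  esum (dep (hoffman_dual k)) m (fun e => zeta_S_star_rep R (oplus (hoffman_dual k) e))
  \in @zeta2_ideal R.
Proof.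
move=> hk k0; set k' := hoffman_dual k.
have hk' : is_index k' by rewrite /k' hoffman_dualE// hdual_pos.
pose LP e := chain_poly sD sX (rev (oplus k e)).
pose RP e := chain_poly sX sD (rev (oplus k' e)).
pose D : {poly C} := \sum_(i < m.+1) corr_lim i *:
   esum (dep k) (m - i) (fun e => (c2 k e)%:R *: LP e) + esum (dep k') m RP.
have tTa := good_tame (@good_qa R).
have D0 : D = 0.
  apply: (horner_small_eq0 Ta_diverges); apply: negl_small.
  have H : asym (fun N => \sum_(i < m.+1) (corr_poly (q N) N.*2)`_i *
      esum (dep k) (m - i) (fun e => (c2 k e)%:R *
        nsum false 0 N.*2 [seq bletter (q N) x | x <- rev (oplus k e)]) +
      esum (dep k') m (fun e => nsum false 0 N.*2 [seq aletter (q N) x | x <- rev (zip k' e)]))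
      (fun N => D.[Ta N]).
    rewrite /D; apply: (eq_asym (fun _ _ => erefl) (v := fun N =>
       \sum_(i < m.+1) corr_lim i * esum (dep k) (m - i) (fun e => (c2 k e)%:R * (LP e).[Ta N]) +
       esum (dep k') m (fun e => (RP e).[Ta N]))) => [N _|].
      rewrite hornerD horner_sum horner_esum; congr (_ + _); apply: eq_bigr => i _.
      rewrite hornerZ horner_esum; congr (_ * _); apply: eq_esum => e _ _.
      by rewrite hornerZ.
    apply: asymD.
      apply: asym_sum => i _; apply: asymM; [exact: corr_poly_asym| |exact: tame_cst|].
        apply: (@asym_esum _ _ (fun e N => (c2 k e)%:R *
          nsum false 0 N.*2 [seq bletter (q N) x | x <- rev (oplus k e)])
          (fun e N => (c2 k e)%:R * (LP e).[Ta N])) => e se.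
        apply: asymM; [exact: asym_refl| |exact: tame_cst|exact: tame_horner].
        by apply: bletter_asym; rewrite is_index_rev oplus_index.
      apply: (eq_tame _ (tame_horner (esum (dep k) (m - i) (fun e => (c2 k e)%:R *: LP e)) tTa)) => N _.
      by rewrite horner_esum; apply: eq_esum => e _ _; rewrite hornerZ.
    apply: (@asym_esum _ _ (fun e N =>
      nsum false 0 N.*2 [seq aletter (q N) x | x <- rev (zip k' e)])
      (fun e N => (RP e).[Ta N])) => e se.
    rewrite /RP /oplus -map_rev; apply: aletter_asym => x; rewrite mem_rev => xz.
    by apply: (mem_index hk'); have := map_f fst xz; rewrite -/unzip1 -/(unzip1 _) unzip1_zip ?se.
  apply: (eq_negl _ (asym_sym H)) => N N0.
  rewrite (@exact_duality C (q N) N.*2 k m)//; [|exact: qn_root_eq0|exact: qn_root_neq0].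
  by rewrite -/k' addNr subr0.
have rO l e : is_index l -> size e = size l -> is_index (rev (oplus l e)).
  by move=> hl se; rewrite is_index_rev oplus_index.
have sX0 : sX.[0] = 0 \/ sX.[0] = d by left; rewrite /sX hornerX.
have sD0 : sD.[0] = 0 \/ sD.[0] = d by right; rewrite /sD hornerD hornerX hornerC add0r.
have cL e : size e = dep k -> zcong (LP e).[0] (zeta_S_star_rep R (oplus k e))%:C%C.
  by move=> se; rewrite -[oplus k e]revK; apply: chain_poly_cong => //; exact: rO.
have cR e : size e = dep k' -> zcong (RP e).[0] (zeta_S_star_rep R (oplus k' e))%:C%C.
  by move=> se; rewrite -[oplus k' e]revK; apply: chain_poly_cong => //; exact: rO.
have zL e : size e = dep k -> zc (LP e).[0].
  move=> se; apply: (zcD_cong (cL e se)); rewrite -[oplus k e]revK; apply: zc_real.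
  by apply: rep_span; exact: rO.
apply: zideal_real; rewrite rmorphD /= !real_esum.
have E := congr1 (fun f => f.[0]) D0.
rewrite /D hornerD horner_sum horner_esum horner0 big_ord_recl in E.
(* the terms with a positive power of [- pi i] from the correction factor *)
pose A := \sum_(i < m) (corr_lim (lift ord0 i) *: esum (dep k) (m - lift ord0 i) (fun e => (c2 k e)%:R *: LP e)).[0].
have zA : zideal A.
  apply: zideal_sum => i _; rewrite hornerZ horner_esum; apply: zidealMr; first exact: corr_lim_zideal.
  apply: zc_esum => e se; rewrite hornerZ; apply: zcM; [exact: zc_nat|exact: zL].
set B := esum (dep k') m (fun e => (RP e).[0]) in E.
set A0 := (corr_lim ord0 *: _).[0] in E.
have cA0 : zcong A0 (esum (dep k) m (fun e => ((c2 k e)%:R * zeta_S_star_rep R (oplus k e))%:C%C)).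
  rewrite /A0 hornerZ mul1r subn0 horner_esum; apply: zcong_esum => e se.
  rewrite hornerZ rmorphM rmorph_nat; apply: zcongM; [exact: zc_nat| |exact: zcong_refl|exact: cL].
  by apply: zc_real; rewrite -[oplus k e]revK; apply: rep_span; exact: rO.
have cB : zcong B (esum (dep k') m (fun e => (zeta_S_star_rep R (oplus k' e))%:C%C)).
  by apply: zcong_esum.
move: E cA0 cB; rewrite -/A; set u := esum _ _ _; set v := esum _ _ _ => E [x1 h1 e1] [x2 h2 e2].
have -> : u + v = - (1 : C) * (A + ((A0 - u) + (B - v))).
  transitivity (u + v - (A0 + A + B)); last by ring.
  by rewrite [A0 + A + B]E subr0.
apply: zidealM; first by have := zc_sign 1; rewrite expr1.
apply: zidealD => //; apply: zidealD; [by exists x1|by exists x2].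
Qed.

Local Open Scope quotient_scope.

Theorem duality_S k m : is_index k -> k != [::] ->
  \sum_(e : (dep k).-tuple 'I_m.+1 | wt (vals e) == m)
    zeta_S_star R (oplus k (vals e)) *+ c2 k (vals e) =
  - \sum_(e : (dep (hoffman_dual k)).-tuple 'I_m.+1 | wt (vals e) == m)
      zeta_S_star R (oplus (hoffman_dual k) (vals e)).
Proof.
move=> hk k0.
pose u : R := \sum_(e : (dep k).-tuple 'I_m.+1 | wt (vals e) == m)
    zeta_S_star_rep R (oplus k (vals e)) *+ c2 k (vals e).
pose v : R := \sum_(e : (dep (hoffman_dual k)).-tuple 'I_m.+1 | wt (vals e) == m)
    zeta_S_star_rep R (oplus (hoffman_dual k) (vals e)).
transitivity (\pi_(Quotient.quot (@zeta2_ideal R)) u : calS R).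
  by rewrite raddf_sum; apply: eq_bigr => e _; rewrite raddfMn.
transitivity (\pi_(Quotient.quot (@zeta2_ideal R)) (- v) : calS R); last first.
  by rewrite raddfN raddf_sum.
apply/eqP; rewrite -Quotient.idealrBE opprK.
have := rep_duality m hk k0; rewrite -!(esumE _ _ (leqnn m)).
rewrite /u; under [X in _ -> X + _ \in _]eq_bigr => e _ do rewrite -mulr_natl.
by [].
Qed.

End Symmetric.

(* The components of e are at most wt(e) = m, hence e ranges over tuples of
   elements of 'I_m.+1. *)
Theorem theorem1p12 (R : realType) (F : flavour) (k : seq nat) (m : nat) :
  is_index k -> k <> [::] ->
  \sum_(e : (dep k).-tuple 'I_m.+1 | wt (vals e) == m)
    zeta_F_star R F (oplus k (vals e)) *+ c2 k (vals e) =
  - \sum_(e : (dep (hoffman_dual k)).-tuple 'I_m.+1 | wt (vals e) == m)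
      zeta_F_star R F (oplus (hoffman_dual k) (vals e)).
Proof.
move=> hk /eqP k0; case: F; first exact: duality_A.
exact: duality_S.
Qed.
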